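(* Pro-Lie Polish abelian groups form a thick subcategory $\mathbf{proLiePAb}$ of the category $\mathbf{PAb}$ of Polish abelian groups and continuous group homomorphisms.
   Context: A Polish abelian group is an abelian topological group whose topology is Polish. An abelian Polish Lie group is a Polish abelian group isomorphic to $\mathbb{R}^{n}\oplus \mathbb{T}^{d}\oplus D$ with $n,d\in\omega$ and $D$ countable discrete. A Polish abelian group $G$ is pro-Lie if every neighborhood of $0$ in $G$ contains a closed subgroup $N$ such that $G/N$ is a Lie group. $\mathbf{proLiePAb}$ is the full subcategory of $\mathbf{PAb}$ spanned by the pro-Lie Polish abelian groups. A quasi-abelian category is a finitely complete and finitely cocomplete additive category in which push-outs of kernels along arbitrary morphisms are kernels and pull-backs of cokernels along arbitrary morphisms are cokernels; its short exact sequences are the kernel-cokernel pairs. $\mathbf{PAb}$ is quasi-abelian; its short exact sequences are the sequences $0\to A\to B\to C\to 0$ of continuous homomorphisms that are algebraically exact with $A\to B$ having closed image (so $A\to B$ is a closed embedding and $B\to C$ is an open surjection). A full subcategory $\mathcal{B}$ of a quasi-abelian category $\mathcal{A}$ is thick if $\mathcal{B}$ is itself quasi-abelian, the inclusion $\mathcal{B}\to\mathcal{A}$ preserves finite limits and finite colimits, and $\mathcal{B}$ is closed under extensions: whenever $0\to B'\to A\to B''\to 0$ is a short exact sequence in $\mathcal{A}$ with $B',B''$ in $\mathcal{B}$, then $A$ is isomorphic to an object of $\mathcal{B}$. *)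

(* Defs.v *)
From HB Require Import structures.
From mathcomp Require Import all_boot all_order all_algebra.
From mathcomp Require Import generic_quotient ring_quotient.
From mathcomp Require Import all_classical all_reals all_analysis.

Set Implicit Arguments.
Unset Strict Implicit.
Unset Printing Implicit Defensive.

Import numFieldNormedType.Exports.

Local Open Scope classical_set_scope.
Local Open Scope ring_scope.

Declare Scope cat_scope.
Delimit Scope cat_scope with cat.

Record category : Type := Category {
  obj : Type;
  hom : obj -> obj -> Type;
  idm : forall a, hom a a;
  comp : forall x y z, hom y z -> hom x y -> hom x z;
  compA : forall a b c d (h : hom c d) (g : hom b c) (f : hom a b),
    comp h (comp g f) = comp (comp h g) f;
  comp1m : forall a b (f : hom a b), comp (idm b) f = f;
  compm1 : forall a b (f : hom a b), comp f (idm a) = f }.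

Arguments hom {C} a b : rename.
Arguments idm {C} a : rename.
Arguments comp {C x y z} g f : rename.

Notation "g \oc f" := (comp g f) (at level 50, left associativity) : cat_scope.
Local Open Scope cat_scope.

Record functor (J C : category) := Functor {
  fobj :> obj J -> obj C;
  fmap : forall i j, hom i j -> hom (fobj i) (fobj j);
  fmap1 : forall i, fmap (idm i) = idm (fobj i);
  fmapM : forall i j k (v : hom j k) (u : hom i j),
    fmap (v \oc u) = fmap v \oc fmap u }.

Section FunctorComposition.
Variables (J C D : category) (F : functor C D) (G : functor J C).

Lemma functor_comp1 i : fmap F (fmap G (idm i)) = idm (F (G i)).
Proof. by rewrite !fmap1. Qed.

Lemma functor_compM i j k (v : hom j k) (u : hom i j) :
  fmap F (fmap G (v \oc u)) = fmap F (fmap G v) \oc fmap F (fmap G u).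
Proof. by rewrite !fmapM. Qed.

Definition functor_comp : functor J D :=
  @Functor J D (fun i => F (G i)) (fun i j u => fmap F (fmap G u))
    functor_comp1 functor_compM.

End FunctorComposition.

Section FullSubcategory.
Variables (A : category) (P : obj A -> Prop).

Definition full_subcat : category := @Category {a : obj A | P a}
  (fun a b => @hom A (sval a) (sval b)) (fun a => idm (sval a))
  (fun a b c g f => @comp A (sval a) (sval b) (sval c) g f)
  (fun a b c d h g f => compA h g f) (fun a b f => comp1m f)
  (fun a b f => compm1 f).

Definition inclusion : functor full_subcat A :=
  @Functor full_subcat A (fun a : obj full_subcat => sval a)
    (fun a b f => f) (fun a => erefl) (fun a b c v u => erefl).

End FullSubcategory.

(* Indexing by finTypes rather than by a finiteness predicate on [category]   *)
(* keeps the index categories in a small universe: [obj TopAb] is large.      *)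
Record finite_category : Type := FiniteCategory {
  fin_obj : finType;
  fin_hom : fin_obj -> fin_obj -> finType;
  fin_idm : forall a, fin_hom a a;
  fin_comp : forall x y z, fin_hom y z -> fin_hom x y -> fin_hom x z;
  fin_compA : forall a b c d
      (h : fin_hom c d) (g : fin_hom b c) (f : fin_hom a b),
    fin_comp h (fin_comp g f) = fin_comp (fin_comp h g) f;
  fin_comp1m : forall a b (f : fin_hom a b), fin_comp (fin_idm b) f = f;
  fin_compm1 : forall a b (f : fin_hom a b), fin_comp f (fin_idm a) = f }.

Coercion category_of_finite (J : finite_category) : category :=
  @Category (fin_obj J) (@fin_hom J) (@fin_idm J) (@fin_comp J)
    (@fin_compA J) (@fin_comp1m J) (@fin_compm1 J).

Section LimitsColimits.
Variables (J C : category) (F : functor J C).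

Record cone := Cone {
  cone_apex : obj C;
  cone_leg : forall j, hom cone_apex (F j);
  cone_comm : forall j k (u : hom j k), fmap F u \oc cone_leg j = cone_leg k }.

Definition is_limit (l : cone) : Prop :=
  forall c : cone, exists! h : hom (cone_apex c) (cone_apex l),
    forall j, cone_leg l j \oc h = cone_leg c j.

Record cocone := Cocone {
  cocone_apex : obj C;
  cocone_leg : forall j, hom (F j) cocone_apex;
  cocone_comm : forall j k (u : hom j k),
    cocone_leg k \oc fmap F u = cocone_leg j }.

Definition is_colimit (l : cocone) : Prop :=
  forall c : cocone, exists! h : hom (cocone_apex l) (cocone_apex c),
    forall j, h \oc cocone_leg l j = cocone_leg c j.

End LimitsColimits.

Definition finitely_complete (C : category) : Prop :=
  forall (J : finite_category) (F : functor J C),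
    exists l : cone F, is_limit l.

Definition finitely_cocomplete (C : category) : Prop :=
  forall (J : finite_category) (F : functor J C),
    exists l : cocone F, is_colimit l.

Section Preservation.
Variables (C D : category) (F : functor C D).

Section Image.
Variables (J : category) (G : functor J C).

Lemma map_cone_comm (c : cone G) j k (u : hom j k) :
  fmap (functor_comp F G) u \oc fmap F (cone_leg c j) = fmap F (cone_leg c k).
Proof. by rewrite /= -fmapM cone_comm. Qed.

Definition map_cone (c : cone G) : cone (functor_comp F G) :=
  @Cone J D (functor_comp F G) (F (cone_apex c))
    (fun j => fmap F (cone_leg c j)) (map_cone_comm c).

Lemma map_cocone_comm (c : cocone G) j k (u : hom j k) :
  fmap F (cocone_leg c k) \oc fmap (functor_comp F G) u =
    fmap F (cocone_leg c j).
Proof. by rewrite /= -fmapM cocone_comm. Qed.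

Definition map_cocone (c : cocone G) : cocone (functor_comp F G) :=
  @Cocone J D (functor_comp F G) (F (cocone_apex c))
    (fun j => fmap F (cocone_leg c j)) (map_cocone_comm c).

End Image.

Definition preserves_finite_limits : Prop :=
  forall (J : finite_category) (G : functor J C) (l : cone G),
    is_limit l -> is_limit (map_cone l).

Definition preserves_finite_colimits : Prop :=
  forall (J : finite_category) (G : functor J C) (l : cocone G),
    is_colimit l -> is_colimit (map_cocone l).

End Preservation.

Section QuasiAbelian.
Variable C : category.
Implicit Types a b c d x y z : obj C.

Definition isomorphic a b : Prop :=
  exists (f : hom a b) (g : hom b a), g \oc f = idm a /\ f \oc g = idm b.

Definition is_zero_object z : Prop :=
  forall a, (exists! f : hom a z, True) /\ (exists! f : hom z a, True).

(* This needs no additive structure; in an additive category these are the   *)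
(* zeros of the hom groups.                                                   *)
Definition is_zero_morphism a b (f : hom a b) : Prop :=
  exists z (u : hom a z) (v : hom z b), is_zero_object z /\ f = v \oc u.

Definition is_kernel_of a b c (f : hom b c) (k : hom a b) : Prop :=
  is_zero_morphism (f \oc k) /\
  forall y (u : hom y b), is_zero_morphism (f \oc u) ->
    exists! h : hom y a, k \oc h = u.

Definition is_cokernel_of a b c (f : hom a b) (q : hom b c) : Prop :=
  is_zero_morphism (q \oc f) /\
  forall y (u : hom b y), is_zero_morphism (u \oc f) ->
    exists! h : hom c y, h \oc q = u.

Definition is_kernel a b (k : hom a b) : Prop :=
  exists c (f : hom b c), is_kernel_of f k.

Definition is_cokernel b c (q : hom b c) : Prop :=
  exists a (f : hom a b), is_cokernel_of f q.

Definition short_exact a b c (i : hom a b) (p : hom b c) : Prop :=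
  is_kernel_of p i /\ is_cokernel_of i p.

Definition is_pullback a b c x (f : hom a c) (g : hom b c)
    (p : hom x a) (q : hom x b) : Prop :=
  f \oc p = g \oc q /\
  forall y (u : hom y a) (v : hom y b), f \oc u = g \oc v ->
    exists! h : hom y x, p \oc h = u /\ q \oc h = v.

Definition is_pushout a b c x (f : hom c a) (g : hom c b)
    (i : hom a x) (j : hom b x) : Prop :=
  i \oc f = j \oc g /\
  forall y (u : hom a y) (v : hom b y), u \oc f = v \oc g ->
    exists! h : hom x y, h \oc i = u /\ h \oc j = v.

Record preadditive_structure := Preadditive {
  hadd : forall a b, hom a b -> hom a b -> hom a b;
  hzero : forall a b, hom a b;
  hopp : forall a b, hom a b -> hom a b;
  haddA : forall a b, associative (@hadd a b);
  haddC : forall a b, commutative (@hadd a b);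
  hadd0 : forall a b, left_id (@hzero a b) (@hadd a b);
  haddN : forall a b, left_inverse (@hzero a b) (@hopp a b) (@hadd a b);
  compDl : forall a b c (g g' : hom b c) (f : hom a b),
    hadd g g' \oc f = hadd (g \oc f) (g' \oc f);
  compDr : forall a b c (g : hom b c) (f f' : hom a b),
    g \oc hadd f f' = hadd (g \oc f) (g \oc f') }.

Definition is_biproduct (S : preadditive_structure) a b x
    (i : hom a x) (j : hom b x) (p : hom x a) (q : hom x b) : Prop :=
  [/\ p \oc i = idm a, q \oc j = idm b,
      p \oc j = hzero S b a, q \oc i = hzero S a b
    & hadd S (i \oc p) (j \oc q) = idm x].

Definition additive_category : Prop :=
  exists S : preadditive_structure,
    (exists z, is_zero_object z) /\
    (forall a b, exists x i j p q, @is_biproduct S a b x i j p q).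

Definition quasi_abelian : Prop :=
  [/\ additive_category, finitely_complete C, finitely_cocomplete C,
      forall a b c x (k : hom c a) (g : hom c b) (i : hom a x) (j : hom b x),
        is_kernel k -> is_pushout k g i j -> is_kernel j
    & forall a b c x (e : hom a c) (g : hom b c) (p : hom x a) (q : hom x b),
        is_cokernel e -> is_pullback e g p q -> is_cokernel q].

End QuasiAbelian.

Definition extension_closed (A : category) (P : obj A -> Prop) : Prop :=
  forall (b' a b'' : obj A) (i : hom b' a) (p : hom a b''),
    short_exact i p -> P b' -> P b'' ->
    exists b : obj A, P b /\ isomorphic a b.

Definition thick_subcategory (A : category) (P : obj A -> Prop) : Prop :=
  [/\ quasi_abelian (full_subcat P),
      preserves_finite_limits (inclusion P),
      preserves_finite_colimits (inclusion P)
    & extension_closed P].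

#[short(type="completeMetricType")]
HB.structure Definition CompleteMetric (K : numDomainType) :=
  {M of Metric K M & Complete M}.

Definition homeomorphic (T U : topologicalType) : Prop :=
  exists (f : T -> U) (g : U -> T),
    [/\ continuous f, continuous g, cancel f g & cancel g f].

Definition separable_space (T : topologicalType) : Prop :=
  exists2 D : set T, countable D & dense D.

Definition polish (R : realType) (T : topologicalType) : Prop :=
  separable_space T /\ exists M : completeMetricType R, homeomorphic T M.

Record cont_hom (G H : topologicalZmodType) := ContHom {
  cont_hom_fun :> G -> H;
  cont_hom_morph : GRing.zmod_morphism cont_hom_fun;
  cont_hom_continuous : continuous cont_hom_fun }.

Lemma cont_hom_ext (G H : topologicalZmodType) (f g : cont_hom G H) :
  f =1 g -> f = g.
Proof.
case: f g => [f fm fc] [g gm gc] /= /funext fg; subst g.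
by congr ContHom; exact: Prop_irrelevance.
Qed.

Section ContHomOps.
Variables G H K : topologicalZmodType.

Lemma cont_hom_id_morph : GRing.zmod_morphism (@idfun G).
Proof. by []. Qed.

Lemma cont_hom_id_continuous : continuous (@idfun G).
Proof. by move=> x. Qed.

Definition cont_hom_id : cont_hom G G :=
  ContHom cont_hom_id_morph cont_hom_id_continuous.

Variables (g : cont_hom H K) (f : cont_hom G H).

Lemma cont_hom_comp_morph : GRing.zmod_morphism (g \o f).
Proof. by move=> x y /=; rewrite !cont_hom_morph. Qed.

Lemma cont_hom_comp_continuous : continuous (g \o f).
Proof.
by move=> x; apply: continuous_comp; exact: cont_hom_continuous.
Qed.

Definition cont_hom_comp : cont_hom G K :=
  ContHom cont_hom_comp_morph cont_hom_comp_continuous.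

End ContHomOps.

Lemma cont_hom_compA (G H K L : topologicalZmodType)
    (h : cont_hom K L) (g : cont_hom H K) (f : cont_hom G H) :
  cont_hom_comp h (cont_hom_comp g f) = cont_hom_comp (cont_hom_comp h g) f.
Proof. exact: cont_hom_ext. Qed.

Lemma cont_hom_comp1m (G H : topologicalZmodType) (f : cont_hom G H) :
  cont_hom_comp (cont_hom_id H) f = f.
Proof. exact: cont_hom_ext. Qed.

Lemma cont_hom_compm1 (G H : topologicalZmodType) (f : cont_hom G H) :
  cont_hom_comp f (cont_hom_id G) = f.
Proof. exact: cont_hom_ext. Qed.

Definition TopAb : category := @Category topologicalZmodType cont_hom
  cont_hom_id cont_hom_comp cont_hom_compA cont_hom_comp1m cont_hom_compm1.

Definition PAb (R : realType) : category :=
  full_subcat (fun G : obj TopAb => polish R (G : topologicalZmodType)).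

HB.instance Definition _ (V : PreTopologicalZmodule.type) m n :=
  Topological.on 'M[V]_(m, n).
HB.instance Definition _ (V W : PreTopologicalZmodule.type) :=
  Topological.on (V * W)%type.

Definition topgroup_isomorphic (G H : PreTopologicalZmodule.type) : Prop :=
  exists (f : G -> H) (g : H -> G),
    [/\ GRing.zmod_morphism f, continuous f, continuous g, cancel f g & cancel g f].

(* G / N with the quotient topology. The group laws are those of              *)
(* [Quotient.quot N]; they are transported by hand because                    *)
(* [quotient_topology] carries its own choiceType structure.                  *)
Section QuotientGroup.
Variables (G : PreTopologicalZmodule.type) (N : zmodClosed G).

Definition quotient_group : Type := quotient_topology (Quotient.quot N).

HB.instance Definition _ := Topological.on quotient_group.
HB.instance Definition _ := GRing.isZmodule.Build quotient_group
  (@GRing.addrA (Quotient.quot N)) (@GRing.addrC (Quotient.quot N))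
  (@GRing.add0r (Quotient.quot N)) (@GRing.addNr (Quotient.quot N)).

End QuotientGroup.

(* The subgroup Z of R: [Num.int_num_subdef] is the predicate under the       *)
(* qualifier [Num.int].                                                       *)
Definition integers (R : realType) : zmodClosed R :=
  GRing.ZmodClosed.clone R (@Num.int_num_subdef R) _.

Definition torus (R : realType) : Type := quotient_group (integers R).
HB.instance Definition _ (R : realType) := PreTopologicalZmodule.on (torus R).

Definition abelian_lie (R : realType) (G : PreTopologicalZmodule.type) : Prop :=
  exists (n d : nat) (D : topologicalZmodType),
    [/\ countable [set: D], forall x : D, open [set x]
      & topgroup_isomorphic G ('rV[R]_n * 'rV[torus R]_d * D)%type].

Definition pro_lie (R : realType) (G : topologicalZmodType) : Prop :=
  forall U : set G, nbhs 0 U -> exists N : zmodClosed G,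
    [/\ closed [set x | x \in N], [set x | x \in N] `<=` U
      & abelian_lie R (quotient_group N)].

Definition proLie (R : realType) (G : obj (PAb R)) : Prop :=
  pro_lie R (sval G : topologicalZmodType).

(* Main.v *)
Require Import Defs.
From HB Require Import structures.
From mathcomp Require Import all_boot all_order all_algebra.
From mathcomp Require Import generic_quotient ring_quotient.
From mathcomp Require Import all_classical all_reals all_analysis.
From mathcomp Require Import ring lra zify.

Set Implicit Arguments.
Unset Strict Implicit.
Unset Printing Implicit Defensive.

Import Order.TTheory GRing.Theory Num.Theory numFieldNormedType.Exports.

Local Open Scope classical_set_scope.
Local Open Scope ring_scope.

(* The subcategory is thick because the class of pro-Lie Polish abelian groups
   is closed under closed subgroups, Hausdorff quotients, finite products and
   extensions: finite limits and colimits are the closed subgroups and the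
   quotients of finite products familiar from PAb, kernels are the closed
   embeddings and cokernels are the open surjections.

   A Polish abelian group is the same as a separable Hausdorff first countable
   group whose Cauchy sequences converge (Klee's theorem), and an abelian Lie
   group is replaced by an open homomorphic image e : R^n -> A near 0.

   Closed subgroups H of G: embed G in a sequence of Lie quotients p_k. The Lie
   algebras of the closures of p_k H, seen as decreasing images in R^n, become
   stationary, and completeness lifts their vectors to one-parameter subgroups
   of H, which exhaust a neighbourhood of 0 in the closure of p_0 H.

   Extensions 0 -> K -> G -> C -> 0: dividing by a small subgroup of K makes K
   a Lie group. A section s : Q -> G over a small subgroup Q of C is additive
   up to an error in the chart of K, so that Hyers' method corrects it into a
   homomorphism; dividing by its image makes C a Lie group as well, and then
   the chart of C lifts to G in the same way. *)

(** The image of a closed subgroup H in a Lie quotient of G need not be closed: for G = R^N, the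
    group Z^2 can be embedded as a discrete subgroup whose first coordinates are dense. So H modulo
    a small subgroup is not visibly a closed subgroup of a Lie group, and smallness of an element of
    H has to be tested in a later quotient than the one in which it is lifted to a line. The finite
    dimension of the charts bounds how much later, and kernels are made to decrease by the absence
    of small subgroups in Lie groups.

    For extensions, Hyers' correction is purely algebraic: it yields a homomorphism close to the
    section, whose continuity needs a second doubling argument. Both arguments use that chart
    vectors are unique near 0, which is why the constants compare six small vectors with the radius
    of injectivity.

    Lie groups carry no countability until the very end, where separability of the Polish quotients
    restores it. Limits in the subcategory are compared with those of the ambient category through
    explicit constructions, as all objects are known only up to isomorphism. *)

Section HomTheory.
Variables (G H : topologicalZmodType) (f : cont_hom G H).

Lemma homB x y : f (x - y) = f x - f y. Proof. exact: cont_hom_morph. Qed.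

Lemma hom0 : f 0 = 0. Proof. by rewrite -(subrr 0) homB subrr. Qed.

Lemma homN x : f (- x) = - f x. Proof. by rewrite -sub0r homB hom0 sub0r. Qed.

Lemma homD x y : f (x + y) = f x + f y.
Proof. by rewrite -[y in LHS]opprK homB homN opprK. Qed.

Lemma homMn x n : f (x *+ n) = f x *+ n.
Proof. by elim: n => [|n IHn]; rewrite ?mulr0n ?hom0// !mulrS homD IHn. Qed.

Lemma homMz x n : f (x *~ n) = f x *~ n.
Proof. by case: n => n; rewrite ?NegzE ?mulrNz ?homN -?pmulrn homMn. Qed.

Lemma hom_sum (I : Type) (r : seq I) (P : pred I) (F : I -> G) :
  f (\sum_(i <- r | P i) F i) = \sum_(i <- r | P i) f (F i).
Proof. by elim/big_ind2: _ => // [|_ x _ y <- <-]; rewrite ?hom0 ?homD. Qed.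

End HomTheory.

(** * A reflexive decision procedure for identities in abelian groups *)

Module ZmodEq.

Inductive expr := Var of nat | Add of expr & expr | Opp of expr | Zero.

Fixpoint eval (M : zmodType) (env : seq M) e : M :=
  match e with
  | Var n => env`_n | Add a b => eval env a + eval env b
  | Opp a => - eval env a | Zero => 0
  end.

(* The pair (p, n) stands for the coefficient p - n. *)
Fixpoint coef (e : expr) (i : nat) : nat * nat :=
  match e with
  | Var n => (if Nat.eqb n i then 1%N else 0%N, 0%N)
  | Add a b => let: (p, n) := coef a i in let: (q, m) := coef b i in
      (Nat.add p q, Nat.add n m)
  | Opp a => let: (p, n) := coef a i in (n, p)
  | Zero => (0%N, 0%N)
  end.

Fixpoint bounded k (e : expr) : bool :=
  match e with
  | Var n => Nat.ltb n k | Add a b => bounded k a && bounded k b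
  | Opp a => bounded k a | Zero => true
  end.

(** Comparing p + m with q + n decides p - n = q - m inside the natural numbers. *)
Fixpoint check k (e f : expr) : bool :=
  if k is k'.+1 then let: (p, n) := coef e k' in let: (q, m) := coef f k' in
    Nat.eqb (Nat.add p m) (Nat.add q n) && check k' e f
  else true.

Lemma evalE (M : zmodType) (env : seq M) e : bounded (size env) e ->
  eval env e = \sum_(i < size env) (env`_i *+ (coef e i).1 - env`_i *+ (coef e i).2).
Proof.
elim: e => [n|a IHa b IHb|a IHa|] /=.
- move=> /PeanoNat.Nat.ltb_lt nk.
  have nk' : (n < size env)%N by apply/ssrnat.ltP.
  rewrite (bigD1 (Ordinal nk')) //= PeanoNat.Nat.eqb_refl big1 => [|i ni].
    by rewrite addr0 mulr1n mulr0n subr0.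
  case: (PeanoNat.Nat.eqb_spec n i) => [E|_]; last by rewrite subr0.
  by case/eqP: ni; apply/val_inj.
- move=> /andP[/IHa -> /IHb ->]; rewrite -big_split; apply: eq_bigr => i _ /=.
  case: (coef a i) (coef b i) => p n [q m] /=.
  by rewrite !mulrnDr opprD addrACA.
- move=> /IHa ->; rewrite -sumrN; apply: eq_bigr => i _ /=.
  by case: (coef a i) => p n /=; rewrite opprB.
- by move=> _; rewrite big1 // => i _; rewrite subr0.
Qed.

Lemma check_sound (M : zmodType) (env : seq M) e f :
  [&& bounded (size env) e, bounded (size env) f & check (size env) e f] ->
  eval env e = eval env f.
Proof.
move=> /and3P[be bf]; rewrite (evalE be) (evalE bf) => ch.
apply: eq_bigr => i _.
have : check i.+1 e f.
  elim: (size env) i ch => [[]//|k IHk] i ch.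
  have [->//|ik] := eqVneq (i : nat) k.
  have ik' : (i < k)%N by rewrite ltn_neqAle ik -ltnS ltn_ord.
  apply: (IHk (Ordinal ik')); move: ch => /=.
  by case: (coef e k) (coef f k) => p n [q m] /andP[].
rewrite /=; case: (coef e i) (coef f i) => p n [q m] /= /andP[].
move=> /PeanoNat.Nat.eqb_eq pq _; apply/eqP.
rewrite subr_eq addrAC eq_sym subr_eq -!mulrnDr.
by rewrite (_ : (q + n)%N = (p + m)%N).
Qed.

(** Atoms are compared by [unify], so convertible terms that look different become one variable. The
    [match tt] wrappers run [unify] while a term is being returned and turn its failure into the
    next branch. *)
Ltac inlist x l :=
  lazymatch l with
  | nil => constr:(false)
  | cons ?y ?l' => match tt with
    | _ => let _ := match tt with _ => unify x y end in constr:(true)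
    | _ => inlist x l'
    end
  end.
Ltac idx x l :=
  lazymatch l with
  | cons ?y ?l' => match tt with
    | _ => let _ := match tt with _ => unify x y end in constr:(0%N)
    | _ => let n := idx x l' in constr:(S n)
    end
  end.
Ltac vars M l t :=
  lazymatch t with
  | (?a + ?b)%R => let l' := vars M l a in vars M l' b
  | (- ?a)%R => vars M l a
  | 0%R => l
  | _ => let b := inlist t l in
    lazymatch b with true => l | false => constr:(@cons M t l) end
  end.
Ltac reify l t :=
  lazymatch t with
  | (?a + ?b)%R => let a' := reify l a in let b' := reify l b in constr:(Add a' b')
  | (- ?a)%R => let a' := reify l a in constr:(Opp a')
  | 0%R => constr:(Zero)
  | _ => let n := idx t l in constr:(Var n)
  end.

End ZmodEq.

(* [ring] does not apply to a bare zmodType. *)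
Ltac zmod :=
  rewrite ?homB ?homD ?homN ?hom0;
  lazymatch goal with
  | |- @eq ?M ?a ?b =>
    let l := ZmodEq.vars M (@nil M) a in let l := ZmodEq.vars M l b in
    let e := ZmodEq.reify l a in let f := ZmodEq.reify l b in
    exact: (@ZmodEq.check_sound _ l e f isT)
  end.

(** * Topological abelian groups described by the neighbourhoods of 0 *)

Definition separated (G : topologicalZmodType) :=
  forall x : G, (forall V, nbhs 0 V -> V x) -> x = 0.

Definition subgroup (G : zmodType) (N : set G) :=
  N 0 /\ forall x y, N x -> N y -> N (x - y).

Definition gclosed (G : topologicalZmodType) (N : set G) :=
  forall x, (forall V, nbhs 0 V -> exists2 y, N y & V (y - x)) -> N x.

Definition gclosure (G : topologicalZmodType) (N : set G) : set G :=
  [set x | forall V, nbhs 0 V -> exists2 y, N y & V (y - x)].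

(** A homeomorphism onto its image, which may fail to be closed; closedness is stated separately as
    [gclosed (range i)]. *)
Definition embedding (G H : topologicalZmodType) (i : cont_hom G H) :=
  injective i /\
  forall V, nbhs 0 V -> exists2 W, nbhs 0 W & forall x, W (i x) -> V x.

Definition open_surj (G H : topologicalZmodType) (q : cont_hom G H) :=
  (forall y, exists x, q x = y) /\
  forall V, nbhs 0 V -> nbhs 0 (q @` V).

Section Subgroups.
Variable A : zmodType.
Implicit Type N : set A.

Lemma subgroupN N x : subgroup N -> N x -> N (- x).
Proof. by move=> [N0 NB] Nx; rewrite -sub0r; exact: NB. Qed.

Lemma subgroupD N x y : subgroup N -> N x -> N y -> N (x + y).
Proof.
by move=> sN Nx Ny; rewrite -[y]opprK; apply sN.2 => //; exact: subgroupN.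
Qed.

End Subgroups.

Section TopGroup.
Variable G : topologicalZmodType.
Implicit Types (x y : G) (U V W : set G).

Lemma nbhs_transl x V : nbhs x V <-> nbhs 0 (fun y => V (x + y)).
Proof.
have addc (a b : G) : (a + z) @[z --> b] --> a + b.
  apply: (@cvg_comp _ _ _ (fun z => (a, z)) (fun p : G * G => p.1 + p.2) _
    (nbhs (a, b))); last exact: (@add_continuous G (a, b)).
  by apply: cvg_pair => /=; [exact: cvg_cst|exact: cvg_id].
split=> [xV|V0].
  by have := addc x 0 V; rewrite addr0; exact.
have := addc (- x) x (fun y => V (x + y)); rewrite addNr => /(_ V0).
move=> h; have {}h : nbhs x (fun y => V (x + (- x + y))) := h.
by apply: filterS h => y /=; rewrite addrA subrr add0r.
Qed.

Lemma nbhs0_opp V : nbhs 0 V -> nbhs 0 (fun x => V (- x)).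
Proof. by move=> V0; have := @opp_continuous G 0 V; rewrite oppr0; apply. Qed.

Lemma nbhs0_sym V : nbhs 0 V -> exists W, [/\ nbhs 0 W,
  forall x, W x -> W (- x), forall x y, W x -> W y -> V (x + y) & W `<=` V].
Proof.
move=> V0; have := @add_continuous G (0, 0) V; rewrite /= addr0.
move=> /(_ V0) [[A B] /= [A0 B0] AB].
pose C := A `&` B; have C0 : nbhs 0 C by exact: filterI.
exists (C `&` (fun x => C (- x))); split.
- by apply: filterI => //; exact: nbhs0_opp.
- by move=> x [Cx CNx]; split => //; rewrite opprK.
- by move=> x y [[Ax _] _] [[_ By] _]; exact: (AB (x, y)).
- move=> x [[Ax _] _]; rewrite -[x]addr0; apply: (AB (x, 0)); split => //.
  exact: nbhs_singleton B0.
Qed.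

Lemma nbhs0_sum4 V : nbhs 0 V -> exists W, [/\ nbhs 0 W, W `<=` V,
  forall x, W x -> W (- x) &
  forall x y z t, W x -> W y -> W z -> W t -> V (x + y + z + t)].
Proof.
move=> /nbhs0_sym [W [W0 Ws WW WV]]; have [X [X0 Xs XX XW]] := nbhs0_sym W0.
exists X; split => //; first by move=> x /XW/WV.
by move=> x y z t hx hy hz ht; rewrite -addrA; apply: WW; exact: XX.
Qed.

Lemma subgroup_gclosure (N : set G) : subgroup N -> subgroup (gclosure N).
Proof.
move=> sN; split=> [V V0|x y Cx Cy V V0].
  by exists 0; [exact: sN.1|rewrite subr0; exact: nbhs_singleton].
have [W [W0 Ws WW _]] := nbhs0_sym V0.
have [x' Nx' Wx'] := Cx _ W0; have [y' Ny' Wy'] := Cy _ W0.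
exists (x' - y'); first exact: sN.2.
rewrite (_ : _ - _ = (x' - x) + (- (y' - y))); last by zmod.
by apply: WW => //; exact: Ws.
Qed.

Lemma gclosure_closed (N : set G) : gclosed (gclosure N).
Proof.
move=> x h V V0; have [W [W0 Ws WW _]] := nbhs0_sym V0.
have [y Cy Wy] := h _ W0; have [z Nz Wz] := Cy _ W0; exists z => //.
by rewrite (_ : z - x = (z - y) + (y - x)); [exact: WW|zmod].
Qed.

Lemma sub_gclosure (N : set G) : N `<=` gclosure N.
Proof.
by move=> x Nx V V0; exists x => //; rewrite subrr; exact: nbhs_singleton.
Qed.

Lemma gclosedP (N : set G) : gclosed N <-> closed N.
Proof.
split=> cN x.
  move=> clx; apply: cN => V V0.
  have : nbhs x (fun y => V (y - x)).
    apply/nbhs_transl; apply: filterS V0 => y /=.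
    by rewrite addrC addrA addNr add0r.
  by move=> /clx [y [Ny Vy]]; exists y.
move=> h; apply: cN => V /nbhs_transl /h [y Ny] /=.
by rewrite addrC subrK => Vy; exists y.
Qed.

Lemma separatedP : separated G <-> hausdorff_space G.
Proof.
split=> [sG x y clxy|hG x hx].
  apply/eqP; rewrite -subr_eq0; apply/eqP; apply: sG => V V0.
  have [W [W0 Ws WW _]] := nbhs0_sym V0.
  have Wn (z : G) : nbhs z (fun t => W (t - z)).
    by apply/nbhs_transl; apply: filterS W0 => t; rewrite addrAC subrr add0r.
  have [z [/= Wx Wy]] := clxy _ _ (Wn x) (Wn y).
  rewrite (_ : x - y = - (z - x) + (z - y)); last by zmod.
  by apply: WW => //; exact: Ws.
apply: hG => A B Ax B0; suff : nbhs 0 (fun y => A (x + y)).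
  have [B1 [B10 B1s _ B1B]] := nbhs0_sym B0.
  move=> A0; have := hx _ (filterI (nbhs0_opp A0) (nbhs0_opp B10)) => -[_ /= Bx].
  exists 0; split; last exact: nbhs_singleton B0.
  have : nbhs 0 (fun y => A (x + y)) by [].
  by move=> /nbhs0_opp /hx /=; rewrite subrr.
exact: (nbhs_transl x A).1 Ax.
Qed.

End TopGroup.

Section Homs.
Variables G H : topologicalZmodType.

Lemma continuous_at0 (f : G -> H) : GRing.zmod_morphism f ->
  (forall V, nbhs 0 V -> nbhs 0 (f @^-1` V)) -> continuous f.
Proof.
move=> fm f0 x V /nbhs_transl /f0 fV; apply/nbhs_transl; apply: filterS fV.
move=> y /=; have fN z : f (- z) = - f z.
  by rewrite -[- z]sub0r fm -(subrr 0) fm !subrr sub0r.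
by rewrite -[y in f (x + y)]opprK fm fN opprK.
Qed.

Lemma cont_hom0 (f : cont_hom G H) V : nbhs 0 V -> nbhs 0 (f @^-1` V).
Proof. by move=> V0; have := @cont_hom_continuous _ _ f 0 V; rewrite hom0; apply. Qed.

Lemma hom_exists (f : G -> H) : GRing.zmod_morphism f ->
  (forall V, nbhs 0 V -> nbhs 0 (f @^-1` V)) -> exists g : cont_hom G H, g =1 f.
Proof. by move=> fm f0; exists (ContHom fm (continuous_at0 fm f0)). Qed.

Lemma ker_subgroup (f : cont_hom G H) : subgroup [set x | f x = 0].
Proof.
split=> [|x y /= fx fy]; first exact: hom0.
by rewrite /= homB fx fy subr0.
Qed.

Lemma ker_closed (f : cont_hom G H) : separated H -> gclosed [set x | f x = 0].
Proof.
move=> sH x hx /=; apply: sH => V /nbhs0_opp /(cont_hom0 f) /hx [y /= fy].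
by rewrite homB fy sub0r opprK.
Qed.

Lemma range_subgroup (f : cont_hom G H) : subgroup (range f).
Proof.
split=> [|_ _ [x _ <-] [y _ <-]]; first by exists 0; rewrite ?hom0.
by exists (x - y); rewrite // homB.
Qed.

Lemma image_subgroup (f : cont_hom G H) (N : set G) :
  subgroup N -> subgroup (f @` N).
Proof.
move=> sN; split=> [|_ _ [x Nx <-] [y Ny <-]].
  by exists 0; rewrite ?hom0//; exact: sN.1.
by exists (x - y); rewrite ?homB//; exact: sN.2.
Qed.

Lemma preimage_subgroup (f : cont_hom G H) (N : set H) :
  subgroup N -> subgroup (f @^-1` N).
Proof.
move=> sN; split=> [|x y Nx Ny] /=; first by rewrite hom0; exact: sN.1.
by rewrite homB; exact: sN.2.
Qed.

Lemma preimage_closed (f : cont_hom G H) (N : set H) :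
  gclosed N -> gclosed (f @^-1` N).
Proof.
move=> cN x hx; apply: cN => V /(cont_hom0 f) /hx [y Ny /=].
by rewrite homB => Vy; exists (f y).
Qed.

Lemma open_surj_separated (q : cont_hom G H) : open_surj q ->
  separated H <-> gclosed [set x | q x = 0].
Proof.
move=> [qs qo]; split; first exact: ker_closed.
move=> cN y hy; have [x xy] := qs y; rewrite -xy; apply: cN => V.
move=> /nbhs0_opp /qo /hy [z /= Vz qz]; exists (x - z); last first.
  by rewrite addrAC subrr sub0r.
by rewrite /= homB qz xy subrr.
Qed.

End Homs.

Section HomComposition.
Variables G H K : topologicalZmodType.

Lemma open_surj_comp (q : cont_hom G H) (r : cont_hom H K) :
  open_surj q -> open_surj r -> open_surj (cont_hom_comp r q).
Proof.
move=> [qs qo] [rs ro]; split=> [z|V /qo /ro].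
  by have [y <-] := rs z; have [x <-] := qs y; exists x.
by apply: filterS => _ [_ [x Vx <-] <-]; exists x.
Qed.

(** The universal property of quotients. The section [s] is arbitrary; continuity of the induced map
    comes from the openness of [q]. *)
Lemma open_surj_factor (q : cont_hom G H) (f : cont_hom G K) : open_surj q ->
  (forall x, q x = 0 -> f x = 0) -> exists g : cont_hom H K, forall x, g (q x) = f x.
Proof.
move=> [qs qo] qf.
have [s sq] := choice qs.
have fE x : f (s (q x)) = f x.
  apply/eqP; rewrite -subr_eq0 -homB; apply/eqP/qf.
  by rewrite homB sq subrr.
have [g gE] : exists g : cont_hom H K, g =1 f \o s.
  apply: hom_exists => [x y /=|V /(cont_hom0 f) /qo].
    by rewrite -[in LHS](sq x) -[in LHS](sq y) -homB fE homB.
  by apply: filterS => _ [x Vx <-] /=; rewrite fE.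
by exists g => x; rewrite gE /= fE.
Qed.

Lemma embedding_factor (i : cont_hom H G) (f : cont_hom K G) : embedding i ->
  (forall x, exists y, i y = f x) -> exists g : cont_hom K H, forall x, i (g x) = f x.
Proof.
move=> [ii io] /choice [s sE].
have [g gE] : exists g : cont_hom K H, g =1 s.
  apply: hom_exists => [x y|V /io [W /(cont_hom0 f) W0 WV]].
    by apply: ii; rewrite homB !sE homB.
  by apply: filterS W0 => x /= Wx; apply: WV; rewrite sE.
by exists g => x; rewrite gE.
Qed.

Lemma embedding_separated (i : cont_hom G H) :
  embedding i -> separated H -> separated G.
Proof.
move=> [ii _] sH x hx; apply: ii; rewrite hom0; apply: sH => V /(cont_hom0 i).
exact: hx.
Qed.

End HomComposition.

(** * Subgroups, quotients and products as topological groups *)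

Section Subgroup.
Variables (G : topologicalZmodType) (N : set G) (sN : subgroup N).

Let P : pred G := fun x => `[< N x >].

Let P_zmod : GRing.zmod_closed P.
Proof.
split=> [|x y /asboolP Nx /asboolP Ny]; apply/asboolP; first by case: sN.
by case: sN => _; exact.
Qed.

(** The proof argument gives the instance below a key, [set_pred sN], from which it finds the
    closure properties of [N]. *)
Definition set_pred of subgroup N := P.
HB.instance Definition _ := GRing.isZmodClosed.Build G (set_pred sN) P_zmod.

Definition set_zmodClosed : zmodClosed G :=
  GRing.ZmodClosed.clone G (set_pred sN) _.

Lemma set_zmodClosedE x : (x \in set_zmodClosed) = `[< N x >].
Proof. by []. Qed.

Definition subgroup_sub : Type := {x : G | x \in set_zmodClosed}.
HB.instance Definition _ := SubChoice.on subgroup_sub.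
HB.instance Definition _ :=
  [SubChoice_isSubZmodule of subgroup_sub by <:].

Definition subgroup_type : Type := initial_topology (val : subgroup_sub -> G).
HB.instance Definition _ := Topological.on subgroup_type.
HB.instance Definition _ := GRing.Zmodule.copy subgroup_type subgroup_sub.

Let valc : continuous (val : subgroup_type -> G).
Proof. exact: initial_continuous. Qed.

Let sub_type_nbhs (x : subgroup_type) (V : set subgroup_type) :
  nbhs x V <-> exists2 W, nbhs (val x) W & val @^-1` W `<=` V.
Proof.
split=> [|[W W0 WV]]; last by apply: filterS WV _; exact: valc.
case=> B [[C Copen <-] Cx CV]; exists C => //.
by apply: open_nbhs_nbhs.
Qed.

Let subgroup_sub_continuous :
  continuous (fun x : subgroup_type * subgroup_type => x.1 - x.2).
Proof.
move=> [x y] V /= /sub_type_nbhs [W W0 WV].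
have valB (a b : subgroup_type) : val (a - b) = val a - val b by [].
rewrite valB in W0.
have /= := @sub_continuous G (val x, val y) _ W0 => - [[A B] /= [Ax By] AB].
exists (val @^-1` A, val @^-1` B); first by split; exact: valc.
by move=> [a b] /= [Aa Bb]; apply: WV => /=; exact: (AB (val a, val b)).
Qed.

HB.instance Definition _ := PreTopologicalNmodule_isTopologicalZmodule.Build
  subgroup_type subgroup_sub_continuous.

Lemma subgroup_exists : exists (H : topologicalZmodType) (i : cont_hom H G),
  embedding i /\ range i = N.
Proof.
have vm : GRing.zmod_morphism (val : subgroup_type -> G) by move=> x y; rewrite raddfB.
exists subgroup_type, (ContHom vm valc); split.
  split=> /= [x y /val_inj //|V /sub_type_nbhs [W W0 WV]].
  by exists W; [rewrite raddf0 in W0|exact: WV].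
apply/seteqP; split=> [_ [[x Nx] _ <-] /=|x Nx]; first exact/asboolP.
by have Nx' : x \in set_zmodClosed; [exact/asboolP|exists (Sub x Nx')].
Qed.

End Subgroup.

Section Quotient.
Variables (G : topologicalZmodType) (N : zmodClosed G).

Let Q := quotient_group N.
Let pi (x : G) : Q := \pi_(Quotient.quot N)%qT x.

Let pi_morph : GRing.zmod_morphism pi.
Proof.
move=> x y; rewrite /pi /=.
rewrite [X in _ = X](_ : _ = Quotient.add (pi x) (Quotient.opp (pi y)))//.
by rewrite -Quotient.pi_opp -Quotient.pi_add.
Qed.

Let pi_surj (y : Q) : exists x, pi x = y.
Proof. by exists (repr (y : Quotient.quot N)); exact: reprK. Qed.

Let pi_ker x y : pi x = pi y <-> (x - y) \in N.
Proof.
rewrite Quotient.idealrBE; split=> [h|/eqP //]; apply/eqP; exact: h.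
Qed.

Let pi_cont : continuous pi.
Proof. exact: pi_continuous. Qed.

(** The preimage of the image of an open [W] is W + N, a union of translates of [W]. *)
Let pi_open (x : G) (V : set G) : nbhs x V -> nbhs (pi x) (pi @` V).
Proof.
rewrite nbhsE => -[W [oW Wx] WV]; rewrite nbhsE; exists (pi @` W); last first.
  exact: image_subset.
split; last by exists x.
rewrite [X in X _](_ : _ = @quotient_open _ (Quotient.quot N))//.
rewrite /quotient_open openE => y [w Ww wy].
move/pi_ker: wy => wy; rewrite /interior.
have /nbhs_transl Wn : nbhs w W by exact: open_nbhs_nbhs.
apply/nbhs_transl; apply: filterS Wn => z /= Wz.
exists (w + z) => //; apply/pi_ker.
by rewrite opprD addrACA subrr addr0.
Qed.

Let quotient_sub_continuous : continuous (fun x : Q * Q => x.1 - x.2).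
Proof.
move=> [a b] V; have [x <-] := pi_surj a; have [y <-] := pi_surj b.
rewrite /= -pi_morph => /pi_cont V0.
have /= [[A B] /= [Ax By] AB] := @sub_continuous G (x, y) _ V0.
exists (pi @` A, pi @` B); first by split; exact: pi_open.
move=> [_ _] /= [[s As <-] [t Bt <-]]; rewrite -pi_morph.
exact: (AB (s, t)).
Qed.

HB.instance Definition _ := PreTopologicalNmodule_isTopologicalZmodule.Build
  (quotient_group N) quotient_sub_continuous.

Lemma quotient_hom : exists q : cont_hom G (quotient_group N),
  open_surj q /\ forall x, q x = 0 <-> x \in N.
Proof.
exists (ContHom pi_morph pi_cont); split; last first.
  move=> x /=; rewrite -[x in x \in N]subr0 -pi_ker.
  by rewrite (_ : pi 0 = 0)// -(subrr 0) pi_morph subrr.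
split=> [|V /pi_open /=]; first exact: pi_surj.
by rewrite (_ : pi 0 = 0)// -(subrr 0) pi_morph subrr.
Qed.

End Quotient.

Lemma quotient_exists (G : topologicalZmodType) (N : set G) : subgroup N ->
  exists (Q : topologicalZmodType) (q : cont_hom G Q),
    open_surj q /\ forall x, q x = 0 <-> N x.
Proof.
move=> sN; have [q [qo qk]] := quotient_hom (set_zmodClosed sN).
exists (quotient_group (set_zmodClosed sN)), q; split => // x.
by split=> [/qk|Nx]; [move/asboolP|apply/qk/asboolP].
Qed.

Section Product.
Variables G H : topologicalZmodType.

Definition prod_type : Type := (G * H)%type.
HB.instance Definition _ := Topological.copy prod_type (G * H)%type.
HB.instance Definition _ := GRing.Zmodule.copy prod_type (G * H)%type.

Let prod_sub_continuous : continuous (fun x : prod_type * prod_type => x.1 - x.2).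
Proof.
move=> [[a b] [c d]] /= V [[A B] /= [Aa Bb] AB].
have /= [[A1 A2] /= [A1a A2c] AA] := @sub_continuous G (a, c) _ Aa.
have /= [[B1 B2] /= [B1b B2d] BB] := @sub_continuous H (b, d) _ Bb.
exists (A1 `*` B1, A2 `*` B2) => /=.
  by split; [exists (A1, B1)|exists (A2, B2)].
move=> [[x y] [z t]] /= [[A1x B1y] [A2z B2t]].
by apply: AB; split => /=; [exact: (AA (x, z))|exact: (BB (y, t))].
Qed.

HB.instance Definition _ := PreTopologicalNmodule_isTopologicalZmodule.Build
  prod_type prod_sub_continuous.

Definition prod_top : topologicalZmodType := prod_type.

Lemma prod_nbhs0 (V : set prod_top) : nbhs 0 V <->
  exists A B, [/\ nbhs 0 A, nbhs 0 B & forall x y, A x -> B y -> V (x, y)].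
Proof.
split=> [[[A B] /= [A0 B0] AB]|[A [B [A0 B0 AB]]]].
  by exists A, B; split=> // x y Ax By; exact: (AB (x, y)).
by exists (A, B) => // -[x y] [/= ? ?]; exact: AB.
Qed.

End Product.

Lemma biproduct_exists (G H : topologicalZmodType) :
  exists (i : cont_hom G (prod_top G H)) (j : cont_hom H (prod_top G H))
    (p : cont_hom (prod_top G H) G) (q : cont_hom (prod_top G H) H),
  [/\ forall x, i x = (x, 0), forall y, j y = (0, y), forall z, p z = z.1
    & forall z, q z = z.2].
Proof.
have [i iE] : exists i : cont_hom G (prod_top G H), i =1 (fun x => (x, 0)).
  apply: hom_exists => [x y|V /prod_nbhs0 [A [B [A0 B0 AB]]]].
    by congr pair; rewrite subr0.
  by apply: filterS A0 => x Ax; apply: AB => //; exact: nbhs_singleton B0.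
have [j jE] : exists j : cont_hom H (prod_top G H), j =1 (fun x => (0, x)).
  apply: hom_exists => [x y|V /prod_nbhs0 [A [B [A0 B0 AB]]]].
    by congr pair; rewrite subr0.
  by apply: filterS B0 => x Bx; apply: AB => //; exact: nbhs_singleton A0.
have [p pE] : exists p : cont_hom (prod_top G H) G, p =1 fst.
  apply: hom_exists => [//|V V0]; apply/prod_nbhs0.
  by exists V, setT; split => //; exact: filterT.
have [q qE] : exists q : cont_hom (prod_top G H) H, q =1 snd.
  apply: hom_exists => [//|V V0]; apply/prod_nbhs0.
  by exists setT, V; split => //; exact: filterT.
by exists i, j, p, q.
Qed.

(** * Subspaces and closed subgroups of R^n *)

Section RowVectors.
Variable R : realType.
Implicit Types n m k : nat.

Lemma rV_nbhs0 n (V : set 'rV[R]_n) :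
  nbhs 0 V <-> exists2 e : R, 0 < e & forall w, `|w| < e -> V w.
Proof.
split=> [/nbhs_ballP [e /= e0 h]|[e e0 h]]; first exists e => // w.
  by move=> we; apply: h; rewrite mx_norm_ball /ball_ /= sub0r normrN.
apply/nbhs_ballP; exists e => // w.
by rewrite mx_norm_ball /ball_ /= sub0r normrN; exact: h.
Qed.

Lemma rV_norm_le n (w : 'rV[R]_n) M :
  0 <= M -> (forall j, `|w 0 j| <= M) -> `|w| <= M.
Proof.
move=> M0 h; have [/eqP w0|w0] := boolP (mx_norm w == 0).
  by rewrite [`|w|]w0.
by have [[i j] /= E] := mx_norm_neq0 w0; rewrite [`|w|]E ord1.
Qed.

Lemma rV_coord_le n (w : 'rV[R]_n) j : `|w 0 j| <= `|w|.
Proof.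
rewrite [X in _ <= X]mx_normrE.
by rewrite (bigmaxD1 (0, j)) //= le_max lexx.
Qed.

Lemma mulmx_norm_le m n (A : 'M[R]_(m, n)) :
  exists2 C : R, 0 < C & forall w : 'rV[R]_m, `|w *m A| <= C * `|w|.
Proof.
pose C := 1 + \sum_i \sum_j `|A i j|.
have S0 : 0 <= \sum_i \sum_j `|A i j|.
  by apply: sumr_ge0 => i _; apply: sumr_ge0.
have C0 : 0 < C by rewrite ltr_pwDl.
exists C => // w; apply: rV_norm_le => [|j]; first by rewrite mulr_ge0 // ltW.
rewrite mxE; apply: (le_trans (ler_norm_sum _ _ _)).
apply: (@le_trans _ _ (\sum_i `|w| * `|A i j|)).
  by apply: ler_sum => i _; rewrite normrM ler_wpM2r // rV_coord_le.
rewrite -mulr_sumr mulrC ler_wpM2r // /C.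
apply: (@le_trans _ _ (\sum_i \sum_j `|A i j|)); last by rewrite lerDr.
apply: ler_sum => i _; rewrite (bigD1 j) //= lerDl.
by apply: sumr_ge0.
Qed.

Lemma cluster_seq n (u : nat -> 'rV[R]_n) M : (forall i, `|u i| <= M) ->
  exists p, forall e, 0 < e -> forall N, exists2 i, (N <= i)%N & `|u i - p| < e.
Proof.
move=> uM; have cpt : compact [set w : 'rV[R]_n | `|w| <= M].
  apply: bounded_closed_compact.
    exists M; split=> [|x Mx w /= wM]; first exact: num_real.
    by rewrite (le_trans wM) // ltW.
  rewrite (_ : [set _ | _] = Num.norm @^-1` [set x | x <= M]) //.
  by apply: closed_comp; [move=> x _; exact: norm_continuous|exact: closed_le].
have [//|p [_ clp]] := cpt (u @ \oo) _ _.
  by exists 0%N => // i _ /=.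
exists p => e e0 N.
have Fn : (u @ \oo) [set w | exists2 i, (N <= i)%N & w = u i].
  by exists N => // i /= Ni; exists i.
have pb : nbhs p [set w | `|w - p| < e].
  apply/nbhs_ballP; exists e => // w; rewrite mx_norm_ball /ball_ /=.
  by rewrite distrC.
by have [w [[i Ni ->] /= ie]] := clp _ _ Fn pb; exists i.
Qed.

Definition linear_set n (L : set 'rV[R]_n) :=
  L 0 /\ forall a u v, L u -> L v -> L (a *: u + v).

(** Take a matrix of maximal rank among those with row space in [L]: a vector of [L] outside it
    would raise the rank. *)
Lemma linear_set_row_space n (L : set 'rV[R]_n) : linear_set L ->
  exists M : 'M[R]_n, forall v, L v <-> (v <= M)%MS.
Proof.
move=> [L0 LD].
pose P r := `[< exists2 M : 'M[R]_n, (forall v : 'rV_n, (v <= M)%MS -> L v) & \rank M = r >].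
have exP : exists r, P r.
  exists 0%N; apply/asboolP; exists 0; last exact: mxrank0.
  by move=> v; rewrite submx0 => /eqP ->.
have ubP r : P r -> (r <= n)%N by move=> /asboolP [M _ <-]; exact: rank_leq_col.
have [r /asboolP [M ML Mr] maxr] := ex_maxnP exP ubP.
exists M => v; split=> [Lv|]; last exact: ML.
have sub : (M <= M + v)%MS by exact: addsmxSl.
have rk : (\rank (M + v)%MS <= \rank M)%N.
  rewrite Mr; apply: maxr; apply/asboolP; exists (M + v)%MS => // w.
  move=> /sub_addsmxP [[u1 u2] /= ->]; rewrite addrC.
  have -> : u2 *m v = u2 0 0 *: v by rewrite [u2]mx11_scalar mul_scalar_mx !mxE.
  by apply: LD => //; apply: ML; exact: submxMl.
have := mxrank_leqif_sup sub => -[_ eqM].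
have /eqP : \rank M = \rank (M + v)%MS by apply/eqP; rewrite eqn_leq rk mxrankS.
by rewrite eqM => h; apply: submx_trans h; exact: addsmxSr.
Qed.

(** At a stage of minimal rank, the later subspaces are contained in the present one and cannot have
    smaller rank. *)
Lemma subspaces_stabilize n (L : nat -> set 'rV[R]_n) :
  (forall k, linear_set (L k)) -> (forall k, L k.+1 `<=` L k) ->
  exists k, forall j, (k <= j)%N -> L k `<=` L j.
Proof.
move=> lin dec; have [M ME] := choice (fun k => linear_set_row_space (lin k)).
have exP : exists r, `[< exists k, \rank (M k) = r >].
  by exists (\rank (M 0%N)); apply/asboolP; exists 0%N.
have [r /asboolP [k kr] minr] := ex_minnP exP.
exists k => j kj v; rewrite !ME.
have sub : (M j <= M k)%MS.
  apply/rV_subP => w; rewrite -!ME; elim: j kj {v} => [|j IHj] kj.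
    by move: kj; rewrite leqn0 => /eqP ->.
  move: kj; rewrite leq_eqVlt => /predU1P[-> //|kj /dec]; exact: IHj.
have rk : (\rank (M k) <= \rank (M j))%N.
  by rewrite kr; apply: minr; apply/asboolP; exists j.
have := mxrank_leqif_sup sub => -[_ eqM].
have /eqP : \rank (M j) = \rank (M k) by apply/eqP; rewrite eqn_leq rk mxrankS.
by rewrite eqM => h hv; exact: submx_trans h.
Qed.

Lemma subgroup_mulz n (K : set 'rV[R]_n) (z : int) w :
  subgroup K -> K w -> K (z%:~R *: w).
Proof.
move=> sK Kw; have KD k : K (w *+ k).
  by elim: k => [|k IHk]; [rewrite mulr0n; case: sK|rewrite mulrS; exact: subgroupD].
rewrite scaler_int; case: z => k; rewrite ?NegzE ?mulrNz -?pmulrn; first exact: KD.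
by apply: subgroupN => //; exact: KD.
Qed.

(* Cartan: away from its lines, K would accumulate at 0 in a complement of
   the space of its lines, and a limit of directions would be a new line. *)
Lemma closed_subgroup_lines n (K : set 'rV[R]_n) : subgroup K -> gclosed K ->
  exists2 e : R, 0 < e & forall w, K w -> `|w| < e -> forall t, K (t *: w).
Proof.
move=> sK cK; pose L : set 'rV[R]_n := [set w | forall t : R, K (t *: w)].
have linL : linear_set L.
  split=> [t|a u v Lu Lv t]; first by rewrite scaler0; case: sK.
  by rewrite scalerDr scalerA; exact: subgroupD.
have [M ME] := linear_set_row_space linL.
(* [P] projects onto a complement of [L] along [L]: it moves an element of [K] by an element of [L],
   so the result stays in [K], and it stretches norms by at most [C]. *)
pose P := proj_mx (M^C)%MS M; have [C C0 PC] := mulmx_norm_le P.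
have capM : (M^C :&: M = 0)%MS by rewrite capmxC capmx_compl.
have Pdec w : exists2 l, L l & w = l + w *m P.
  have wM : (w <= M^C + M)%MS by rewrite addsmxC (submx_full _ (addsmx_compl_full M)).
  exists (w *m proj_mx M (M^C)%MS); first by apply/ME; exact: proj_mx_sub.
  by rewrite addrC add_proj_mx.
have [|nex] := pselect (exists2 e : R, 0 < e & forall w, K w -> `|w| < e -> L w).
  by case=> e e0 h; exists e.
have cex i : exists c : 'rV[R]_n, [/\ K c, c != 0, (c <= M^C)%MS & `|c| < i.+1%:R^-1].
  have : ~ forall w, K w -> `|w| < (C * i.+1%:R)^-1 -> L w.
    by move=> h; apply: nex; exists (C * i.+1%:R)^-1 => //; rewrite invr_gt0 mulr_gt0.
  move/existsNP => [w /not_implyP [Kw /not_implyP [wi nLw]]].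
  have [l Ll wE] := Pdec w; exists (w *m P); split.
  - rewrite (_ : w *m P = w - l); last by rewrite [in RHS]wE addrC addKr.
    by case: (sK) => _; apply => //; have := Ll 1; rewrite scale1r.
  - by apply/eqP => wP0; apply: nLw; rewrite wE wP0 addr0.
  - exact: proj_mx_sub.
  - rewrite (le_lt_trans (PC w)) // -ltr_pdivlMl // -invfM mulrC.
    by rewrite mulrC.
have [c cP] := choice cex.
have c0 i : 0 < `|c i| by rewrite normr_gt0; have [] := cP i.
pose u i : 'rV[R]_n := `|c i|^-1 *: c i.
have u1 i : `|u i : 'rV[R]_n| = 1.
  by rewrite normrZ gtr0_norm ?invr_gt0 // mulVf // gt_eqF.
have [p pcl] : exists p, forall e, 0 < e -> forall N, exists2 i, (N <= i)%N & `|u i - p| < e.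
  by apply: (@cluster_seq _ u 1) => i; rewrite u1.
have p1 : p != 0.
  apply/eqP => p0; have [i _] := pcl 1 ltr01 0%N.
  by rewrite p0 subr0 u1 ltxx.
(* The complement is closed: its cokernel [Q] kills every u i, and these come arbitrarily close to
   p. *)
have pM : (p <= M^C)%MS.
  apply/contraT => /negP npM; pose Q := cokermx (M^C)%MS.
  have pQ : 0 < `|p *m Q|.
    by rewrite normr_gt0; apply/negP => /eqP h; apply: npM; rewrite submxE h.
  have [D D0 QD] := mulmx_norm_le Q.
  have [i _ iD] := pcl (`|p *m Q| / D) (divr_gt0 pQ D0) 0%N.
  have := QD (u i - p); rewrite mulmxBl.
  have -> : u i *m Q = 0.
    by apply/eqP; rewrite -submxE scalemx_sub //; have [] := cP i.
  by rewrite sub0r normrN leNgt -ltr_pdivlMl // mulrC iD.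
have Lp : L p.
  move=> t; apply: cK => V /rV_nbhs0 [e e0 eV].
  (* Chosen so that |t| * d <= e / 2; the summand 1 allows t = 0. *)
  pose d := e / 2 / (1 + `|t|).
  have t1 : 0 < 1 + `|t| by rewrite ltr_pwDl.
  have d0 : 0 < d by rewrite !divr_gt0.
  have [N NE] : exists N : nat, N.+1%:R^-1 < e / 2.
    have [N] := @ltr_add_invr R 0 (e / 2) (divr_gt0 e0 (ltr0Sn _ 1)).
    by rewrite add0r => ?; exists N.
  have [i Ni iu] := pcl d d0 N.
  have [Kc _ _ ci] := cP i.
  (* This multiple of c i is within |c i| < e / 2 of t *: u i, which is within e / 2 of t *: p. *)
  pose z := Num.floor (t / `|c i|).
  exists (z%:~R *: c i); first exact: subgroup_mulz.
  apply: eV; rewrite (_ : _ - _ =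
     (z%:~R * `|c i| - t) *: u i + t *: (u i - p)); last first.
    rewrite scalerBr scalerBl addrA subrK; congr (_ - _).
    by rewrite /u scalerA mulfK ?gt_eqF.
  apply: le_lt_trans (ler_normD _ _) _; rewrite (normrZ _ (u i)) u1 mulr1 (normrZ t).
  rewrite [e]splitr ltr_leD //.
    apply: (@le_lt_trans _ _ `|c i|); last first.
      apply: (lt_trans ci); apply: le_lt_trans NE.
      by rewrite lef_pV2 ?posrE // ler_nat.
    have /andP[z1 z2] := real_floor_itv (num_real (t / `|c i|)).
    rewrite ler_pdivlMr // in z1.
    rewrite ltr_pdivrMr // intrD mulrDl mul1r in z2.
    by rewrite distrC ger0_norm ?subr_ge0 // lerBlDl ltW.
  apply: (@le_trans _ _ (`|t| * d)); first by rewrite ler_wpM2l // ltW.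
  by rewrite /d mulrA ler_pdivrMr // mulrC ler_wpM2l ?lerDr // ltW // divr_gt0.
have : (p <= M^C :&: M)%MS by rewrite sub_capmx pM; exact/ME.
by rewrite capM submx0 (negPf p1).
Qed.

End RowVectors.

(** * Discrete subgroups of R^n *)

Section Lattices.
Variable R : realType.
Implicit Types (n d : nat).

(** The generator is the infimum of the positive elements; it is attained because two elements
    closer than d coincide. *)
Lemma real_subgroup_cyclic (T : set R) (d t0 : R) : subgroup T ->
  0 < d -> (forall t, T t -> `|t| < d -> t = 0) -> T t0 -> t0 != 0 ->
  exists2 s, 0 < s /\ T s & forall t, T t -> exists z : int, t = z%:~R * s.
Proof.
move=> sT d0 dT Tt0 t00; pose S := [set t | T t /\ 0 < t].
have Sinf : has_inf S.
  split; last by exists 0 => t [_ /ltW].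
  exists `|t0|; split; last by rewrite normr_gt0.
  by case: (ger0P t0) => // _; exact: subgroupN.
have [s [Ts s0] ss] := inf_adherent d0 Sinf.
have smin t : S t -> s <= t.
  move=> St; have [Tt t_gt0] := St; rewrite leNgt; apply/negP => ts.
  have it : inf S <= t by apply: ge_inf => //; exact: Sinf.2.
  have : s - t = 0.
    apply: dT; first exact: sT.2.
    by rewrite gtr0_norm ?subr_gt0 // ltrBlDr (lt_le_trans ss) // addrC lerD2l.
  by move/eqP; rewrite subr_eq0 => /eqP E; rewrite E ltxx in ts.
exists s => // t Tt; exists (Num.floor (t / s)).
have /andP[z1 z2] := real_floor_itv (num_real (t / s)).
rewrite ler_pdivlMr // in z1; rewrite ltr_pdivrMr // intrD mulrDl mul1r in z2.
apply/eqP; rewrite -subr_eq0 eq_le subr_ge0 z1 andbT leNgt; apply/negP => r0.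
have Tz : T (t - (Num.floor (t / s))%:~R * s).
  apply sT.2 => //.
  have Tn k : T (k%:R * s).
    elim: k => [|k IHk]; first by rewrite mul0r; exact: sT.1.
    by rewrite -add1n natrD mulrDl mul1r; exact: subgroupD.
  case: (Num.floor _) => k; rewrite -?pmulrn ?NegzE ?mulrNz ?mulNr; first exact: Tn.
  by apply: subgroupN => //; exact: Tn.
have := smin _ (conj Tz r0).
by rewrite leNgt; case/negP; rewrite ltrBlDl.
Qed.

Lemma row_free_col_mx n d (B : 'M[R]_(d, n)) (w : 'rV[R]_n) :
  row_free B -> ~~ (w <= B)%MS -> row_free (col_mx B w).
Proof.
move=> fB wB; rewrite /row_free eqn_leq rank_leq_row /= -addsmxE addn1.
have := mxrank_leqif_sup (addsmxSl B w).
move=> [rk rkE]; rewrite -[X in (X < _)%N](eqP fB) ltn_neqAle rk rkE andbT.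
by apply: contra wB => h; apply: submx_trans h; exact: addsmxSr.
Qed.

(** Take a free family in [K], of maximal size among those that generate the part of [K] in their
    span. If v in [K] lies outside the span, the coefficients at v of the elements of [K] in the
    larger span form a cyclic group, and an element realising its generator extends the family. *)
Lemma discrete_subgroup_basis n (K : set 'rV[R]_n) : subgroup K ->
  (exists2 e : R, 0 < e & forall w, K w -> `|w| < e -> w = 0) ->
  exists d (B : 'M[R]_(d, n)), row_free B /\
    forall v, K v <-> exists z : 'rV[int]_d, v = map_mx intr z *m B.
Proof.
move=> sK [e e0 eK].
have Kint d (B : 'M[R]_(d, n)) (z : 'rV[int]_d) : (forall i, K (row i B)) ->
    K (map_mx intr z *m B).
  move=> KB; rewrite mulmx_sum_row.
  elim/big_ind: _ => [|x y Kx Ky|i _]; [exact: sK.1|exact: subgroupD|].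
  by rewrite mxE; exact: subgroup_mulz.
pose Q d := `[< exists B : 'M[R]_(d, n), [/\ row_free B, forall i, K (row i B) &
  forall v, K v -> (v <= B)%MS -> exists z : 'rV[int]_d, v = map_mx intr z *m B] >].
have exQ : exists d, Q d.
  exists 0%N; apply/asboolP; exists (0 : 'M[R]_(0, n)); split => [|[]//|v _].
    by rewrite /row_free mxrank0.
  by move=> /submxP [c ->]; exists 0; rewrite [c]thinmx0 [map_mx _ _]thinmx0.
have ubQ d : Q d -> (d <= n)%N.
  move=> /asboolP [B [fB _ _]]; move/eqP: fB => fB.
  by rewrite -[X in (X <= _)%N]fB; exact: rank_leq_col.
have [d /asboolP [B [fB KB intB]] maxd] := ex_maxnP exQ ubQ.
exists d, B; split=> // v; split=> [Kv|[z ->]]; last exact: Kint.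
have [vB|vB] := boolP (v <= B)%MS; first exact: intB.
suff : Q (d + 1)%N by move/maxd; rewrite addn1 ltnn.
apply/asboolP.
have indep (s : 'rV[R]_d) t : s *m B + t *: v = 0 -> t = 0.
  move=> h; apply/eqP; apply: contraNT vB => t0.
  have -> : v = - t^-1 *: (s *m B).
    have -> : s *m B = - (t *: v) by apply/eqP; rewrite -addr_eq0 h.
    by rewrite scaleNr scalerN opprK scalerA mulVf // scale1r.
  by rewrite scalemx_sub // submxMl.
pose T := [set t : R | exists s : 'rV[R]_d, K (s *m B + t *: v)].
have sT : subgroup T.
  split=> [|x y [s Ks] [s' Ks']].
    by exists 0; rewrite mul0mx scale0r addr0; exact: sK.1.
  exists (s - s'); rewrite mulmxBl scalerBl addrACA -opprD; exact: sK.2.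
have T1 : T 1 by exists 0; rewrite mul0mx add0r scale1r.
(* Reducing the coordinates along [B] modulo 1 keeps the vectors bounded. If nonzero coefficients at
   v accumulated at 0, two vectors with different coefficients would be closer than e, hence equal,
   against the independence of v from [B]. *)
have [d' d'0 d'T] : exists2 d' : R, 0 < d' & forall t, T t -> `|t| < d' -> t = 0.
  apply: contrapT => nex.
  have wex i : exists st : 'rV[R]_d * R, [/\ K (st.1 *m B + st.2 *: v),
      st.2 != 0, `|st.2| < i.+1%:R^-1 & `|st.1| <= 1].
    have : ~ forall t, T t -> `|t| < i.+1%:R^-1 -> t = 0.
      by move=> h; apply: nex; exists i.+1%:R^-1 => //; rewrite invr_gt0.
    move/existsNP => [t /not_implyP [[s Ks] /not_implyP [ti /eqP t0]]].
    pose z : 'rV[int]_d := \row_j Num.floor (s 0 j).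
    exists (s - map_mx intr z, t); split => //=.
      rewrite mulmxBl addrAC; apply sK.2 => //; exact: Kint.
    apply: rV_norm_le => // j; rewrite !mxE.
    have /andP[z1 z2] := real_floor_itv (num_real (s 0 j)).
    rewrite ger0_norm ?subr_ge0 // lerBlDl ltW //.
    by move: z2; rewrite intrD.
  have [st stP] := choice wex.
  have [C C0 BC] := mulmx_norm_le B.
  pose w i := (st i).1 *m B + (st i).2 *: v.
  have [p pcl] : exists p, forall e, 0 < e -> forall N, exists2 i, (N <= i)%N & `|w i - p| < e.
    apply: (@cluster_seq _ _ w (C + `|v|)) => i; have [_ _ ti si] := stP i.
    apply: le_trans (ler_normD _ _) _; rewrite lerD //.
      by apply: le_trans (BC _) _; rewrite ger_pMr.
    rewrite normrZ ler_piMl // (le_trans (ltW ti)) // invf_le1 ?ler1n //.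
  have e20 : 0 < e / 2 by rewrite divr_gt0.
  have [i _ ip] := pcl _ e20 0%N; have [Ki ti0 _ _] := stP i.
  have [N] := @ltr_add_invr R 0 `|(st i).2| ltac:(by rewrite normr_gt0).
  rewrite add0r => Ni.
  have [j Nj jp] := pcl _ e20 N; have [Kj _ tj _] := stP j.
  have tij : `|(st j).2| < `|(st i).2|.
    by apply: (lt_trans tj); apply: le_lt_trans Ni; rewrite lef_pV2 ?posrE ?ler_nat.
  have : w i - w j = 0.
    apply: eK; first exact: sK.2.
    rewrite (_ : w i - w j = (w i - p) + (p - w j)); last by rewrite addrA subrK.
    rewrite [e]splitr (le_lt_trans (ler_normD _ _)) // ltrD //.
    by rewrite distrC.
  rewrite /w opprD addrACA -mulmxBl -scalerBl => /indep /eqP.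
  by rewrite subr_eq0 => /eqP E; rewrite E ltxx in tij.
have [s [s0 Ts] sgen] := real_subgroup_cyclic sT d'0 d'T T1 (oner_neq0 _).
have [r Kr] := Ts; pose w := r *m B + s *: v.
have wB : ~~ (w <= B)%MS.
  apply: contra vB => h; have -> : v = s^-1 *: (w - r *m B).
    by rewrite /w addrC addKr scalerA mulVf ?gt_eqF // scale1r.
  by rewrite scalemx_sub // addmx_sub // eqmx_opp submxMl.
exists (col_mx B w); split; first exact: row_free_col_mx.
  move=> i; rewrite -[i](splitK i); case: (fintype.split i) => j /=.
    by rewrite rowKu.
  by rewrite rowKd; rewrite [j]ord1 (_ : row 0 w = w) // ; apply/rowP => k; rewrite mxE.
move=> u Ku /submxP [c]; rewrite -[c]hsubmxK mul_row_col => uE.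
pose c0 := rsubmx c 0 0.
have cE : rsubmx c *m w = c0 *: w by rewrite [rsubmx c]mx11_scalar mul_scalar_mx.
have [z zE] : exists z : int, c0 = z%:~R.
  have : T (c0 * s).
    exists (lsubmx c + c0 *: r); rewrite mulmxDl -scalemxAl -addrA -scalerA -scalerDr.
    by rewrite -cE -uE.
  by move=> /sgen [z] /(mulIf (lt0r_neq0 s0)) ->; exists z.
have [y yE] : exists y : 'rV[int]_d, u - z%:~R *: w = map_mx intr y *m B.
  apply: intB; first by apply sK.2 => //; exact: subgroup_mulz.
  by rewrite uE cE zE addrK submxMl.
exists (row_mx y z%:M); rewrite map_row_mx mul_row_col -yE.
by rewrite map_scalar_mx mul_scalar_mx subrK.
Qed.

(* B is a basis of the lattice K, C completes it to a basis of the space, and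
   P and Q are the dual coordinates. *)
Lemma discrete_subgroup_coordinates n (K : set 'rV[R]_n) : subgroup K ->
  (exists2 e : R, 0 < e & forall w, K w -> `|w| < e -> w = 0) ->
  exists d m (B : 'M[R]_(d, n)) (C : 'M[R]_(m, n)) (P : 'M[R]_(n, d)) (Q : 'M[R]_(n, m)),
  [/\ B *m P = 1%:M, B *m Q = 0, C *m P = 0, C *m Q = 1%:M &
      P *m B + Q *m C = 1%:M] /\
      (forall v, K v <-> exists z : 'rV[int]_d, v = map_mx intr z *m B).
Proof.
move=> sK /(discrete_subgroup_basis sK) [d [B [fB KB]]].
pose C := row_base (B^C)%MS; pose A := col_mx B C.
have full : row_full A.
  rewrite -sub1mx -addsmxE; apply: submx_trans (addsmxS (submx_refl B) (_ : (B^C <= C)%MS)).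
    by rewrite sub1mx addsmx_compl_full.
  by rewrite eq_row_base.
have free : row_free A.
  rewrite /row_free (eqP full) mxrank_compl -[in X in (_ == X + _)%N](eqP fB).
  by rewrite subnKC ?rank_leq_col.
have AV : A *m pinvmx A = 1%:M by rewrite mulmxVp.
have VA : pinvmx A *m A = 1%:M by rewrite mulVpmx.
exists d, (\rank (B^C)%MS), B, C, (lsubmx (pinvmx A)), (rsubmx (pinvmx A)).
rewrite -[pinvmx A]hsubmxK mul_col_row scalar_mx_block in AV.
have [E1 E2 E3 E4] := eq_block_mx AV.
split=> //; split=> //.
by rewrite -mul_row_col hsubmxK.
Qed.

End Lattices.

(** * Charts of abelian Lie groups and Hyers' correction *)

Section LieGroups.
Variable R : realType.
Implicit Types (A G H C : topologicalZmodType) (n m : nat).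

Definition open0 G H (f : cont_hom G H) :=
  forall V, nbhs 0 V -> nbhs 0 (f @` V).

(* Any abelian Lie group, without countability: an open homomorphic image of
   some R^n is an open subgroup. *)
Definition lie A := exists n (e : cont_hom 'rV[R]_n A), open0 e.

Definition inj0 n A (e : cont_hom 'rV[R]_n A) :=
  exists2 r : R, 0 < r & forall w, `|w| < r -> e w = 0 -> w = 0.

Lemma nbhs0_ball n (r : R) : 0 < r -> nbhs 0 [set w : 'rV[R]_n | `|w| < r].
Proof. by move=> r0; apply/rV_nbhs0; exists r. Qed.

Lemma mulmx_hom m n (B : 'M[R]_(m, n)) :
  exists f : cont_hom 'rV[R]_m 'rV[R]_n, forall w, f w = w *m B.
Proof.
have [C C0 BC] := mulmx_norm_le B.
apply: hom_exists => [x y|V /rV_nbhs0 [e e0 eV]]; first exact: mulmxBl.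
apply/rV_nbhs0; exists (e / C); first by rewrite divr_gt0.
by move=> w we; apply: eV; rewrite (le_lt_trans (BC w)) // mulrC -ltr_pdivlMr.
Qed.

(* One restricts e to a complement of the space of lines in ker e. *)
Lemma lie_chart A : separated A -> lie A ->
  exists n (e : cont_hom 'rV[R]_n A), open0 e /\ inj0 e.
Proof.
move=> sA [n [e oe]]; pose K := [set w | e w = 0].
have sK : subgroup K := ker_subgroup e.
have cK : gclosed K by exact: ker_closed.
have [r r0 rK] := closed_subgroup_lines sK cK.
pose L : set 'rV[R]_n := [set w | forall t : R, K (t *: w)].
have linL : linear_set L.
  split=> [t|a u v Lu Lv t]; first by rewrite scaler0; case: sK.
  by rewrite scalerDr scalerA; exact: subgroupD.
have [M ME] := linear_set_row_space linL.
pose C := row_base (M^C)%MS.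
have [f fE] := mulmx_hom C.
exists (\rank (M^C)%MS), (cont_hom_comp e f); split.
  move=> V V0.
  have [g gE] := mulmx_hom (proj_mx (M^C)%MS M *m pinvmx C).
  have := oe _ (cont_hom0 g V0); apply: filterS => _ [w /= Vgw <-].
  exists (g w) => //=.
  have -> : f (g w) = w *m proj_mx (M^C)%MS M.
    rewrite fE gE (mulmxA w) mulmxKpV //.
    by rewrite eq_row_base proj_mx_sub.
  have wM : (w <= M^C + M)%MS by rewrite addsmxC (submx_full _ (addsmx_compl_full M)).
  have capM : (M^C :&: M = 0)%MS by rewrite capmxC capmx_compl.
  have lM : K (w *m proj_mx M (M^C)%MS).
    have : L (w *m proj_mx M (M^C)%MS) by apply/ME; exact: proj_mx_sub.
    by move/(_ 1); rewrite scale1r.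
  by rewrite -[in RHS](add_proj_mx capM wM) homD [X in _ = _ + X]lM addr0.
have [D D0 CD] := mulmx_norm_le C.
exists (r / D); first by rewrite divr_gt0.
move=> u ur; rewrite /= fE => KuC.
have uC : L (u *m C).
  by apply: rK => //; rewrite (le_lt_trans (CD u)) // mulrC -ltr_pdivlMr.
have : (u *m C <= M :&: M^C)%MS.
  rewrite sub_capmx (ME _).1 //= (submx_trans (submxMl u C)) //.
  by rewrite eq_row_base.
rewrite capmx_compl submx0 => /eqP uC0.
by apply: (row_free_inj (row_base_free (M^C)%MS)); rewrite uC0 mul0mx.
Qed.

Lemma chart_nss A n (e : cont_hom 'rV[R]_n A) : open0 e -> inj0 e ->
  exists2 U, nbhs 0 U & forall N : set A, subgroup N -> N `<=` U -> N `<=` [set 0].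
Proof.
(* If w and the chart vector w' of e (w + w) are shorter than d, then |w' - (w + w)| < 3 d = r, so
   w' = w + w. Thus all the vectors 2^k w stay in the ball, which forces w = 0. *)
move=> oe [r r0 re]; pose d := r / 3.
have d0 : 0 < d by rewrite divr_gt0.
exists (e @` [set w | `|w| < d]); first exact/oe/nbhs0_ball.
move=> N sN NU x Nx /=; have [w /= wd xw] := NU x Nx.
suff wk k : `|w *+ (2 ^ k)| < d /\ N (e (w *+ (2 ^ k))).
  suff w0 : w = 0 by rewrite -xw w0 hom0.
  apply/eqP; rewrite -normr_eq0; apply: contraT => w0.
  have {}w0 : 0 < `|w| by rewrite lt_def w0 normr_ge0.
  have := Num.Theory.archi_boundP (divr_ge0 (ltW d0) (ltW w0)).
  move: (Num.bound _) => k h'; have [] := wk k.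
  rewrite normrMn -mulr_natr mulrC -ltr_pdivlMr // => h _.
  have := lt_trans h h'; rewrite ltr_nat ltnNge => /negP[]; exact/ltnW/ltn_expl.
elim: k => [|k [IH1 IH2]]; first by rewrite mulr1n xw.
have N2 : N (e (w *+ (2 ^ k.+1))).
  by rewrite expnS mul2n -addnn mulrnDr homD; exact: subgroupD.
split=> //; have [w' /= w'd ew'] := NU _ N2.
suff -> : w *+ (2 ^ k.+1) = w' by [].
apply/eqP; rewrite eq_sym -subr_eq0; apply/eqP; apply: re; last by rewrite homB ew' subrr.
apply: (le_lt_trans (ler_normB _ _)).
rewrite (_ : r = d + (d + d)); last by rewrite /d; field.
rewrite ltrD // expnS mul2n -addnn mulrnDr.
by apply: (le_lt_trans (ler_normD _ _)); rewrite ltrD.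
Qed.

Lemma exp2_le0 (t c : R) : (forall N, t <= 2^-1 ^+ N * c) -> t <= 0.
Proof.
move=> h; rewrite leNgt; apply/negP => t0.
have c0 : 0 < c by rewrite (lt_le_trans t0) // (le_trans (h 0%N)) // expr0 mul1r.
have := Num.Theory.archi_boundP (divr_ge0 (ltW c0) (ltW t0)).
set k := Num.bound _ => ck; have := h k.
rewrite exprVn mulrC ler_pdivlMr ?exprn_gt0 // leNgt => /negP; apply.
rewrite -ltr_pdivrMl // mulrC (lt_trans ck) // -natrX ltr_nat.
exact: ltn_expl.
Qed.

(** The sum of the series is obtained as a cluster point of its bounded partial sums, and the
    geometric tails make the rate explicit. *)
Lemma dyadic_sum n (D : nat -> 'rV[R]_n) rho : (forall k, `|D k| <= rho) ->
  exists p, forall N, `|p - \sum_(k < N) 2^-1 ^+ k.+1 *: D k| <= 2^-1 ^+ N * rho.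
Proof.
move=> Drho; pose S N := \sum_(k < N) 2^-1 ^+ k.+1 *: D k.
have rho0 : 0 <= rho by exact: le_trans (Drho 0%N).
have half0 k : 0 < 2^-1 ^+ k :> R by rewrite exprn_gt0.
have SS N k : `|S (N + k)%N - S N| <= (2^-1 ^+ N - 2^-1 ^+ (N + k)) * rho.
  elim: k => [|k IHk]; first by rewrite addn0 !subrr normr0 mul0r.
  rewrite addnS [S _.+1]big_ord_recr /= -/(S (N + k)%N) addrAC.
  apply: (le_trans (ler_normD _ _)); apply: le_trans (lerD IHk (_ : _ <= 2^-1 ^+ (N + k).+1 * rho)) _.
    by rewrite normrZ (ger0_norm (ltW (half0 _))) ler_wpM2l // ltW.
  by rewrite -mulrDl ler_wpM2r // exprS; set x := 2^-1 ^+ (N + k); lra.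
have Sb N : `|S N| <= rho.
  have := SS 0%N N; rewrite add0n /S big_ord0 subr0 => /le_trans; apply.
  by rewrite expr0 ler_piMl // lerBlDr lerDl ltW.
have [p pcl] := cluster_seq Sb.
exists p => N; apply/ler_addgt0Pl => d d0.
have [i Ni ip] := pcl d d0 N; rewrite -(subnKC Ni) in ip.
rewrite -/(S N) (_ : p - S N = (p - S (N + (i - N))%N) + (S (N + (i - N))%N - S N)); last first.
  by rewrite addrA subrK.
apply: (le_trans (ler_normD _ _)); rewrite lerD //; first by rewrite distrC ltW.
by apply: (le_trans (SS _ _)); rewrite ler_wpM2r // lerBlDr lerDl ltW.
Qed.

(* Hyers' stability argument: the defect d of s satisfies
   D(x + y) - D x - D y = d(2x, 2y) - 2 d(x, y) with D x = d(x, x), so that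
   the sum of the 2^-(k+1) D(2^k x) telescopes. *)
Lemma hyers (Q : zmodType) G n (e : cont_hom 'rV[R]_n G) (r rho : R) (s : Q -> G) :
  (forall w, `|w| < r -> e w = 0 -> w = 0) -> 0 < rho -> 6 * rho <= r ->
  (forall x y, exists2 w, `|w| < rho & s (x + y) - s x - s y = e w) ->
  exists a : Q -> 'rV[R]_n, (forall x, `|a x| <= rho) /\
    forall x y, s (x + y) + e (a (x + y)) = (s x + e (a x)) + (s y + e (a y)).
Proof.
move=> re rho0 rhor sd.
have /choice [d dP] : forall p : Q * Q, exists w : 'rV[R]_n,
    `|w| < rho /\ s (p.1 + p.2) - s p.1 - s p.2 = e w.
  by move=> [x y]; have [w] := sd x y; exists w.
have dn p : `|d p| < rho by have [] := dP p.
have dE x y : e (d (x, y)) = s (x + y) - s x - s y by have [_ <-] := dP (x, y).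
(* The two sides agree after [e]. Each is a sum of three vectors shorter than rho, so local
   injectivity applies when 6 * rho <= r. *)
have key x y : d (x + y, x + y) - d (x, x) - d (y, y) =
    d (x + x, y + y) - (d (x, y) + d (x, y)).
  apply/eqP; rewrite -subr_eq0; apply/eqP; apply: re.
    apply: lt_le_trans rhor; apply: (le_lt_trans (ler_normB _ _)).
    rewrite (_ : 6 * rho = (rho + rho + rho) + (rho + (rho + rho))); last by ring.
    rewrite ltrD //.
      apply: (le_lt_trans (ler_normB _ _)); rewrite ltrD //.
      by apply: (le_lt_trans (ler_normB _ _)); rewrite ltrD.
    apply: (le_lt_trans (ler_normB _ _)); rewrite ltrD //.
    by apply: (le_lt_trans (ler_normD _ _)); rewrite ltrD.
  rewrite !homB !homD !dE (addrACA x y x y).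
  by zmod.
have [a aP] := choice (fun x => dyadic_sum (fun k => ltW (dn (x *+ (2 ^ k), x *+ (2 ^ k))))).
exists a; split=> [x|x y].
  by have := aP x 0%N; rewrite big_ord0 subr0 expr0 mul1r.
suff : a (x + y) - a x - a y + d (x, y) = 0.
  move=> h; have := congr1 e h; rewrite hom0 homD !homB dE => E.
  apply/eqP; rewrite -subr_eq0 -E; apply/eqP; zmod.
(* The factor 4 counts the tails of the three series and the last term of the telescoping sum. *)
apply/eqP; rewrite -normr_le0; apply: (@exp2_le0 _ (4 * rho)) => N.
pose S z := \sum_(k < N) 2^-1 ^+ k.+1 *: d (z *+ (2 ^ k), z *+ (2 ^ k)).
have tel : S (x + y) - S x - S y =
    2^-1 ^+ N *: d (x *+ (2 ^ N), y *+ (2 ^ N)) - d (x, y).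
  rewrite /S -!sumrB; elim: (N) => [|k IHk].
    by rewrite big_ord0 expr0 scale1r !mulr1n subrr.
  rewrite big_ord_recr IHk /= -!scalerBr !mulrnDl key.
  have e2 (z : Q) : z *+ (2 ^ k) + z *+ (2 ^ k) = z *+ (2 ^ k.+1).
    by rewrite -mulrnDr addnn -mul2n -expnS.
  rewrite !e2 scalerBr.
  rewrite (_ : 2^-1 ^+ k.+1 *: (d (x *+ (2 ^ k), y *+ (2 ^ k)) + d (x *+ (2 ^ k), y *+ (2 ^ k)))
    = 2^-1 ^+ k *: d (x *+ (2 ^ k), y *+ (2 ^ k))); first by zmod.
  rewrite scalerDr -scalerDl exprS; congr (_ *: _).
  by set t := _ ^+ k; lra.
have -> : a (x + y) - a x - a y + d (x, y) =
    (a (x + y) - S (x + y)) - (a x - S x) - (a y - S y) +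
    2^-1 ^+ N *: d (x *+ (2 ^ N), y *+ (2 ^ N)).
  rewrite (_ : 2^-1 ^+ N *: _ = S (x + y) - S x - S y + d (x, y)); first by zmod.
  by rewrite tel subrK.
rewrite (_ : 2^-1 ^+ N * (4 * rho) =
  2^-1 ^+ N * rho + 2^-1 ^+ N * rho + 2^-1 ^+ N * rho + 2^-1 ^+ N * rho); last by ring.
apply: (le_trans (ler_normD _ _)); rewrite lerD //.
  apply: (le_trans (ler_normB _ _)); apply: lerD; last exact: aP.
  by apply: (le_trans (ler_normB _ _)); apply: lerD; exact: aP.
by rewrite normrZ ger0_norm ?exprn_ge0 // ler_wpM2l ?exprn_ge0 // ltW.
Qed.

End LieGroups.

Section HomAddition.
Variables G H : topologicalZmodType.
Implicit Types f g : cont_hom G H.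

Lemma hom_add_morph f g : GRing.zmod_morphism (fun x => f x + g x).
Proof. by move=> x y; rewrite !homB; zmod. Qed.

Lemma hom_add_cont f g : continuous (fun x => f x + g x).
Proof.
apply: continuous_at0; first exact: hom_add_morph.
move=> V /nbhs0_sym [W [W0 _ WW _]].
apply: filterS (filterI (cont_hom0 f W0) (cont_hom0 g W0)) => x [/= fx gx].
exact: WW.
Qed.

Definition cont_hom_add f g := ContHom (hom_add_morph f g) (@hom_add_cont f g).

Lemma hom_opp_morph f : GRing.zmod_morphism (fun x => - f x).
Proof. by move=> x y; rewrite homB; zmod. Qed.

Lemma hom_opp_cont f : continuous (fun x => - f x).
Proof.
apply: continuous_at0; first exact: hom_opp_morph.
by move=> V /nbhs0_opp /(cont_hom0 f).
Qed.

Definition cont_hom_opp f := ContHom (hom_opp_morph f) (@hom_opp_cont f).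

Lemma hom_zero_morph : GRing.zmod_morphism (fun _ : G => 0 : H).
Proof. by move=> x y; rewrite subr0. Qed.

Lemma hom_zero_cont : continuous (fun _ : G => 0 : H).
Proof. by move=> x; exact: cvg_cst. Qed.

Definition cont_hom_zero := ContHom hom_zero_morph hom_zero_cont.

Lemma hom_sum_exists (I : Type) (r : seq I) (F : I -> cont_hom G H) :
  exists f : cont_hom G H, forall x, f x = \sum_(i <- r) F i x.
Proof.
elim: r => [|i r [f fE]].
  by exists cont_hom_zero => x; rewrite big_nil.
by exists (cont_hom_add (F i) f) => x; rewrite big_cons /= fE.
Qed.

End HomAddition.

(** * Lifting homomorphisms through an extension with Lie kernel *)

Section Lifting.
Variable R : realType.

(** [e] is a chart of the kernel of [p]; the last clause says that it is open onto that kernel for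
    the topology induced by [G]. *)
Definition kernel_chart (G C : topologicalZmodType) (p : cont_hom G C) n
    (e : cont_hom 'rV[R]_n G) :=
  [/\ forall w, p (e w) = 0, inj0 e &
  forall d : R, 0 < d -> exists2 W, nbhs 0 W &
    forall x, W x -> p x = 0 -> exists2 w, `|w| < d & x = e w].

Variables (G C : topologicalZmodType) (p : cont_hom G C) (po : open_surj p).
Variables (n : nat) (e : cont_hom 'rV[R]_n G) (kc : kernel_chart p e).

(* Writing f x = w + e u with w small, doubling x shows that u is half of the
   corresponding u for 2x up to a small error: iterating, u is small. *)
Lemma lift_continuous (Q : topologicalZmodType) (f : Q -> G) (X : cont_hom Q C)
    (r d : R) (W : set G) (T : set Q) :
  GRing.zmod_morphism f -> (forall x, p (f x) = X x) ->
  (forall w, `|w| < r -> e w = 0 -> w = 0) -> 0 < d -> 6 * d <= r ->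
  nbhs 0 W -> nbhs 0 T -> (forall x, T x -> W (f x)) ->
  (forall x y, W x -> W y -> p (x - y) = 0 -> exists2 w, `|w| < d & x - y = e w) ->
  continuous f.
Proof.
move=> fm pf re d0 dr W0 T0 TW WW; apply: continuous_at0 => // V V0.
have fD x y : f (x + y) = f x + f y.
  have fN z : f (- z) = - f z by rewrite -sub0r fm -(subrr 0) fm !subrr sub0r.
  by rewrite -[y in LHS]opprK fm fN opprK.
have [V2 [V20 _ V2V _]] := nbhs0_sym V0.
have /rV_nbhs0 [h h0 hV2] := cont_hom0 e V20.
pose d1 := Num.min (h / 2) d.
have d10 : 0 < d1 by rewrite lt_min d0 divr_gt0.
have d1h : d1 <= h / 2 by rewrite ge_min lexx.
have d1d : d1 <= d by rewrite ge_min lexx orbT.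
have [_ _ /(_ d1 d10) [W1 W10 W1e]] := kc.
have [W2 [W20 W2s W2n W2W1]] := nbhs0_sum4 (filterI W10 (filterI V20 W0)).
pose S := T `&` X @^-1` (p @` W2).
have S0 : nbhs 0 S by apply: filterI => //; exact/cont_hom0/po.2.
have dec x : S x -> exists w u, [/\ W2 w, `|u| < d & f x = w + e u].
  move=> [Tx [w W2w wx]]; have [] := WW (f x) w (TW _ Tx).
  - by have [_ []] := W2s _ W2w.
  - by rewrite homB pf wx subrr.
  - by move=> u ud fu; exists w, u; split => //; rewrite -fu addrC subrK.
(* [Ti i] holds at x when x, 2 x, ..., 2^i x all lie in [S]. *)
pose Ti i := iter i (fun T x => S x /\ T (x + x)) S.
have Ti0 i : nbhs 0 (Ti i).
  elim: i => [//|i /nbhs0_sym [Y [Y0 _ YY _]]] /=; apply: filterI => //.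
  by apply: filterS Y0 => y Yy; exact: YY.
(* The error [d1] reproduces itself: from |u + u| <= (2^-i d + d1) + d1 one gets |u| <= 2^-(i+1) d +
   d1. *)
have main i x : Ti i x ->
    exists w u, [/\ W2 w, `|u| <= 2^-1 ^+ i * d + d1 & f x = w + e u].
  elim: i x => [x /dec [w [u [Ww ud fx]]]|i IHi x /= [Sx /IHi [w2 [u2 [Ww2 u2d fx2]]]]].
    by exists w, u; split => //; rewrite expr0 mul1r (le_trans (ltW ud)) // lerDl ltW.
  have [w [u [Ww ud fx]]] := dec _ Sx; exists w, u; split => //.
  have E : e (u2 - (u + u)) = w + w - w2.
    have E2 : e u2 = f x + f x - w2 by rewrite -fD fx2; zmod.
    by rewrite homB homD E2 fx; zmod.
  have [v vd Ev] : exists2 v, `|v| < d1 & w + w - w2 = e v.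
    apply: W1e; last by rewrite -E; have [-> _ _] := kc.
    have W20' : W2 0 by exact: nbhs_singleton.
    have [] // := W2W1 w w (- w2) 0 Ww Ww (W2n _ Ww2) W20'.
    by rewrite addr0.
  have i1 : 2^-1 ^+ i * d <= d.
    by rewrite ler_piMl ?(ltW d0) // exprn_ile1 // invf_le1 // ler1n.
  have uv : u2 - (u + u) - v = 0.
    apply: re; last by rewrite homB E Ev subrr.
    apply: (lt_le_trans _ dr); apply: (le_lt_trans (ler_normB _ _)).
    apply: (@le_lt_trans _ _ (`|u2| + (`|u| + `|u|) + `|v|)); last first.
      have := lt_le_trans vd d1d; have := ud; have := u2d; lra.
    by rewrite lerD2r (le_trans (ler_normB _ _)) // lerD2l ler_normD.
  have -> : `|u| = `|u + u| / 2.
    by rewrite -mulr2n normrMn; lra.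
  have -> : u + u = u2 - v by apply/eqP; rewrite -subr_eq0 -oppr0 -uv; apply/eqP; zmod.
  rewrite ler_pdivrMr // (le_trans (ler_normB _ _)) // exprS.
  by have := ltW vd; have := u2d; set t := _ ^+ i; lra.
have [i ih] : exists i, 2^-1 ^+ i * d < h / 2.
  apply: contrapT => /forallNP nex; have : h / 2 <= 0.
    by apply: (@exp2_le0 _ _ d) => i; rewrite leNgt; apply/negP/nex.
  by rewrite leNgt divr_gt0.
apply: filterS (Ti0 i) => x /main [w [u [Ww uh fxE]]].
rewrite /= fxE; apply: V2V.
  by have [_ []] := W2s _ Ww.
apply: hV2; rewrite (le_lt_trans uh) // [h]splitr ltr_leD //.
Qed.

(** An approximate section with defect in [W] is corrected by [hyers] and made continuous by
    [lift_continuous]. [W] is fixed before [Q], because in [prolie_extension] the group [Q] is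
    itself chosen in terms of [W]. *)
Lemma lift_section (V : set G) : nbhs 0 V -> exists2 W, nbhs 0 W &
  forall (Q : topologicalZmodType) (X : cont_hom Q C) (s : Q -> G),
    (forall x, p (s x) = X x) -> (forall x y, W (s (x + y) - s x - s y)) ->
    (exists2 T, nbhs 0 T & forall x, T x -> W (s x)) ->
  exists f : cont_hom Q G, (forall x, p (f x) = X x) /\ forall x, V (f x - s x).
Proof.
move=> V0; have [pe [r r0 re] ke] := kc.
pose d := r / 6; have d0 : 0 < d by rewrite divr_gt0.
have dr : 6 * d <= r by rewrite /d mulrC divfK.
have [Wd Wd0 Wde] := ke d d0.
have [Wf [Wf0 Wfs WfWd _]] := nbhs0_sym Wd0.
have [Wg [Wg0 Wgs WgWf _]] := nbhs0_sym Wf0.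
have VW0 : nbhs 0 (V `&` Wg) by exact: filterI.
have /rV_nbhs0 [h h0 hV] := cont_hom0 e VW0.
pose rho := Num.min (h / 2) d.
have rho0 : 0 < rho by rewrite lt_min d0 divr_gt0.
have rhoh : rho < h.
  by rewrite gt_min; apply/orP; left; rewrite ltr_pdivrMr // mulr_natr mulr2n ltrDl.
have rhor : 6 * rho <= r by rewrite (le_trans _ dr) // ler_wpM2l // ge_min lexx orbT.
have [W1 W10 W1e] := ke rho rho0.
exists (W1 `&` Wg); first exact: filterI.
move=> Q X s ps sW [T T0 TW].
have [a [arho aD]] : exists a : Q -> 'rV[R]_n, (forall x, `|a x| <= rho) /\
    forall x y, s (x + y) + e (a (x + y)) = (s x + e (a x)) + (s y + e (a y)).
  apply: hyers re rho0 rhor _ => x y; have [W1s _] := sW x y.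
  by apply: W1e => //; rewrite !homB !ps homD; zmod.
pose f x := s x + e (a x).
have fm : GRing.zmod_morphism f.
  move=> x y; have : f x = f (x - y) + f y by rewrite /f -aD subrK.
  by move=> ->; rewrite addrK.
have ah x : `|a x| < h by rewrite (le_lt_trans (arho x)).
have pf x : p (f x) = X x by rewrite /f homD pe addr0.
have fc : continuous f.
  apply: (lift_continuous fm pf re d0 dr Wf0 T0).
    by move=> x /TW [_ Wgx]; apply: WgWf => //; have [] := hV _ (ah x).
  by move=> x y Wx Wy pxy; apply: Wde => //; apply: WfWd => //; exact: Wfs.
exists (ContHom fm fc); split=> // x /=.
by rewrite /f addrC addKr; have [] := hV _ (ah x).
Qed.

(** Small lifts exist only over a short interval [0, t]. Writing w = z t + q with 0 <= q < t, one
    sends w to z times the lift of t plus the lift of q. The carry z (x + y) - z x - z y is 0 or 1,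
    so the defect is a sum of at most four small elements. *)
Lemma lift_line (X : cont_hom 'rV[R]_1 C) :
  exists f : cont_hom 'rV[R]_1 G, forall x, p (f x) = X x.
Proof.
have [W W0 lift] := lift_section filterT.
have [W1 [W10 W1W W1n W1s]] := nbhs0_sum4 W0.
have W1z : W1 0 by exact: nbhs_singleton.
have /rV_nbhs0 [h h0 hX] := cont_hom0 X (po.2 _ W10).
pose t := h / 2; have t0 : 0 < t by rewrite divr_gt0.
have th : t < h by rewrite /t ltr_pdivrMr // mulr_natr mulr2n ltrDl.
have /choice [sg sgP] : forall w : 'rV[R]_1, exists x, p x = X w /\ (`|w| <= t -> W1 x).
  move=> w; have [wt|wt] := boolP (`|w| <= t).
    have [x W1x xX] : (p @` W1) (X w) by apply: hX; rewrite (le_lt_trans wt).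
    by exists x.
  by have [x xX] := po.1 (X w); exists x.
have psg w : p (sg w) = X w by have [] := sgP w.
pose c (a : R) : 'rV[R]_1 := const_mx a.
have cE (w : 'rV[R]_1) : w = c (w 0 0) by apply/rowP => i; rewrite mxE ord1.
have nc a : `|c a| = `|a|.
  apply/eqP; rewrite eq_le; apply/andP; split.
    by apply: rV_norm_le => // j; rewrite mxE.
  by apply: le_trans (rV_coord_le _ 0); rewrite mxE.
have W1sg a : 0 <= a -> a <= t -> W1 (sg (c a)).
  by move=> a0 at_; have [_] := sgP (c a); apply; rewrite nc ger0_norm.
pose z (w : 'rV[R]_1) := Num.floor (w 0 0 / t).
pose q (w : 'rV[R]_1) := w 0 0 - (z w)%:~R * t.
have zP w : 0 <= q w /\ q w < t.
  have /andP[z1 z2] := real_floor_itv (num_real (w 0 0 / t)).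
  rewrite ler_pdivlMr // in z1; rewrite ltr_pdivrMr // intrD mulrDl mul1r in z2.
  by split; rewrite /q ?subr_ge0 // ltrBlDl.
pose s (w : 'rV[R]_1) := sg (c t) *~ z w + sg (c (q w)).
have ps w : p (s w) = X w.
  rewrite homD homMz !psg -homMz -homD; congr (X _).
  apply/rowP => i; rewrite [i]ord1 -scaler_int !mxE /q mulrzl addrCA subrr addr0 //.
have W1q w : W1 (sg (c (q w))) by have [? /ltW ?] := zP w; exact: W1sg.
have W1t : W1 (sg (c t)) by apply: W1sg => //; exact: ltW.
have [||f [fX _]] := lift _ X s ps; last by exists f.
- move=> x y.
  have [zxy|zxy] : z (x + y) = z x + z y \/ z (x + y) = z x + z y + 1.
  + have [q1 q2] := zP (x + y); have [x1 x2] := zP x; have [y1 y2] := zP y.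
    have E : q (x + y) = q x + q y + ((z x + z y - z (x + y))%:~R) * t.
      by rewrite /q mxE !intrD mulrNz; ring.
    pose k := z x + z y - z (x + y); rewrite -/k in E.
    have k1 : (k < 1)%R.
      rewrite ltNge; apply/negP => k1; have : (1 : R) <= k%:~R by rewrite ler1z.
      move/(ler_wpM2r (ltW t0)); rewrite mul1r; lra.
    have k2 : (-2 < k)%R.
      rewrite ltNge; apply/negP => k2; have : k%:~R <= (-2 : R).
        by rewrite -[-2 : R]/((-2)%:~R) ler_int.
      move/(ler_wpM2r (ltW t0)); lra.
    have : k = 0 \/ k = -1 by lia.
    have Ez : z (x + y) = z x + z y - k by rewrite /k subKr.
    by case=> k0; rewrite Ez k0 ?subr0 ?opprK; [left|right].
  + rewrite (_ : _ - _ = sg (c (q (x + y))) + - sg (c (q x)) + - sg (c (q y)) + 0).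
      by apply: W1s => //; exact: W1n.
    by rewrite /s zxy mulrzDr; zmod.
  + rewrite (_ : _ - _ = sg (c (q (x + y))) + - sg (c (q x)) + - sg (c (q y)) + sg (c t)).
      by apply: W1s => //; exact: W1n.
    by rewrite /s zxy !mulrzDr mulr1z; zmod.
- exists [set w | `|w| < t]; first exact: nbhs0_ball.
  move=> w /= wt; have : - t < w 0 0 < t.
    by rewrite -ltr_norml (le_lt_trans (rV_coord_le _ _)).
  move=> /andP[w1 w2]; have [z0|z1] : z w = 0 \/ z w = -1.
  + have [q1 q2] := zP w; have k1 : (z w < 1)%R.
      rewrite ltNge; apply/negP => k1; have : (1 : R) <= (z w)%:~R by rewrite ler1z.
      by move/(ler_wpM2r (ltW t0)); rewrite mul1r /q in q1 *; lra.
    have k2 : (-2 < z w)%R.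
      rewrite ltNge; apply/negP => k2; have : (z w)%:~R <= (-2 : R).
        by rewrite -[-2 : R]/((-2)%:~R) ler_int.
      by move/(ler_wpM2r (ltW t0)); rewrite /q in q2 *; lra.
    by lia.
  + rewrite /s z0 mulr0z add0r; exact: W1W.
  + rewrite /s z1 mulrN1z addrC -[X in W X]addr0 -[X in W X]addr0; apply: W1s => //.
    exact: W1n.
Qed.

Lemma lift_rV m (X : cont_hom 'rV[R]_m C) :
  exists f : cont_hom 'rV[R]_m G, forall x, p (f x) = X x.
Proof.
have H : forall j : 'I_m, exists f : cont_hom 'rV[R]_m G,
    forall x, p (f x) = X (x *m (delta_mx j 0 : 'M[R]_(m, 1)) *m delta_mx 0 j).
  move=> j; have [a aE] := mulmx_hom (delta_mx 0 j : 'M[R]_(1, m)).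
  have [b bE] := mulmx_hom (delta_mx j 0 : 'M[R]_(m, 1)).
  have [f fE] := lift_line (cont_hom_comp X a).
  by exists (cont_hom_comp f b) => x /=; rewrite fE /= aE bE.
have [f fE] := choice H.
have [g gE] := hom_sum_exists (index_enum 'I_m) f.
exists g => x; rewrite gE hom_sum.
under eq_bigr do rewrite fE.
rewrite -hom_sum; congr (X _); rewrite [RHS]row_sum_delta.
apply: eq_bigr => j _; have -> : x *m (delta_mx j 0 : 'M[R]_(m, 1)) = (x 0 j)%:M.
  by rewrite -colE; apply/rowP => i; rewrite !mxE ord1.
by rewrite mul_scalar_mx.
Qed.

End Lifting.

(** * Quotients and extensions of pro-Lie groups *)

Section ProLie.
Variable R : realType.
Implicit Types (G H C K Q : topologicalZmodType).

(** The subgroup is replaced by its quotient map, so any isomorphic copy of the quotient may serve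
    as [A]. *)
Definition prolie G := forall U, nbhs 0 U ->
  exists (A : topologicalZmodType) (p : cont_hom G A),
    [/\ separated A, lie R A, open_surj p & forall x, p x = 0 -> U x].

Lemma lie_open_surj G H (q : cont_hom G H) : open_surj q -> lie R G -> lie R H.
Proof.
move=> [_ qo] [n [e eo]]; exists n, (cont_hom_comp q e) => V /eo /qo.
by apply: filterS => _ [_ [w Vw <-] <-]; exists w.
Qed.

(** The Lie quotient of [Q] is [A] modulo the closure of p (ker q), which need not be closed itself.
    A point of the closure is only approximated by p (ker q); the error is absorbed by halving [U]
    to [U1] and its preimage to [U2]. *)
Lemma prolie_quotient G Q (q : cont_hom G Q) : open_surj q -> separated Q ->
  prolie G -> prolie Q.
Proof.
move=> qo sQ lG U U0; have [U1 [U10 U1n U1U _]] := nbhs0_sym U0.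
have [U2 [U20 _ U2U1 _]] := nbhs0_sym (cont_hom0 q U10).
have [A [p [sA lA po pU]]] := lG _ U20.
have sN := subgroup_gclosure (image_subgroup p (ker_subgroup q)).
have [B [r [ro rk]]] := quotient_exists sN.
have [g gE] : exists g : cont_hom Q B, forall x, g (q x) = r (p x).
  apply: (open_surj_factor (f := cont_hom_comp r p) qo) => x qx.
  by apply/rk/sub_gclosure; exists x.
have sB : separated B.
  apply/(open_surj_separated ro); rewrite (_ : mkset _ = gclosure (p @` [set x | q x = 0])).
    exact: gclosure_closed.
  by apply/seteqP; split=> x /rk.
exists B, g; split => //; first exact: lie_open_surj ro lA.
  split=> [y|V V0].
    by have [a <-] := ro.1 y; have [x <-] := po.1 a; exists (q x).
  have := ro.2 _ (po.2 _ (cont_hom0 q V0)).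
  by apply: filterS => _ [_ [x Vx <-] <-]; exists (q x).
move=> y gy; have [x xy] := qo.1 y; rewrite -xy in gy *.
rewrite gE in gy; move/rk: gy => /(_ _ (po.2 _ U20)) [_ [z /= qz <-] [w U2w]].
rewrite -homB => wE; have : p (z - x - w) = 0 by rewrite homB -wE subrr.
move=> /pU /(U2U1 _ _ U2w) /=; rewrite addrC subrK homB qz sub0r => /U1n.
rewrite opprK => U1x; rewrite -[q x]addr0; apply: U1U => //.
exact: nbhs_singleton.
Qed.

(** With [f] lifting the chart of [C], the chart of [G] is (w, y) -> e w + f y: a small x differs
    from some f y by a small element of the kernel, which [e] reaches. *)
Lemma lie_extension G C (p : cont_hom G C) n (e : cont_hom 'rV[R]_n G) :
  open_surj p -> kernel_chart p e -> lie R C -> lie R G.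
Proof.
move=> po kc [m [a ao]]; have [f fE] := lift_rV po kc a.
have [u uE] := @mulmx_hom R (n + m) n (col_mx 1%:M 0).
have [v vE] := @mulmx_hom R (n + m) m (col_mx 0 1%:M).
exists (n + m)%N, (cont_hom_add (cont_hom_comp e u) (cont_hom_comp f v)).
have [pe _ ke] := kc.
move=> V /rV_nbhs0 [d d0 dV].
have [W W0 We] := ke d d0; have [W1 [W10 W1n W1W _]] := nbhs0_sym W0.
have W2 : nbhs 0 (f @^-1` W1 `&` [set w | `|w| < d]).
  by apply: filterI; [exact: cont_hom0|exact: nbhs0_ball].
apply: filterS (filterI W10 (cont_hom0 p (ao _ W2))) => x [W1x [y [/= W1y yd] yx]].
have [w wd wE] : exists2 w, `|w| < d & x - f y = e w.
  apply: We; first by apply: W1W => //; exact: W1n.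
  by rewrite homB fE yx subrr.
exists (row_mx w y) => /=.
  apply: dV; rewrite (le_lt_trans (_ : _ <= Num.max `|w| `|y|)) //; last first.
    by rewrite gt_max wd yd.
  apply: rV_norm_le => [|j]; first by rewrite le_max normr_ge0.
  rewrite -(splitK j) le_max; case: (fintype.split j) => k /=.
    by rewrite row_mxEl rV_coord_le.
  by rewrite row_mxEr rV_coord_le orbT.
rewrite uE vE !mul_row_col !mulmx1 !mulmx0 addr0 add0r -wE.
by rewrite subrK.
Qed.

Lemma prolie_extension K G C (i : cont_hom K G) (p : cont_hom G C) :
  separated G -> separated C -> embedding i -> open_surj p ->
  (forall x, p x = 0 <-> exists k, i k = x) ->
  prolie K -> prolie C -> prolie G.
Proof.
move=> sG sC ie po pk lK lC U U0.
have [U1 [U10 U1n U1U _]] := nbhs0_sym U0.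
have [A [b [sA lA bo bU]]] := lK _ (cont_hom0 i U10).
have [n [a [ao ai]]] := lie_chart sA lA.
(* Closed in [G], since [i] is an embedding onto the kernel of [p]. Modulo [N] the kernel of the
   extension becomes the Lie group [A]. *)
pose N := i @` [set k | b k = 0].
have sN : subgroup N by apply: image_subgroup; exact: ker_subgroup.
have cN : gclosed N.
  move=> x xN; have : p x = 0.
    have /= h := @ker_closed _ _ p sC x; apply: h => V /xN [_ [k bk <-] Vk]; exists (i k) => //.
    by apply/pk; exists k.
  move=> /pk [k kx]; exists k => //; rewrite -kx in xN.
  have /= h := @ker_closed _ _ b sA k; apply: h => V /ie.2 [W W0 WV].
  have [_ [k' bk' <-] Wk] := xN _ W0; exists k' => //; apply: WV.
  by rewrite homB.
have [G1 [q [qo qk]]] := quotient_exists sN.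
have sG1 : separated G1.
  apply/(open_surj_separated qo); rewrite (_ : mkset _ = N) //.
  by apply/seteqP; split=> x /qk.
have [p1 p1E] : exists p1 : cont_hom G1 C, forall x, p1 (q x) = p x.
  by apply: (open_surj_factor qo) => x /qk [k _ <-]; apply/pk; exists k.
have p1o : open_surj p1.
  split=> [y|V /(cont_hom0 q) /po.2].
    by have [x <-] := po.1 y; exists (q x).
  by apply: filterS => _ [x Vx <-]; exists (q x).
have [g gE] : exists g : cont_hom A G1, forall k, g (b k) = q (i k).
  by apply: (open_surj_factor (f := cont_hom_comp q i) bo) => k bk; apply/qk; exists k.
have kc1 : kernel_chart p1 (cont_hom_comp g a).
  split=> [w| |d d0] /=.
  - by have [k <-] := bo.1 (a w); rewrite gE p1E; apply/pk; exists k.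
  - have [r r0 ra] := ai; exists r => // w wr /=.
    have [k kw] := bo.1 (a w); rewrite -kw gE => /qk [k' /= bk' /ie.1 kk'].
    by apply: ra => //; rewrite -kw -kk'.
  - have [W W0 Wb] := ie.2 _ (cont_hom0 b (ao _ (nbhs0_ball n d0))).
    exists (q @` W); first exact: qo.2.
    move=> _ [x Wx <-]; rewrite p1E => /pk [k kx]; rewrite -kx in Wx *.
    have [w wd aw] := Wb _ Wx; exists w => //.
    by rewrite /= aw gE.
(* The section and its correction will both lie in [V], so that [f] takes values in the image of
   [U1]. Then [W1] bounds the section and its defect, and ker c is chosen inside the image of
   [W1]. *)
have [V [V0 Vn VV VU]] := nbhs0_sym (qo.2 _ U10).
have [W W0 lift] := lift_section p1o kc1 V0.
have [W1 [W10 W1s W1n W1W]] := nbhs0_sum4 (filterI W0 V0).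
have W1z : W1 0 by exact: nbhs_singleton.
have [B [c [sB lB co cW]]] := lC _ (p1o.2 _ W10).
have [Q [j [je jr]]] := subgroup_exists (ker_subgroup c).
have jk y : c y = 0 <-> exists x, j x = y.
  have -> : (c y = 0) = range j y by rewrite jr.
  by split=> [[x _ <-]|[x <-]]; exists x.
have H y : exists x, W1 x /\ p1 x = j y.
  by have [x W1x px] : (p1 @` W1) (j y); [apply/cW/jk; exists y|exists x].
have [s sP] := choice H.
have [f [pf fV]] : exists f : cont_hom Q G1,
    (forall x, p1 (f x) = j x) /\ forall x, V (f x - s x).
  apply: lift => [x|x y|]; first by have [] := sP x.
    have [W1x _] := sP x; have [W1y _] := sP y; have [W1xy _] := sP (x + y).
    rewrite -[X in W X]addr0.
    by have [] := W1W (s (x + y)) (- s x) (- s y) 0 W1xy (W1n _ W1x) (W1n _ W1y) W1z.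
  exists setT; first exact: filterT.
  by move=> x _; have [W1x _] := sP x; have [] := W1s _ W1x.
have fU x : (q @` U1) (f x).
  rewrite -[f x](subrK (s x)); apply: VV => //.
  by have [W1x _] := sP x; have [] := W1s _ W1x.
have sr := range_subgroup f.
have fj x : f x = 0 -> x = 0 by move=> fx; apply: je.1; rewrite -pf fx !hom0.
(* If x is a limit of points f y', then p1 x = j y for some y, and the y' approach y because [j] is
   an embedding; by continuity of [f] the points f y' also tend to f y. *)
have cr : gclosed (range f).
  move=> x xN; have [y jy] : exists y, j y = p1 x.
    apply/jk; have /= h := @ker_closed _ _ (cont_hom_comp c p1) sB x; apply: h => X /xN.
    by move=> [_ [y _ <-] Xy]; exists (f y) => //=; rewrite pf; apply/jk; exists y.
  exists y => //; apply/eqP; rewrite -subr_eq0; apply/eqP; apply: sG1 => X X0.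
  have [Y [Y0 Yn YX _]] := nbhs0_sym X0.
  have [Z Z0 ZY] := je.2 _ (cont_hom0 f Y0).
  have [_ [y' _ <-] [Yy' /= Zy']] := xN _ (filterI Y0 (cont_hom0 p1 Z0)).
  rewrite (_ : f y - x = (f y' - x) + - f (y' - y)); last by zmod.
  by apply: YX => //; apply/Yn/ZY; rewrite homB jy -pf -homB.
have [G2 [q2 [q2o q2k]]] := quotient_exists sr.
have q2k' x : q2 x = 0 <-> exists y, f y = x.
  by rewrite q2k; split=> [[y _ <-]|[y <-]]; exists y.
have sG2 : separated G2.
  apply/(open_surj_separated q2o); rewrite (_ : mkset _ = range f) //.
  by apply/seteqP; split=> x /q2k.
have [p2 p2E] : exists p2 : cont_hom G2 B, forall x, p2 (q2 x) = c (p1 x).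
  apply: (open_surj_factor (f := cont_hom_comp c p1) q2o) => x /q2k' [y <-] /=.
  by rewrite pf; apply/jk; exists y.
have p2o : open_surj p2.
  have [s12 o12] := open_surj_comp p1o co; split=> [y|X /(cont_hom0 q2) /o12].
    by have [x <-] := s12 y; exists (q2 x).
  by apply: filterS => _ [x Xx <-]; exists (q2 x) => //; rewrite p2E.
have [pe1 ei1 ke1] := kc1.
(* The range of [f] meets the kernel of [p1] only in 0, so the chart survives the division, now over
   the Lie group [B]. *)
have kc2 : kernel_chart p2 (cont_hom_comp q2 (cont_hom_comp g a)).
  split=> [w| |d d0] /=.
  - by rewrite p2E pe1 hom0.
  - have [r r0 ra] := ei1; exists r => // w wr /= /q2k' [y fy].
    apply: ra => //=; rewrite -fy (_ : y = 0) ?hom0 //.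
    by apply: je.1; rewrite -pf fy pe1 hom0.
  - have [X X0 Xw] := ke1 d d0; have [Y [Y0 Yn YX _]] := nbhs0_sym X0.
    have [Z Z0 ZY] := je.2 _ (cont_hom0 f Y0).
    exists (q2 @` (Y `&` p1 @^-1` Z)).
      by apply: q2o.2; apply: filterI => //; exact: cont_hom0.
    move=> _ [x [Yx /= Zx] <-]; rewrite p2E => /jk [y jy].
    have [w wd wE] : exists2 w, `|w| < d & x - f y = cont_hom_comp g a w.
      apply: Xw; last by rewrite homB pf jy subrr.
      by apply: YX => //; apply/Yn/ZY; rewrite jy.
    exists w => //; rewrite -[RHS]/(q2 (cont_hom_comp g a w)) -wE homB.
    by rewrite (q2k' (f y)).2 ?subr0 //; exists y.
exists G2, (cont_hom_comp q2 q); split => //.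
- exact: lie_extension p2o kc2 lB.
- exact: open_surj_comp.
- move=> x /q2k' [y fy]; have [z U1z qz] := fU y.
  have : q (x - z) = 0 by rewrite homB qz fy subrr.
  move=> /qk [k bk kE]; rewrite -[x](subrK z) -kE; apply: U1U => //.
  exact: bU.
Qed.

End ProLie.

(** * Sequential completeness and countable bases at 0 *)

Section Sequences.
Variable G : topologicalZmodType.

Definition gcvg (u : nat -> G) (x : G) :=
  forall V, nbhs 0 V -> exists N, forall k, (N <= k)%N -> V (u k - x).

Definition gcauchy (u : nat -> G) := forall V, nbhs 0 V ->
  exists N, forall k l, (N <= k)%N -> (N <= l)%N -> V (u k - u l).

Definition seqcomplete := forall u, gcauchy u -> exists x, gcvg u x.

Definition countable_base0 := exists U : nat -> set G,
  (forall k, nbhs 0 (U k)) /\ forall V, nbhs 0 V -> exists k, U k `<=` V.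

Lemma countable_base0_halving : countable_base0 -> exists U : nat -> set G,
  [/\ forall k, nbhs 0 (U k), forall V, nbhs 0 V -> exists k, U k `<=` V,
      forall k x, U k x -> U k (- x),
      forall k x y, U k.+1 x -> U k.+1 y -> U k (x + y)
    & forall k, U k.+1 `<=` U k].
Proof.
move=> [U [U0 UV]].
have H (V : set G) : exists W, nbhs 0 V -> [/\ nbhs 0 W,
    forall x, W x -> W (- x), forall x y, W x -> W y -> V (x + y) & W `<=` V].
  have [/nbhs0_sym [W hW]|nV] := pselect (nbhs 0 V); first by exists W.
  by exists V.
have [h hP] := choice H.
(* Intersecting with [U k'] before halving keeps the sequence a base at 0. *)
pose X := fix X k := if k is k'.+1 then h (X k' `&` U k') else h setT.
have X0 k : nbhs 0 (X k).
  elim: k => [|k IHk] /=; first by have [] := hP _ (@filterT _ _ _ : nbhs 0 setT).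
  by have [] := hP (X k `&` U k) (filterI IHk (U0 k)).
have XU0 k : nbhs 0 (X k `&` U k) by exact: filterI.
have XU k := hP _ (XU0 k).
exists X; split => //.
- move=> V /UV [k kV]; exists k.+1 => x Xx; apply: kV.
  by have [_ _ _ sub] := XU k; have [] := sub x Xx.
- case=> [|k] x; first by have [_ + _ _] := hP _ (@filterT _ _ _ : nbhs 0 setT); apply.
  by have [_ + _ _] := XU k; apply.
- move=> k x y Xx Xy; have [_ _ sub _] := XU k.
  by have [] := sub x y Xx Xy.
- by move=> k x Xx; have [_ _ _ sub] := XU k; have [] := sub x Xx.
Qed.

End Sequences.

Lemma dependent_choice_seq (T : Type) (P : nat -> T -> Prop)
    (Q : nat -> T -> T -> Prop) (x0 : T) : P 0%N x0 ->
  (forall k x, P k x -> exists2 y, P k.+1 y & Q k x y) ->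
  exists u : nat -> T, [/\ u 0%N = x0, forall k, P k (u k) & forall k, Q k (u k) (u k.+1)].
Proof.
move=> P0 step.
have H (kx : nat * T) : exists y, P kx.1 kx.2 -> P kx.1.+1 y /\ Q kx.1 kx.2 y.
  have [/step [y Py Qy]|nP] := pselect (P kx.1 kx.2); first by exists y.
  by exists x0.
have [h hP] := choice H.
pose u := fix u k := if k is k'.+1 then h (k', u k') else x0.
have Pu k : P k (u k) by elim: k => //= k IHk; have [] := hP (k, u k) IHk.
by exists u; split => // k; have [] := hP (k, u k) (Pu k).
Qed.

(** * One-parameter subgroups and closed subgroups of pro-Lie groups *)

Section OneParameter.
Variable R : realType.

(* The closed subgroup of the (w, v) with X w = e v contains lines through
   small elements. *)
Lemma one_param (A : topologicalZmodType) m n (X : cont_hom 'rV[R]_m A)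
    (e : cont_hom 'rV[R]_n A) (w : 'rV[R]_m) : separated A -> open0 e ->
  exists v, forall t, X (t *: w) = e (t *: v).
Proof.
move=> sA eo.
have [a aE] := @mulmx_hom R (m + n) m (col_mx 1%:M 0).
have [b bE] := @mulmx_hom R (m + n) n (col_mx 0 1%:M).
pose f := cont_hom_add (cont_hom_comp X a) (cont_hom_opp (cont_hom_comp e b)).
have fE x y : f (row_mx x y) = X x - e y.
  by rewrite /= aE bE !mul_row_col !mulmx1 !mulmx0 addr0 add0r.
have [r r0 rK] := closed_subgroup_lines (ker_subgroup f) (@ker_closed _ _ f sA).
have /rV_nbhs0 [d d0 dX] := cont_hom0 X (eo _ (nbhs0_ball n r0)).
(* Scaling by [c] brings w below both d and r: below d, X (c *: w) is hit by a short v, and then (c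
   *: w, v) is shorter than r in the kernel of [f]. *)
pose c := Num.min d r / (2 * (1 + `|w|)).
have w1 : 0 < 1 + `|w| by rewrite ltr_pwDl.
have m0 : 0 < Num.min d r by rewrite lt_min d0.
have c0 : 0 < c by rewrite divr_gt0 // mulr_gt0.
have cw : `|c *: w| < Num.min d r.
  rewrite normrZ gtr0_norm // /c mulrAC ltr_pdivrMr ?mulr_gt0 // ltr_pM2l //.
  by have := normr_ge0 w; lra.
have [v /= vr vw] : (e @` [set v | `|v| < r]) (X (c *: w)).
  by apply: dX; move: cw; rewrite lt_min => /andP[].
exists (c^-1 *: v) => t.
have fw : f (row_mx (c *: w) v) = 0 by rewrite fE vw subrr.
have : f ((t / c) *: row_mx (c *: w) v) = 0.
  apply: (rK _ fw).
  apply: (@le_lt_trans _ _ (Num.max `|c *: w| `|v|)).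
    apply: rV_norm_le => [|j]; first by rewrite le_max normr_ge0.
    rewrite -(splitK j) le_max; case: (fintype.split j) => k /=.
      by rewrite row_mxEl rV_coord_le.
    by rewrite row_mxEr rV_coord_le orbT.
  by move: cw; rewrite lt_min gt_max => /andP[_ ->].
rewrite scale_row_mx fE => /eqP; rewrite subr_eq0 => /eqP.
by rewrite !scalerA divfK ?gt_eqF.
Qed.

Lemma one_param_mx (A : topologicalZmodType) m n (X : cont_hom 'rV[R]_m A)
    (e : cont_hom 'rV[R]_n A) : separated A -> open0 e ->
  exists M : 'M[R]_(m, n), forall w, X w = e (w *m M).
Proof.
move=> sA eo; have [v vP] := choice (fun j => one_param X (delta_mx 0 j) sA eo).
exists (\matrix_j v j) => w; rewrite [in LHS](row_sum_delta w) hom_sum mulmx_sum_row hom_sum.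
by apply: eq_bigr => j _; rewrite vP rowK.
Qed.

Lemma inj0_line (A : topologicalZmodType) n (e : cont_hom 'rV[R]_n A) u :
  inj0 e -> (forall t, e (t *: u) = 0) -> u = 0.
Proof.
move=> [r r0 re] h; apply: contrapT => /eqP u0.
have {}u0 : 0 < `|u| by rewrite normr_gt0.
have : (r / 2 / `|u|) *: u = 0.
  apply: re => //; rewrite normrZ gtr0_norm ?divr_gt0 // divfK ?gt_eqF //.
  by rewrite ltr_pdivrMr // mulr_natr mulr2n ltrDl.
move/eqP; rewrite scaler_eq0 gt_eqF ?divr_gt0 //= => /eqP u00.
by rewrite u00 normr0 ltxx in u0.
Qed.

End OneParameter.

Section ClosedSubgroup.
Variables (R : realType) (H G : topologicalZmodType) (i : cont_hom H G).
Hypotheses (ie : embedding i) (ic : gclosed (range i)).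
Hypotheses (sG : separated G) (cG : seqcomplete G).
Variables (A : nat -> topologicalZmodType) (p : forall k, cont_hom G (A k)).
Variables (n : nat -> nat) (e : forall k, cont_hom 'rV[R]_(n k) (A k)).
Hypotheses (sA : forall k, separated (A k)) (po : forall k, open_surj (p k)).
Hypotheses (eo : forall k, open0 (e k)) (ei : forall k, inj0 (e k)).
Hypothesis pker : forall k x, p k.+1 x = 0 -> p k x = 0.
Hypothesis psmall : forall V, nbhs 0 V -> exists k, forall x, p k x = 0 -> V x.

Let pker_le j k x : (k <= j)%N -> p j x = 0 -> p k x = 0.
Proof.
move=> kj; rewrite -(subnK kj); elim: (j - k)%N => [//|l IHl] /=.
by rewrite addSn => /pker.
Qed.

Definition approx k : set 'rV[R]_(n k) :=
  [set w | gclosure (p k @` range i) (e k w)].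

(* The Lie algebra of the closure of p_k H. *)
Definition approx_lie k : set 'rV[R]_(n k) :=
  [set w | forall t : R, approx (t *: w)].

Let sK k : subgroup (@approx k).
Proof. exact/preimage_subgroup/subgroup_gclosure/image_subgroup/range_subgroup. Qed.

Let KL k : exists2 r : R, 0 < r &
  forall w : 'rV[R]_(n k), approx w -> `|w| < r -> approx_lie w.
Proof.
have cK : gclosed (@approx k) by apply: preimage_closed; exact: gclosure_closed.
by have [r r0 h] := closed_subgroup_lines (@sK k) cK; exists r.
Qed.

Let linL k : linear_set (@approx_lie k).
Proof.
split=> [t|a u v Lu Lv t]; first by rewrite scaler0; case: (sK k).
by rewrite scalerDr scalerA; exact: (subgroupD (sK k)).
Qed.

(** The transition map from [A j] to [A k] read in charts; the value 0 for k > j makes [M] a total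
    family. *)
Let trans j k : exists M : 'M[R]_(n j, n k), (k <= j)%N ->
  forall w x, p j x = e j w -> p k x = e k (w *m M).
Proof.
have [kj|kj] := boolP (k <= j)%N; last by exists 0.
have [g gE] : exists g : cont_hom (A j) (A k), forall x, g (p j x) = p k x.
  by apply: (open_surj_factor (po j)) => x; exact: pker_le.
have [M ME] := one_param_mx (cont_hom_comp g (e j)) (@sA k) (@eo k).
by exists M => _ w x pjx; rewrite -ME /= -pjx gE.
Qed.

Let M j k := sval (cid (trans j k)).

Let MP j k w x : (k <= j)%N -> p j x = e j w -> p k x = e k (w *m M j k).
Proof. by move=> kj; exact: (svalP (cid (trans j k)) kj). Qed.

(** As charts are injective only near 0, equality of vectors is deduced from equality along whole
    lines. *)
Let Mcomp j l k (w : 'rV[R]_(n j)) : (k <= l)%N -> (l <= j)%N ->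
  w *m M j l *m M l k = w *m M j k.
Proof.
move=> kl lj; apply/eqP; rewrite -subr_eq0; apply/eqP.
apply: (inj0_line (@ei k)) => t; have [x xE] := (po j).1 (e j (t *: w)).
have h1 := MP lj xE; have h2 := MP kl h1; have h3 := MP (leq_trans kl lj) xE.
by rewrite scalerBr homB !scalemxAl -h2 -h3 subrr.
Qed.

Let ML j k (w : 'rV[R]_(n j)) : (k <= j)%N ->
  approx_lie w -> approx_lie (w *m M j k).
Proof.
move=> kj Lw t V V0; have [x xE] := (po j).1 (e j (t *: w)).
have [_ [_ [y _ <-] <-] Vy] : exists2 z, (p j @` range i) z &
    (p j @` (p k @^-1` V)) (z - e j (t *: w)).
  by apply: (Lw t); apply: (po j).2; exact: cont_hom0.
case: Vy => z /= Vz zE; exists (p k (i y)); first by exists (i y) => //; exists y.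
have : p k (z - (i y - x)) = 0.
  by apply: (pker_le kj); rewrite !homB zE xE; zmod.
rewrite homB => /subr0_eq pz; rewrite scalemxAl -(MP kj xE) -homB -pz.
exact: Vz.
Qed.

(** The intersection at stage k of the images of all later Lie algebras. *)
Definition liftable k : set 'rV[R]_(n k) :=
  [set v | forall j, (k <= j)%N -> exists2 w : 'rV[R]_(n j), approx_lie w & v = w *m M j k].

(** The Mittag-Leffler condition: the images decrease inside a finite-dimensional space. *)
Let stab k : exists2 J, (k <= J)%N &
  forall w : 'rV[R]_(n J), approx_lie w -> liftable (w *m M J k).
Proof.
pose V j := [set v | exists2 w : 'rV[R]_(n (k + j)%N), approx_lie w & v = w *m M (k + j)%N k].
have linV j : linear_set (V j).
  split=> [|a _ _ [u Lu ->] [v Lv ->]].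
    by exists 0; [exact: (linL _).1|rewrite mul0mx].
  by exists (a *: u + v); [exact: (linL _).2|rewrite mulmxDl scalemxAl].
have decV j : V j.+1 `<=` V j.
  move=> _ [w Lw ->]; exists (w *m M (k + j.+1)%N (k + j)%N).
    by apply: ML => //; rewrite leq_add2l.
  by rewrite Mcomp // ?leq_addr // leq_add2l.
have [J JV] := subspaces_stabilize linV decV.
exists (k + J)%N; first exact: leq_addr.
move=> w Lw j kj; have [Jj|Jj] := leqP (k + J)%N j.
  have kJ : (J <= j - k)%N by lia.
  have := JV _ kJ (w *m M (k + J)%N k) (ex_intro2 _ _ w Lw erefl).
  by rewrite /V /= subnKC // => -[u Lu ->]; exists u.
exists (w *m M (k + J)%N j); first by apply: ML => //; exact: ltnW.
by rewrite Mcomp // ltnW.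
Qed.

Let lin_liftable k : linear_set (@liftable k).
Proof.
split=> [j kj|a u v Lu Lv j kj].
  by exists 0; [exact: (linL _).1|rewrite mul0mx].
have [u' Lu' ->] := Lu j kj; have [v' Lv' ->] := Lv j kj.
by exists (a *: u' + v'); [exact: (linL _).2|rewrite mulmxDl scalemxAl].
Qed.

Let psep x : (forall k, p k x = 0) -> x = 0.
Proof. by move=> px; apply: sG => V /psmall [k]; apply. Qed.

(* By Mittag-Leffler, a liftable vector gives a coherent sequence of
   one-parameter subgroups of the p_j H, hence one of H by completeness. *)
Let lift_liftable (v : 'rV[R]_(n 0%N)) : liftable v ->
  exists f : cont_hom 'rV[R]_1 H, forall t, p 0%N (i (f t)) = e 0%N (t 0 0 *: v).
Proof.
move=> Lv.
(* The choice is made of whole curves in [G]. Consecutive ones agree modulo the kernel of [p k], so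
   they converge pointwise. *)
pose P k (y : R -> G) := exists2 u : 'rV[R]_(n k), liftable u & forall t, p k (y t) = e k (t *: u).
have [y0 y0E] := choice (fun t : R => (po 0%N).1 (e 0%N (t *: v))).
have P0 : P 0%N y0 by exists v.
have [|y [yy0 Py yS]] := @dependent_choice_seq _ P
    (fun k y y' => forall t, p k (y' t) = p k (y t)) y0 P0.
  (* The vector u is lifted to a stage [J] that is stable for k + 1 and pushed down to stage k + 1,
     where it is liftable again. *)
  move=> k y [u Lu uE]; have [J kJ stJ] := stab k.+1.
  have [w Lw wE] := Lu J (ltnW kJ).
  have [y' y'E] := choice (fun t : R => (po k.+1).1 (e k.+1 (t *: (w *m M J k.+1)))).
  exists y'; first by exists (w *m M J k.+1) => //; exact: stJ.
  move=> t; rewrite uE (MP (leqnSn k) (y'E t)) wE -scalemxAl Mcomp //.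
have yle k j t : (k <= j)%N -> p k (y j t) = p k (y k t).
  move=> kj; rewrite -(subnK kj); elim: (j - k)%N => [//|l IHl].
  rewrite -IHl addSn; apply/eqP; rewrite -subr_eq0 -homB; apply/eqP.
  by apply: (@pker_le (l + k)%N); rewrite ?leq_addl // homB yS subrr.
have H0 t : exists x, forall k, p k (i x) = p k (y k t).
  have [x xc] : exists x, gcvg (fun k => y k t) x.
    apply: cG => V /nbhs0_sym [W [W0 Wn WW _]]; have [k kW] := psmall W0.
    exists k => j l kj kl; rewrite -[y j t](subrK (y k t)) -addrA.
    apply: WW; apply: kW; by rewrite homB yle // subrr.
  have px k : p k x = p k (y k t).
    apply/eqP; rewrite eq_sym -subr_eq0 -homB; apply/eqP; apply: (@sA k) => V V0.
    have [N NV] := xc _ (cont_hom0 (p k) V0).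
    have := NV (maxn N k) (leq_maxl _ _); rewrite /= !homB yle //.
    exact: leq_maxr.
  (* At stage k the curve runs in the closure of the image of [H]; as the kernel of [p k] is small,
     its points are close to [H] in [G]. *)
  have [z _ zx] : range i x.
    apply: ic => V /nbhs0_sym [W [W0 _ WV _]]; have [k kW] := psmall W0.
    have [u Lu uE] := Py k; have [u' Lu' uu'] := Lu k (leqnn k).
    have := ML (leqnn k) Lu' t; rewrite -uu' => /(_ _ ((po k).2 _ W0)).
    move=> [_ [_ [z _ <-] <-] [w Ww wE]]; exists (i z); first by exists z.
    rewrite -[_ - _](subrK w) addrC; apply: WV => //; apply: kW.
    by rewrite homB wE homB px uE; zmod.
  by exists z => k; rewrite zx.
have [f fE] := choice (fun t : 'rV[R]_1 => H0 (t 0 0)).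
have fE' k : exists u, forall t, p k (i (f t)) = e k (t 0 0 *: u).
  by have [u _ uE] := Py k; exists u => t; rewrite fE.
have [g gE] : exists g : cont_hom 'rV[R]_1 H, g =1 f.
  apply: hom_exists => [s t|V /ie.2 [W W0 WV]].
    apply: ie.1; apply/eqP; rewrite -subr_eq0; apply/eqP/psep => k.
    have [u uE] := fE' k; rewrite !homB !uE !mxE scalerBl homB; zmod.
  have [W1 [W10 W1n W1W _]] := nbhs0_sym W0; have [k kW] := psmall W10.
  have [u uE] := fE' k.
  have [a aE] := mulmx_hom u.
  have := cont_hom0 a (cont_hom0 (e k) ((po k).2 _ W10)).
  apply: filterS => t /= [x W1x xE]; apply: WV.
  rewrite -(subrK x (i (f t))); apply: W1W => //; apply: kW.
  rewrite homB uE xE aE; apply/eqP; rewrite subr_eq0; apply/eqP; congr (e k _).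
  by apply/rowP => c; rewrite !mxE big_ord1.
exists g => t; rewrite gE; have [u _ uE] := Py 0%N.
by rewrite fE yy0 y0E.
Qed.

(** The lines of [H] over a basis of the liftable vectors at stage 0 give the chart [E]. It is open
    modulo the kernel of [q]: if x in [H] is small at the stage [J] of [stab], then its chart vector
    there belongs to the Lie algebra, so the image of that vector at stage 0 is liftable. *)
Lemma closed_subgroup_lie : exists (B : topologicalZmodType) (q : cont_hom H B),
  [/\ separated B, lie R B, open_surj q & forall x, q x = 0 <-> p 0%N (i x) = 0].
Proof.
have [B [q [qo qk]]] := quotient_exists (ker_subgroup (cont_hom_comp (p 0%N) i)).
exists B, q; split => //.
  apply/(open_surj_separated qo); rewrite (_ : mkset _ = [set x | cont_hom_comp (p 0%N) i x = 0]).
    exact: ker_closed.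
  by apply/seteqP; split=> x /qk.
have [D DE] := linear_set_row_space (@lin_liftable 0%N).
pose b := row_base D.
have Lb k : liftable (row k b).
  by apply/DE; rewrite (submx_trans (row_sub k b)) // eq_row_base.
have [f fE] := choice (fun k => lift_liftable (Lb k)).
have H1 k : exists g : cont_hom 'rV[R]_(\rank D) H, forall t, g t = f k (t *m delta_mx k 0).
  have [a aE] := mulmx_hom (delta_mx k 0 : 'M[R]_(\rank D, 1)).
  by exists (cont_hom_comp (f k) a) => t /=; rewrite aE.
have [h hE] := choice H1.
have [E EE] := hom_sum_exists (index_enum 'I_(\rank D)) h.
have pE t : p 0%N (i (E t)) = e 0%N (t *m b).
  rewrite EE !hom_sum mulmx_sum_row hom_sum; apply: eq_bigr => k _.
  by rewrite hE fE -colE mxE.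
exists (\rank D), (cont_hom_comp q E) => V /rV_nbhs0 [d d0 dV].
have [J _ stJ] := stab 0%N.
have [C C0 MC] := mulmx_norm_le (M J 0%N *m pinvmx b).
have [r r0 rL] := KL J.
have d1 : 0 < Num.min r (d / C) by rewrite lt_min r0 divr_gt0.
have U0 := cont_hom0 i (cont_hom0 (p J) (eo (nbhs0_ball (n J) d1))).
apply: filterS (qo.2 _ U0) => _ [x /= [w] + xE <-].
rewrite /= lt_min => /andP[wr wd].
have Lw : approx_lie w.
  by apply: rL => //; rewrite /approx /= xE; apply: sub_gclosure; exists (i x) => //; exists x.
have := stJ _ Lw; set v := w *m _ => Lv.
exists (v *m pinvmx b).
  apply: dV; rewrite /v -mulmxA (le_lt_trans (MC w)) // mulrC -ltr_pdivlMr //.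
rewrite /=; apply/eqP; rewrite -subr_eq0 -homB; apply/eqP/qk.
have vD : (v <= b)%MS by rewrite eq_row_base; exact/DE.
by rewrite /= !homB pE mulmxKpV // (MP (leq0n J) (esym xE)) subrr.
Qed.

End ClosedSubgroup.

(** The next quotient is chosen with kernel in [U k] and in a neighbourhood all of whose subgroups
    lie in the present kernel ([chart_nss]); this makes the kernels decrease. *)
Lemma prolie_closed_subgroup (R : realType) (H G : topologicalZmodType)
    (i : cont_hom H G) : embedding i -> gclosed (range i) -> separated G ->
  seqcomplete G -> countable_base0 G -> prolie R G -> prolie R H.
Proof.
move=> ie ic sG cG [U [U0 UV]] lG W /ie.2 [X X0 XW].
pose stage := {A : topologicalZmodType & {p : cont_hom G A &
  {n : nat & cont_hom 'rV[R]_n A}}}.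
pose good (s : stage) := let: existT A (existT p (existT n e)) := s in
  [/\ separated A, open_surj p, open0 e & inj0 e].
pose ker (s : stage) : set G := let: existT A (existT p _) := s in [set x | p x = 0].
have ex V : nbhs 0 V -> exists s, good s /\ ker s `<=` V.
  move=> /lG [A [p [sA lA po pV]]]; have [n [e [eo ei]]] := lie_chart sA lA.
  by exists (existT _ A (existT _ p (existT _ n e))).
have [s0 [gs0 s0X]] := ex _ X0.
have nss s : good s -> exists2 V, nbhs 0 V & forall N, subgroup N -> N `<=` V -> N `<=` ker s.
  case: s => [A [p [n e]]] [sA po eo ei]; have [V V0 VN] := chart_nss eo ei.
  exists (p @^-1` V); first exact: cont_hom0.
  move=> N sN NV x Nx; apply: (VN (p @` N)); last by exists x.
    exact: image_subgroup.
  by move=> _ [y Ny <-]; exact: NV.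
have ksub s : subgroup (ker s).
  by case: s => [A [p [n e]]]; exact: ker_subgroup.
have [|u [u0 gu kuS]] := @dependent_choice_seq _ (fun _ => good)
    (fun k s s' => ker s' `<=` ker s /\ ker s' `<=` U k) s0 gs0.
  move=> k s gs; have [V V0 VN] := nss s gs.
  have [s' [gs' s'V]] := ex _ (filterI V0 (U0 k)).
  exists s' => //; split=> x /=; last by move=> /s'V [].
  by apply: VN => [|y /s'V []].
have [] := @closed_subgroup_lie R H G i ie ic sG cG (fun k => projT1 (u k))
  (fun k => projT1 (projT2 (u k))) (fun k => projT1 (projT2 (projT2 (u k))))
  (fun k => projT2 (projT2 (projT2 (u k)))).
- by move=> k; have := gu k; case: (u k) => [A [p [n e]]] [].
- by move=> k; have := gu k; case: (u k) => [A [p [n e]]] [].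
- by move=> k; have := gu k; case: (u k) => [A [p [n e]]] [].
- by move=> k; have := gu k; case: (u k) => [A [p [n e]]] [].
- move=> k x; have [+ _] := kuS k; move/(_ x).
  by case: (u k) => [A [p [n e]]]; case: (u k.+1) => [A' [p' [n' e']]].
- move=> V /UV [k kV]; exists k.+1 => x ux; apply: kV.
  have [_] := kuS k; move/(_ x); apply; move: ux.
  by case: (u k.+1) => [A' [p' [n' e']]].
move=> B [q [sB lB qo qk]]; exists B, q; split=> // x /qk px.
apply: XW; apply: s0X; rewrite -u0; move: px.
by case: (u 0%N) => [A' [p' [n' e']]].
Qed.

(** * Polish groups: Klee's theorem and metrization *)

Section MetrizableGroups.
Variables (R : realType) (M : completeMetricType R).

Lemma fast_cauchy_cvg (w : nat -> M) :
  (forall j, ball (w j) (2^-1 ^+ j : R) (w j.+1)) ->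
  exists x : M, forall V : set M, nbhs x V ->
    exists N, forall k, (N <= k)%N -> V (w k).
Proof.
move=> wS.
have half0 k : 0 < 2^-1 ^+ k :> R by rewrite exprn_gt0.
have wd N k : mdist (w N) (w (N + k)%N) <= 2 * (2^-1 ^+ N - 2^-1 ^+ (N + k)) :> R.
  elim: k => [|k IHk]; first by rewrite addn0 mdistxx subrr mulr0.
  apply: le_trans (metric_triangle _ (w (N + k)%N) _) _.
  have := wS (N + k)%N; rewrite ballEmdist /= -addnS => /ltW.
  rewrite addnS exprS; set t := _ ^+ (N + k); set s := _ ^+ N in IHk *.
  by move: IHk; rewrite -/t -/s; lra.
have wN N k : (N <= k)%N -> ball (w N) (2 * 2^-1 ^+ N : R) (w k).
  move=> Nk; rewrite ballEmdist /= -(subnKC Nk); apply: le_lt_trans (wd _ _) _.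
  by rewrite ltr_pM2l // ltrBlDr ltrDl.
have small (d : R) : 0 < d -> exists N, 2 * 2^-1 ^+ N < d.
  move=> d0; apply: contrapT => /forallNP nex; have : d <= 0.
    by apply: (@exp2_le0 _ _ 2) => N; rewrite leNgt mulrC; apply/negP/nex.
  by rewrite leNgt d0.
have : cvg (w @ \oo).
  apply: cauchy_cvg; apply: cauchy_exP => d /small [N Nd].
  exists (w N), N => // k /= Nk; apply: le_ball (wN N k Nk); exact: ltW.
move=> wc; exists (lim (w @ \oo)) => V /wc [N _ NV]; exists N => k Nk.
exact: NV.
Qed.

Variables (G : topologicalZmodType) (f : G -> M) (g : M -> G).
Hypotheses (fc : continuous f) (gc : continuous g) (fK : cancel f g) (gK : cancel g f).

Let f_nbhs x V : nbhs x V -> exists2 d : R, 0 < d & forall y, ball (f x) d (f y) -> V y.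
Proof.
move=> Vx; have : nbhs (f x) (g @^-1` V) by apply: gc; rewrite fK.
move=> /nbhs_ballP [d /= d0 dV]; exists d => // y /dV /=.
by rewrite fK.
Qed.

Lemma metrizable_separated : separated G.
Proof.
apply/separatedP => x y xy; apply: (can_inj fK); apply: (@metric_hausdorff R M).
move=> A B /fc Ax /fc By; have [z [Az Bz]] := xy _ _ Ax By.
by exists (f z).
Qed.

Lemma metrizable_base0 : countable_base0 G.
Proof.
exists (fun k => f @^-1` ball (f 0) (k.+1%:R^-1 : R)); split.
  by move=> k; apply: fc; apply: nbhsx_ballx; rewrite invr_gt0.
move=> V /f_nbhs [d d0 dV].
have [N] := @ltr_add_invr R 0 d d0; rewrite add0r => Nd; exists N => y /= fy.
by apply: dV; apply: le_ball fy; exact: ltW.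
Qed.

(* Klee: with z_(k+1) = u_(m k) - z_k and m k large depending on z_k, both
   z_(2k) and z_(2k+1) converge for the metric, hence so does the subsequence
   u_(m k) = z_k + z_(k+1). *)
Lemma metrizable_seqcomplete : seqcomplete G.
Proof.
move=> u cu.
have step k (zm : G * nat) : exists m, [/\ (zm.2 <= m)%N, (k <= m)%N &
    forall m', (m <= m')%N -> ball (f zm.1) (2^-1 ^+ k : R) (f (zm.1 + (u m' - u m)))].
  have /nbhs_transl B0 : nbhs zm.1 (f @^-1` ball (f zm.1) (2^-1 ^+ k : R)).
    by apply: fc; apply: nbhsx_ballx; rewrite exprn_gt0.
  have [N NB] := cu _ B0; exists (maxn (maxn zm.2 k) N); split.
  - by rewrite !leq_max leqnn.
  - by rewrite !leq_max leqnn orbT.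
  - move=> m' mm'; apply: NB; last exact: leq_maxr.
    by apply: leq_trans mm'; exact: leq_maxr.
(* The state is z_k with the last index used. The invariant is trivial: all the information is in
   the relation between consecutive states. *)
have [s [s0 sP sS]] := @dependent_choice_seq (G * nat)
  (fun k zm => exists2 z, True & True)
  (fun k zm zm' => [/\ (zm.2 <= zm'.2)%N, (k <= zm'.2)%N, zm'.1 = u zm'.2 - zm.1 &
    forall m', (zm'.2 <= m')%N -> ball (f zm.1) (2^-1 ^+ k : R) (f (zm.1 + (u m' - u zm'.2)))])
  (0, 0%N) (ex_intro2 _ _ tt I I)
  (fun k zm _ => let: ex_intro m (And3 h1 h2 h3) := step k zm in
     ex_intro2 _ _ (u m - zm.1, m) (ex_intro2 _ _ tt I I) (And4 h1 h2 erefl h3)).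
pose z k := (s k).1; pose m k := (s k.+1).2.
have mk k : (k <= m k)%N by have [] := sS k.
have mS k : (m k <= m k.+1)%N by have [] := sS k.+1.
have zS k : z k.+1 = u (m k) - z k by have [] := sS k.
(* Here z_(k+2) = z_k + (u (m_(k+1)) - u (m_k)), a move bounded by the choice of m_k. *)
have zb k : ball (f (z k)) (2^-1 ^+ k : R) (f (z k.+2)).
  have [_ _ _ h] := sS k; have := h (m k.+1) (mS k).
  rewrite -/(z k) -/(m k) (_ : z k + _ = z k.+2) //.
  by rewrite !zS; zmod.
have half j i : ball (f (z (j.*2 + i)%N)) (2^-1 ^+ j : R) (f (z (j.+1.*2 + i)%N)).
  rewrite doubleS !addSn; apply: le_ball (zb _).
  rewrite -addnn -addnA exprD ler_piMr ?exprn_ge0 // exprn_ile1 // invf_le1 // ler1n //.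
have cv i : exists x : G, forall V : set G, nbhs x V -> exists N, forall k, (N <= k)%N -> V (z (k.*2 + i)%N).
  have [x xP] := fast_cauchy_cvg (fun j => half j i).
  exists (g x) => V /gc /xP [N NV]; exists N => k /NV /=.
  by rewrite fK.
have [a aP] := cv 0%N; have [b bP] := cv 1%N.
exists (a + b) => V V0; have [W [W0 _ _ WV]] := nbhs0_sum4 V0.
have Wsh x : nbhs x (fun y => W (y - x)).
  by apply/nbhs_transl; apply: filterS W0 => y; rewrite addrAC subrr add0r.
have [Na Ha] := aP _ (Wsh a); have [Nb Hb] := bP _ (Wsh b).
have [Nc Hc] := cu _ W0.
pose k := maxn (maxn Na Nb) Nc.
exists (maxn Nc (m k.*2)) => l; rewrite geq_max => /andP[cl ml].
have ka : W (z k.*2 - a) by rewrite -[k.*2]addn0; apply: Ha; rewrite /k; lia.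
have kb : W (z k.*2.+1 - b) by rewrite -addn1; apply: Hb; rewrite /k; lia.
have kc : W (u l - u (m k.*2)).
  apply: Hc => //; apply: leq_trans (mk _); rewrite /k; lia.
have -> : u l - (a + b) = (u l - u (m k.*2)) + (z k.*2 - a) + (z k.*2.+1 - b) + 0.
  by rewrite zS; zmod.
by apply: WV => //; exact: nbhs_singleton.
Qed.

End MetrizableGroups.

Definition polish_group (G : topologicalZmodType) :=
  [/\ separable_space G, separated G, countable_base0 G & seqcomplete G].

Lemma polish_polish_group (R : realType) (G : topologicalZmodType) :
  polish R G -> polish_group G.
Proof.
move=> [sepG [M [f [g [fc gc fK gK]]]]]; split => //.
- exact: metrizable_separated fc fK.
- exact: metrizable_base0 fc gc fK.
- exact: metrizable_seqcomplete fc gc fK.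
Qed.

Section UniformGroup.
Variable G : topologicalZmodType.

(** An alias that carries the translation-invariant uniformity, apart from the structures of [G]. *)
Definition uniform_group : Type := G.
HB.instance Definition _ := Choice.copy uniform_group G.

Local Open Scope relation_scope.

Let ent : set_system (uniform_group * uniform_group) :=
  filter_from [set U : set G | nbhs 0 U] (fun U => [set xy | U ((xy.2 : G) - (xy.1 : G))]).

Let ent_filter : Filter ent.
Proof.
apply: filter_from_filter; first by exists setT; exact: filterT.
move=> U V U0 V0; exists (U `&` V); first exact: filterI.
by move=> [x y] [].
Qed.

Let ent_diagonal A : ent A -> diagonal `<=` A.
Proof.
move=> [U U0 UA] [x y] /diagonalP ->; apply: UA => /=.
by rewrite subrr; exact: nbhs_singleton.
Qed.

Let ent_inv A : ent A -> ent A^-1.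
Proof.
move=> [U U0 UA]; exists (fun x => U (- x)); first exact: nbhs0_opp.
by move=> [x y] /= Uxy; apply: UA; rewrite /= -opprB.
Qed.

Let ent_split A : ent A -> exists2 B, ent B & B \; B `<=` A.
Proof.
move=> [U /nbhs0_sym [W [W0 _ WW _]] UA].
exists [set xy | W ((xy.2 : G) - (xy.1 : G))]; first by exists W.
move=> [x y] /= [z Wxz Wzy]; apply: UA => /=.
by rewrite (_ : y - x = (z - x) + (y - z)); [exact: WW|zmod].
Qed.

HB.instance Definition _ := isUniform.Build uniform_group
  ent_filter ent_diagonal ent_inv ent_split.

Lemma uniform_group_entourage (A : set (uniform_group * uniform_group)) :
  entourage A <-> exists2 U : set G, nbhs 0 U &
    forall x y : G, U (y - x) -> A (x, y).
Proof.
split=> [[U U0 UA]|[U U0 UA]]; exists U => //.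
  by move=> x y Uxy; exact: (UA (x, y)).
by move=> [x y]; exact: UA.
Qed.

Lemma uniform_group_countable : countable_base0 G -> countable_uniformity uniform_group.
Proof.
move=> [U [U0 UV]]; apply/countable_uniformityP.
exists (fun k => [set xy : uniform_group * uniform_group | U k ((xy.2 : G) - (xy.1 : G))]).
  move=> A /uniform_group_entourage [V /UV [k kV] VA]; exists k => -[x y] /= h.
  exact/VA/kV.
by move=> k; apply/uniform_group_entourage; exists (U k).
Qed.

End UniformGroup.

Section MetricGroup.
Variables (R : realType) (G : topologicalZmodType).
Hypotheses (sG : separated G) (bG : countable_base0 G) (cG : seqcomplete G).

Let T : pseudoMetricType R := countable_uniform (uniform_group_countable bG).
Let b (x : G) (e : R) (y : G) := @ball R T x e y.

Let b_small e : 0 < e -> exists2 U : set G, nbhs 0 U & forall x y, U (y - x) -> b x e y.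
Proof.
move=> e0; have /uniform_group_entourage [U U0 UA] :
    entourage ([set xy | b xy.1 e xy.2] : set (uniform_group G * uniform_group G)).
  exact: (@entourage_ball R T (PosNum e0)).
by exists U.
Qed.

Let small_b (U : set G) : nbhs 0 U -> exists2 e : R, 0 < e & forall x y, b x e y -> U (y - x).
Proof.
move=> U0; have : @entourage (uniform_group G) [set xy | U ((xy.2 : G) - (xy.1 : G))].
  by apply/uniform_group_entourage; exists U.
rewrite -[entourage]/(@entourage T) -entourage_ballE => -[e /= e0 eU].
by exists e => // x y xy; exact: (eU (x, y)).
Qed.

(** The uniformity yields a pseudometric given by balls only; the distance is the infimum of the
    radii, among which 2 always occurs. *)
Definition group_dist (x y : G) : R := inf [set e | 0 < e /\ b x e y].

Let dist_inf x y : has_inf [set e | 0 < e /\ b x e y].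
Proof.
split; last by exists 0 => e [/ltW].
by exists 2; split=> //; exact: countable_uniform.countable_uniform_bounded.
Qed.

Let dist_le x y e : 0 < e -> b x e y -> group_dist x y <= e.
Proof. by move=> e0 xy; apply: ge_inf => //; exact: (dist_inf x y).2. Qed.

Let dist_ge0 x y : 0 <= group_dist x y.
Proof. by apply: lb_le_inf; [exact: (dist_inf x y).1|move=> e [/ltW]]. Qed.

Let dist_lt x y e : group_dist x y < e -> b x e y.
Proof.
rewrite -subr_gt0 => h; have [d [d0 xy]] := inf_adherent h (dist_inf x y).
rewrite -/(group_dist x y) addrC subrK => de; apply: le_ball xy; exact: ltW.
Qed.

Let distxx x : group_dist x x = 0.
Proof.
apply/eqP; rewrite eq_le dist_ge0 andbT; apply/ler_addgt0Pl => e e0.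
by rewrite addr0; apply: dist_le => //; exact: (@ball_center R T x (PosNum e0)).
Qed.

Let dist_eq0 x y : group_dist x y = 0 -> x = y.
Proof.
move=> xy; apply/eqP; rewrite eq_sym -subr_eq0; apply/eqP; apply: sG => V.
by move=> /small_b [e e0]; apply; apply: dist_lt; rewrite xy.
Qed.

Let dist_sym x y : group_dist x y = group_dist y x.
Proof.
rewrite /group_dist; congr inf; apply/seteqP.
by split=> e [e0 xy]; split=> //; exact: (@ball_sym R T).
Qed.

Let dist_triangle y x z : group_dist x z <= group_dist x y + group_dist y z.
Proof.
apply/ler_addgt0Pl => e e0; have e20 : 0 < e / 2 by rewrite divr_gt0.
have xy : b x (group_dist x y + e / 2) y by apply: dist_lt; rewrite ltrDl.
have yz : b y (group_dist y z + e / 2) z by apply: dist_lt; rewrite ltrDl.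
rewrite [e in leRHS]splitr (_ : e / 2 + _ + _ =
  (group_dist x y + e / 2) + (group_dist y z + e / 2)); last by ring.
apply: dist_le; last exact: (@ball_triangle R T _ _ _ _ _ xy yz).
by rewrite addr_gt0 // ltr_wpDl.
Qed.

(** The [let] turns the three hypotheses into parameters of the alias, so that its instances can
    depend on them. *)
Definition metric_group : Type := let _ := (sG, cG, bG) in G.
HB.instance Definition _ := Choice.copy metric_group G.
HB.instance Definition _ := isMetric.Build R metric_group
  distxx dist_eq0 dist_sym dist_triangle.
HB.instance Definition _ := isPointed.Build metric_group (0 : G).

Let mball (x y : metric_group) (e : R) : ball x e y <-> group_dist x y < e.
Proof. by rewrite ballEmdist. Qed.

Let metric_nbhs (x : G) (V : set G) : nbhs (x : metric_group) V <-> nbhs x V.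
Proof.
split=> [/nbhs_ballP [e /= e0 eV]|/nbhs_transl /small_b [e e0 eV]].
  have [U U0 UB] := b_small (divr_gt0 e0 (ltr0n _ 2)).
  apply/nbhs_transl; apply: filterS U0 => y Uy; apply: eV; apply/mball.
  apply: (@le_lt_trans _ _ (e / 2)); last first.
    by rewrite ltr_pdivrMr // mulr_natr mulr2n ltrDl.
  by apply: dist_le; rewrite ?divr_gt0 //; apply: UB; rewrite addrC addKr.
apply/nbhs_ballP; exists e => // y /mball /dist_lt /eV.
by rewrite addrC subrK.
Qed.

Let metric_complete (F : set_system metric_group) :
  ProperFilter F -> cauchy F -> cvg F.
Proof.
move=> FF /cauchyP Fc.
have [V [V0 Vb Vn VV Vdec]] := countable_base0_halving bG.
(* Centres of ever smaller sets of the filter form a Cauchy sequence, and its limit is a limit of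
   the filter. *)
have ex k : exists x : metric_group, F [set y : G | V k (y - x)].
  have [e e0 eV] := small_b (V0 k); have [x xF] := Fc e e0; exists x.
  by apply: filterS xF => y /mball /dist_lt /eV.
have [u uP] := choice ex.
have Vle k l : (k <= l)%N -> V l `<=` V k.
  by move=> kl; rewrite -(subnK kl); elim: (l - k)%N => // j IHj x /Vdec/IHj.
have uu k l : (k.+1 <= l)%N -> V k (u l - u k.+1).
  move=> kl; have [y [/= y1 y2]] := filter_ex (filterI (uP k.+1) (uP l)).
  rewrite (_ : u l - u k.+1 = (y - u k.+1) + - (y - u l)); last by zmod.
  apply: VV => //; apply: Vn; exact: (Vle _ _ kl).
have [x xu] : exists x, gcvg (u : nat -> G) x.
  apply: cG => W /nbhs0_sym [X [X0 Xn XX _]]; have [k kX] := Vb _ X0.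
  exists k.+1 => i j ki kj.
  rewrite (_ : (u i : G) - u j = ((u i : G) - u k.+1) + - ((u j : G) - u k.+1)); last by zmod.
  by apply: XX; [|apply: Xn]; apply: kX; exact: uu.
apply/cvg_ex; exists (x : metric_group) => W /metric_nbhs /nbhs_transl.
move=> /nbhs0_sym [X [X0 Xn XX _]]; have [k kX] := Vb _ X0.
have [N NX] := xu _ X0; pose l := maxn N k.
apply: filterS (uP l) => y /= Vy.
have -> : y = x + ((y - u l) + (u l - x)) by zmod.
apply: XX; last by apply: NX; exact: leq_maxl.
by apply: kX; apply: (Vle _ _ _ _ Vy); exact: leq_maxr.
Qed.

HB.instance Definition _ := Uniform_isComplete.Build metric_group metric_complete.

Lemma metric_group_homeomorphic :
  exists M : completeMetricType R, homeomorphic G M.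
Proof.
exists metric_group; exists (fun x : G => x : metric_group), (fun x : metric_group => x : G).
by split=> // x V /metric_nbhs.
Qed.

End MetricGroup.

Lemma polishP (R : realType) (G : topologicalZmodType) :
  polish R G <-> polish_group G.
Proof.
split=> [|[sepG sG bG cG]]; first exact: polish_polish_group.
by split=> //; exact: metric_group_homeomorphic.
Qed.

(** * Permanence properties of Polish groups *)

Section PolishClosure.
Implicit Types (G H Q : topologicalZmodType).

Lemma separable_seq G : separable_space G <->
  exists s : nat -> G, forall x V, nbhs 0 V -> exists n, V (s n - x).
Proof.
split=> [[D + dD]|[s sD]].
  move=> /pfcard_geP[D0|/unsquash f].
    exists (fun=> 0) => x; have [|y [_]] := dD setT _ openT; first by exists 0.
    by rewrite D0.
  exists f => x V V0.
  have /nbhs_interior Vx : nbhs x (fun y => V (y - x)).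
    by apply/nbhs_transl; apply: filterS V0 => y; rewrite addrAC subrr add0r.
  have [|y [/interior_subset Vy Dy]] := dD _ _ (@open_interior _ (fun y => V (y - x))).
    by exists x; exact: nbhs_singleton.
  by have [n _ nE] := @surj _ _ _ _ f _ Dy; exists n; rewrite nE.
exists (range s); first exact: card_image_le.
move=> X [x Xx] oX; have /nbhs_transl X0 : nbhs x X by exact: open_nbhs_nbhs.
have [n] := sD x _ X0; rewrite addrC subrK => Xs.
by exists (s n); split=> //; exists n.
Qed.

Lemma polish_closed_subgroup H G (i : cont_hom H G) :
  embedding i -> gclosed (range i) -> polish_group G -> polish_group H.
Proof.
move=> ie ic [/separable_seq [s sD] sG bG cG]; split.
- have [U [U0 UV Un UU Ud]] := countable_base0_halving bG.
  (* For each dense point of [G] and each basic neighbourhood, some point of [H] that close to it,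
     and 0 if there is none: these points are dense in [H]. *)
  have ex (nk : nat * nat) : exists h, (exists h, U nk.2 (s nk.1 - i h)) -> U nk.2 (s nk.1 - i h).
    have [[h hU]|nh] := pselect (exists h, U nk.2 (s nk.1 - i h)); first by exists h.
    by exists 0.
  have [t tP] := choice ex.
  apply/separable_seq; exists (fun m => t (odflt (0, 0)%N (unpickle m))) => x V.
  move=> /ie.2 [W W0 WV]; have [k kW] := UV _ W0.
  have [n nU] := sD (i x) _ (U0 k.+1).
  exists (pickle (n, k.+1)); rewrite pickleK /=; apply: WV; rewrite homB; apply: kW.
  have /= h := tP (n, k.+1) (ex_intro _ x nU).
  rewrite (_ : _ - _ = (s n - i x) + - (s n - i (t (n, k.+1)))); last by zmod.
  by apply: UU => //; exact: Un.
- exact: embedding_separated ie sG.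
- have [U [U0 UV]] := bG; exists (fun k => i @^-1` U k); split.
    by move=> k; exact: cont_hom0.
  by move=> V /ie.2 [W /UV [k kW] WV]; exists k => x /kW /WV.
- move=> u cu; have [x ux] : exists x, gcvg (fun k => i (u k)) x.
    apply: cG => V /(cont_hom0 i) /cu [N NV]; exists N => k l Nk Nl.
    by rewrite -homB; exact: NV.
  have [y _ yx] : range i x.
    by apply: ic => V /ux [N NV]; exists (i (u N)); [exists (u N)|exact: NV].
  exists y => V /ie.2 [W /ux [N NW] WV]; exists N => k Nk; apply: WV.
  by rewrite homB yx; exact: NW.
Qed.

(** Along a subsequence, the terms are lifted one after the other, each lift differing from the
    previous one by an element of [U k]; the lifts converge in [G]. *)
Lemma seqcomplete_quotient G Q (q : cont_hom G Q) : open_surj q ->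
  countable_base0 G -> seqcomplete G -> seqcomplete Q.
Proof.
move=> qo /countable_base0_halving [U [U0 UV Un UU Ud]] cG u cu.
pose P k (xm : G * nat) := q xm.1 = u xm.2 /\
  forall j l, (xm.2 <= j)%N -> (xm.2 <= l)%N -> (q @` U k) (u j - u l).
have [N0 hN0] := cu _ (qo.2 _ (U0 0%N)); have [x0 x0E] := qo.1 (u N0).
have [|xm [_ xmP xmS]] := @dependent_choice_seq (G * nat) P
    (fun k xm xm' => U k (xm'.1 - xm.1) /\ (xm.2 <= xm'.2)%N) (x0, N0) (conj x0E hN0).
  move=> k [x m] /= [xE mU]; have [N NU] := cu _ (qo.2 _ (U0 k.+1)).
  have [d Ud' dE] := mU (maxn m N) m (leq_maxl _ _) (leqnn _).
  exists (x + d, maxn m N) => /=; last by rewrite addrC addKr leq_maxl.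
  split=> /=; first by rewrite homD xE dE addrC subrK.
  by move=> j l; rewrite !geq_max => /andP[_ Nj] /andP[_ Nl]; exact: NU.
pose x k := (xm k).1.
have tail j k : U k (x (k.+1 + j)%N - x k.+1).
  elim: j k => [|j IHj] k; first by rewrite addn0 subrr; exact: nbhs_singleton.
  rewrite addnS -addSn -(subrK (x k.+2) (x _)) -addrA; apply: UU; first exact: IHj.
  by have [] := xmS k.+1.
have [y xy] : exists y, gcvg x y.
  apply: cG => V /UV [k kV]; exists k.+2 => i j ki kj; apply: kV.
  have xU l : (k.+2 <= l)%N -> U k.+1 (x l - x k.+2).
    by move=> kl; rewrite -(subnKC kl); exact: tail.
  rewrite (_ : x i - x j = (x i - x k.+2) + - (x j - x k.+2)); last by zmod.
  by apply: UU; [|apply: Un]; exact: xU.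
exists (q y) => V /nbhs0_sym [W [W0 _ WW _]]; have [k kW] := UV _ (cont_hom0 q W0).
have [N NW] := xy _ (cont_hom0 q W0).
pose l := maxn N k; exists (xm l).2 => j lj.
have [qx mU] := xmP l.
rewrite -[u j](subrK (u (xm l).2)) -addrA; apply: WW.
  have Ukl : U l `<=` U k.
    have : (k <= l)%N by exact: leq_maxr.
    by move=> kl; rewrite -(subnK kl); elim: (l - k)%N => // i IHi z /Ud /IHi.
  by have [d /Ukl /kW Wd <-] := mU j (xm l).2 lj (leqnn _).
by rewrite -qx -homB; apply: NW; exact: leq_maxl.
Qed.

Lemma polish_quotient G Q (q : cont_hom G Q) :
  open_surj q -> separated Q -> polish_group G -> polish_group Q.
Proof.
move=> qo sQ [/separable_seq [s sD] sG bG cG]; split=> //.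
- apply/separable_seq; exists (fun n => q (s n)) => y V /(cont_hom0 q) V0.
  have [x <-] := qo.1 y; have [n nV] := sD x _ V0; exists n.
  by rewrite -homB.
- have [U [U0 UV]] := bG; exists (fun k => q @` U k); split.
    by move=> k; exact: qo.2.
  by move=> V /(cont_hom0 q) /UV [k kV]; exists k => _ [x /kV ? <-].
- exact: seqcomplete_quotient qo bG cG.
Qed.

Lemma separated_prod G H : separated G -> separated H -> separated (prod_top G H).
Proof.
move=> sG sH [x y] xy; have [i [j [p [q [_ _ pE qE]]]]] := biproduct_exists G H.
congr pair.
  by apply: sG => V /(cont_hom0 p) /xy; rewrite /= pE.
by apply: sH => V /(cont_hom0 q) /xy; rewrite /= qE.
Qed.

Lemma polish_prod G H : polish_group G -> polish_group H -> polish_group (prod_top G H).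
Proof.
move=> [/separable_seq [s sD] sG [U [U0 UV]] cG] [/separable_seq [t tD] sH [W [W0 WV]] cH].
have [i [j [p [q [_ _ pE qE]]]]] := biproduct_exists G H.
split.
- apply/separable_seq.
  exists (fun m => let nk := odflt (0, 0)%N (unpickle m) in (s nk.1, t nk.2)).
  move=> [x y] V /prod_nbhs0 [A [B [A0 B0 AB]]].
  have [n An] := sD x _ A0; have [k Bk] := tD y _ B0.
  by exists (pickle (n, k)); rewrite pickleK; exact: AB.
- exact: separated_prod.
- exists (fun m => let nk := odflt (0, 0)%N (unpickle m) in U nk.1 `*` W nk.2); split.
    move=> m /=; case: (odflt _ _) => a b /=; apply/prod_nbhs0.
    by exists (U a), (W b).
  move=> V /prod_nbhs0 [A [B [/UV [n nA] /WV [k kB] AB]]].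
  exists (pickle (n, k)); rewrite pickleK => -[x y] [/nA Ax /kB By].
  exact: AB.
- move=> u cu; have [x ux] : exists x, gcvg (fun k => p (u k)) x.
    apply: cG => V /(cont_hom0 p) /cu [N NV]; exists N => k l Nk Nl.
    by rewrite -homB; exact: NV.
  have [y uy] : exists y, gcvg (fun k => q (u k)) y.
    apply: cH => V /(cont_hom0 q) /cu [N NV]; exists N => k l Nk Nl.
    by rewrite -homB; exact: NV.
  exists (x, y) => V /prod_nbhs0 [A [B [/ux [N NA] /uy [M MB] AB]]].
  exists (maxn N M) => k; rewrite geq_max => /andP[/NA + /MB].
  rewrite pE qE; case: (u k) => a b; exact: AB.
Qed.

Lemma polish_trivial G : (forall x : G, x = 0) -> polish_group G.
Proof.
move=> G0; split.
- apply/separable_seq; exists (fun=> 0) => x V V0; exists 0%N.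
  by rewrite (G0 (_ - _)); exact: nbhs_singleton.
- by move=> x _.
- exists (fun=> setT); split=> [_|V V0]; first exact: filterT.
  by exists 0%N => x _; rewrite (G0 x); exact: nbhs_singleton.
- move=> u _; exists 0 => V V0; exists 0%N => k _.
  by rewrite (G0 (_ - _)); exact: nbhs_singleton.
Qed.

End PolishClosure.

Section ProLieClosure.
Variable R : realType.
Implicit Types (G H : topologicalZmodType).

Lemma prolie_trivial G : (forall x : G, x = 0) -> prolie R G.
Proof.
move=> G0 U U0; exists G, (cont_hom_id G); split.
- by move=> x _.
- exists 0%N, (cont_hom_zero 'rV[R]_0 G) => V V0; apply: filterS filterT => x _.
  by exists 0; [exact: nbhs_singleton|rewrite (G0 x)].
- split=> [y|V V0]; first by exists y.
  by apply: filterS V0 => x Vx; exists x.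
- by move=> x _; rewrite (G0 x); exact: nbhs_singleton.
Qed.

Lemma prolie_prod G H : separated G -> separated H ->
  prolie R G -> prolie R H -> prolie R (prod_top G H).
Proof.
move=> sG sH lG lH; have [i [j [p [q [iE jE pE qE]]]]] := biproduct_exists G H.
apply: (prolie_extension (i := i) (p := q)) => //.
- exact: separated_prod.
- split=> [x y|V V0]; first by rewrite !iE => -[].
  by exists (p @^-1` V); [exact: cont_hom0|move=> x /=; rewrite iE pE].
- split=> [y|V /prod_nbhs0 [A [B [A0 B0 AB]]]].
    by exists (0, y); rewrite qE.
  apply: filterS B0 => y By; exists (0, y); last by rewrite qE.
  by apply: AB => //; exact: nbhs_singleton A0.
- move=> [x y]; rewrite qE /=; split=> [->|[z]]; first by exists x; rewrite iE.
  by rewrite iE => -[].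
Qed.

End ProLieClosure.

(** * The structure of abelian Lie groups *)

Lemma subgroupMz (A : zmodType) (N : set A) x (z : int) :
  subgroup N -> N x -> N (x *~ z).
Proof.
move=> sN Nx; have ND k : N (x *+ k).
  by elim: k => [|k IHk]; [rewrite mulr0n; exact: sN.1|rewrite mulrS; exact: subgroupD].
by case: z => k; rewrite ?NegzE ?mulrNz -?pmulrn //; exact: subgroupN.
Qed.

(** Baer's argument: a subgroup [D] maximal with trivial intersection with [S] is a complement of
    [S]. *)
Lemma divisible_retraction (A : zmodType) (S : set A) : subgroup S ->
  (forall x k, S x -> (0 < k)%N -> exists2 y, S y & y *+ k = x) ->
  exists r : A -> A, [/\ GRing.zmod_morphism r, forall x, S (r x) & forall x, S x -> r x = x].
Proof.
move=> sS div.
(* [D] may be empty, so that the union of the empty chain qualifies; maximality then yields 0 in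
   [D]. *)
pose P (D : set A) := (forall x y, D x -> D y -> D (x - y)) /\
  forall x, D x -> S x -> x = 0.
have [|D [[DB DS] Dmax]] := @Zorn_bigcup A P.
  move=> F FP tF; split=> [x y [X FX Xx] [Y FY Yy]|x [X /FP[_ XS] Xx]]; last exact: XS.
  have [XY|YX] := tF _ _ FX FY.
    by exists Y => //; have [YB _] := FP _ FY; apply: YB => //; exact: XY.
  by exists X => //; have [XB _] := FP _ FX; apply: XB => //; exact: YX.
have maxD (E : set A) : P E -> D `<=` E -> E `<=` D.
  move=> PE DE; apply: contrapT => nED; exact: (Dmax E).
have D0 : D 0.
  have : P (D `|` [set 0]).
    split=> [x y [Dx|->] [Dy|->]|x [Dx|->] //]; last exact: DS.
    - by left; exact: DB.
    - by left; rewrite subr0.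
    - by left; rewrite -(subrr y); apply: (DB) => //; exact: DB.
    - by right; rewrite subrr.
  by move=> /maxD; apply; [left|right].
have sD : subgroup D by split.
have decomp x : exists2 a, S a & D (x - a).
  apply: contrapT => nx.
  pose T (z : int) := exists2 a, S a & D (x *~ z - a).
  have TB z z' : T z -> T z' -> T (z - z').
    move=> [a Sa Da] [a' Sa' Da']; exists (a - a'); first exact: sS.2.
    by rewrite mulrzBr (_ : _ - _ - _ = (x *~ z - a) - (x *~ z' - a')); [exact: DB|zmod].
  have T0 : T 0 by exists 0; [exact: sS.1|rewrite mulr0z subr0].
  have sT : subgroup T by split.
  (* If m > 0 is least with x *+ m in a + D for some a in [S], subtracting from x an m-th part of a
     moves all its multiples that lie in S + D into [D]. So D + Z x' still meets [S] trivially. *)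
  have [x' x'T] : exists x', (exists2 a, S a & x' = x - a) /\
      forall z, T z -> D (x' *~ z).
    have [[k k0 Tk]|nk] := pselect (exists2 k : nat, (0 < k)%N & T k).
      have exk : exists k, `[< (0 < k)%N /\ T k%:Z >] by exists k; exact/asboolP.
      have [m /asboolP [m0 [a Sa Da]] mmin] := ex_minnP exk.
      have [b Sb ba] := div a m Sa m0.
      have Dm : D ((x - b) *+ m) by rewrite mulrnBl ba; exact: Da.
      exists (x - b); split; first by exists b.
      have Tm : T m%:Z by exists a.
      move=> z Tz; rewrite (divz_eq z m).
      have -> : (z %% m)%Z = 0.
        have Tr : T (z %% m)%Z.
          have -> : (z %% m)%Z = z - (z %/ m)%Z * m by rewrite [X in X - _](divz_eq z m) addrC addKr.
          by apply: TB => //; rewrite mulrC -mulrzz; exact: subgroupMz.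
        have := modz_ge0 z (lt0n_neq0 m0 : m%:Z != 0).
        have := ltz_pmod z (m0 : (0 < m%:Z)%R).
        case: (z %% m)%Z Tr => // r Tr rm _.
        have [->//|r0] := posnP r.
        have mr : (m <= r)%N by apply: mmin; exact/asboolP.
        by move: rm; rewrite ltz_nat ltnNge mr.
      by rewrite addr0 mulrC mulrzA -pmulrn; exact: subgroupMz.
    exists x; split; first by exists 0; [exact: sS.1|rewrite subr0].
    move=> z Tz; suff -> : z = 0 by rewrite mulr0z.
    apply: contrapT => /eqP z0; apply: nk; exists `|z|%N; first by rewrite absz_gt0.
    by case: z Tz {z0} => k //; rewrite NegzE abszN => /(subgroupN sT); rewrite opprK.
  have [[a Sa x'E] x'D] := x'T.
  have nDx' : ~ D x' by move=> Dx'; apply: nx; exists a => //; rewrite -x'E.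
  pose E := [set y | exists2 z : int, True & D (y - x' *~ z)].
  apply: nDx'; apply: (maxD E).
  - split=> [y y' [z _ Dy] [z' _ Dy']|y [z _ Dy] Sy].
      exists (z - z') => //; rewrite mulrzBr (_ : _ - _ = (y - x' *~ z) - (y' - x' *~ z')).
        exact: DB.
      by zmod.
    have : D (x' *~ (- z)).
      apply: x'D; exists (- y + a *~ (- z)).
        by apply: subgroupD => //; [exact: subgroupN|exact: subgroupMz].
      rewrite (_ : _ - _ = y - x' *~ z) // x'E mulrzBl !mulrNz; zmod.
    move=> Dz; have : D y.
      rewrite (_ : y = (y - x' *~ z) - x' *~ (- z)); first exact: DB.
      by rewrite mulrNz; zmod.
    by move=> /DS; apply.
  - by move=> y Dy; exists 0 => //; rewrite mulr0z subr0.
  - by exists 1 => //; rewrite mulr1z subrr.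
have H x : exists a, S a /\ D (x - a) by have [a] := decomp x; exists a.
have [r rP] := choice H.
have uniq a b x : S a -> D (x - a) -> S b -> D (x - b) -> a = b.
  move=> Sa Da Sb Db; apply/eqP; rewrite -subr_eq0; apply/eqP; apply: DS; last exact: sS.2.
  by rewrite (_ : a - b = (x - b) - (x - a)); [exact: DB|zmod].
exists r; split=> [x y|x|x Sx]; last 2 first.
- by have [] := rP x.
- by have [Sr Dr] := rP x; apply: (uniq _ _ x) => //; rewrite subrr.
have [Sx Dx] := rP x; have [Sy Dy] := rP y; have [Sxy Dxy] := rP (x - y).
apply: (uniq _ _ (x - y)) => //; first exact: sS.2.
by rewrite (_ : _ - _ = (x - r x) - (y - r y)); [exact: DB|zmod].
Qed.

Section LieStructure.
Variable R : realType.

Lemma torus_hom : exists p : cont_hom R (torus R),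
  open_surj p /\ forall x : R, p x = 0 <-> x \is a Num.int.
Proof. exact: (quotient_hom (integers R)). Qed.

Lemma mx_continuous (T U : topologicalType) m n (f : T -> 'M[U]_(m, n)) :
  (forall i j, continuous (fun x => f x i j)) -> continuous f.
Proof.
move=> fc x V [P PV sPV].
have := @filter_forall _ _ (fun (ij : 'I_m * 'I_n) y => P ij.1 ij.2 (f y ij.1 ij.2)) _
  (nbhs_filter x) (fun ij => fc ij.1 ij.2 x _ (PV ij.1 ij.2)).
by apply: filterS => y h; apply: sPV => i j; exact: (h (i, j)).
Qed.

Lemma mx_coord_continuous (U : topologicalType) m n i j :
  continuous (fun A : 'M[U]_(m, n) => A i j).
Proof.
move=> A V VA; exists (fun i' j' => [set y | i' = i -> j' = j -> V y]).
  move=> i' j'; have [->|ni] := eqVneq i' i; last first.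
    by apply: filterS filterT => y _ /= E; rewrite E eqxx in ni.
  have [->|nj] := eqVneq j' j; last first.
    by apply: filterS filterT => y _ /= _ E; rewrite E eqxx in nj.
  by apply: filterS VA => y Vy _ _.
by move=> B BV /=; exact: BV.
Qed.

Lemma continuous_pair (T U V : topologicalType) (f : T -> U) (g : T -> V) :
  continuous f -> continuous g -> continuous (fun x => (f x, g x)).
Proof. by move=> fc gc x; apply: cvg_pair; [exact: fc|exact: gc]. Qed.

Lemma continuous_add (T : topologicalType) (A : topologicalZmodType) (f g : T -> A) :
  continuous f -> continuous g -> continuous (fun x => f x + g x).
Proof.
move=> fc gc x.
apply: (@cvg_comp _ _ _ (fun x => (f x, g x)) (fun p : A * A => p.1 + p.2) _
  (nbhs (f x, g x))); last exact: (@add_continuous A (f x, g x)).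
by apply: cvg_pair; [exact: fc|exact: gc].
Qed.

Lemma continuous_sum (T : topologicalType) (A : topologicalZmodType) (I : Type)
    (s : seq I) (f : I -> T -> A) : (forall i, continuous (f i)) ->
  continuous (fun x => \sum_(i <- s) f i x).
Proof.
move=> fc; elim: s => [|i s IHs].
  by move=> x; under eq_fun do rewrite big_nil; exact: cvg_cst.
rewrite (_ : (fun x => _) = (fun x => f i x + \sum_(i <- s) f i x)).
  by apply: continuous_add.
by apply/funext => x; rewrite big_cons.
Qed.

Lemma line_hom n (w : 'rV[R]_n) :
  exists f : cont_hom R 'rV[R]_n, forall t, f t = t *: w.
Proof.
apply: hom_exists => [x y|V /rV_nbhs0 [d d0 dV]]; first exact: scalerBl.
have w1 : 0 < 1 + `|w| by rewrite ltr_pwDl.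
apply/nbhs_ballP; exists (d / (1 + `|w|)); first by rewrite /= divr_gt0.
move=> t; rewrite -ball_normE /ball_ /= sub0r normrN => td; apply: dV.
rewrite normrZ (@le_lt_trans _ _ (`|t| * (1 + `|w|))) // ?ler_wpM2l ?lerDr //.
by rewrite -ltr_pdivlMr.
Qed.

(** The range of [e] is open, and divisible as an image of R^n; so it splits off with a discrete
    complement, the kernel of [rho]. A chosen chart vector xi x is unique up to the lattice [K], so
    its [Q]-coordinates are well defined, and its [P]-coordinates are so modulo integers: these are
    the vector and torus components. *)
Lemma lie_abelian_lie (A : topologicalZmodType) :
  separated A -> separable_space A -> lie R A -> abelian_lie R A.
Proof.
move=> sA /separable_seq [s sD] lA; have [n [e [eo [r r0 er]]]] := lie_chart sA lA.
pose K := [set w | e w = 0]; have sK : subgroup K := ker_subgroup e.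
have [d [m [B [C [P [Q [[BP BQ CP CQ PQ] KE]]]]]]] :=
  discrete_subgroup_coordinates sK (ex_intro2 _ _ r r0 (fun w Kw wr => er w wr Kw)).
have A0 : nbhs 0 (range e) by apply: eo; exact: filterT.
have [|rho [rm rS rid]] := divisible_retraction (range_subgroup e).
  move=> _ k [w _ <-] k0; exists (e (k%:R^-1 *: w)); first by exists (k%:R^-1 *: w).
  by rewrite -homMn scalerMnl -mulr_natr mulVf ?scale1r // pnatr_eq0 -lt0n.
have rN x : rho (- x) = - rho x by rewrite -sub0r rm -(subrr 0) rm !subrr sub0r.
have rD x y : rho (x + y) = rho x + rho y by rewrite -[y in LHS]opprK rm rN opprK.
have [xi xiE] : exists xi : A -> 'rV[R]_n, forall x, e (xi x) = rho x.
  have H x : exists w, e w = rho x by have [w _ we] := rS x; exists w.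
  by have [xi] := choice H; exists xi.
have xiK x w : e w = rho x -> exists z : 'rV[int]_d, xi x = w + map_mx intr z *m B.
  move=> ew; have /KE [z zE] : K (xi x - w) by rewrite /K /= homB xiE ew subrr.
  by exists z; rewrite -zE addrC subrK.
have xiQ x w : e w = rho x -> xi x *m Q = w *m Q.
  by move=> /xiK [z ->]; rewrite mulmxDl -mulmxA BQ mulmx0 addr0.
have [p [po pk]] := torus_hom.
have xiP x w i : e w = rho x -> p ((xi x *m P) 0 i) = p ((w *m P) 0 i).
  move=> /xiK [z ->]; apply/eqP; rewrite -subr_eq0 -homB; apply/eqP/pk.
  rewrite mulmxDl -mulmxA BP mulmx1; move: (w *m P) => u.
  rewrite !mxE; set a := u 0 i; set b := _%:~R.
  by rewrite (_ : a + b - a = b) ?intr_int //; ring.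
have [f1 f1E] : exists f : cont_hom A 'rV[R]_m, forall x, f x = xi x *m Q.
  apply: hom_exists => [x y|V V0].
    by rewrite -mulmxBl; apply: xiQ; rewrite homB !xiE rm.
  have [q qE] := mulmx_hom Q; apply: filterS (eo _ (cont_hom0 q V0)).
  move=> _ [w /= Vw <-]; rewrite (xiQ _ w) -?qE // rid //; by exists w.
have H2 i : exists f : cont_hom A (torus R), forall x, f x = p ((xi x *m P) 0 i).
  apply: hom_exists => [x y|V V0].
    have -> : p ((xi x *m P) 0 i) - p ((xi y *m P) 0 i) =
        p (((xi x - xi y) *m P) 0 i).
      by rewrite -homB mulmxBl; move: (xi x *m P) (xi y *m P) => a b; rewrite !mxE.
    by apply: xiP; rewrite homB !xiE rm.
  have [q qE] := mulmx_hom (P *m delta_mx i 0 : 'M[R]_(n, 1)).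
  have /nbhs_ballP [h /= h0 hV] := cont_hom0 p V0.
  apply: filterS (eo _ (cont_hom0 q (nbhs0_ball 1 h0))).
  move=> _ [w /= wh <-] /=; have ew : rho (e w) = e w by apply: rid; exists w.
  rewrite (xiP _ w) ?ew //.
  apply: hV; rewrite -ball_normE /ball_ /= sub0r normrN.
  apply: le_lt_trans wh; rewrite qE mulmxA -colE.
  by apply: le_trans (rV_coord_le _ 0); rewrite [X in _ <= `|X|]mxE.
have [f2 f2E] := choice H2.
have sker : subgroup [set x | rho x = 0].
  split=> [|x y /= x0 y0] /=; first by rewrite -(subrr 0) rm !subrr.
  by rewrite rm x0 y0 subrr.
have [D [j [je jr]]] := subgroup_exists sker.
have rj y : rho (j y) = 0.
  have : range j (j y) by exists y.
  by rewrite jr.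
have [h hE] : exists h : cont_hom A A, forall x, h x = x - rho x.
  apply: hom_exists => [x y|V V0]; first by rewrite rm; zmod.
  apply: filterS A0 => x xe /=; rewrite rid // subrr; exact: nbhs_singleton.
have [f3 f3E] : exists f : cont_hom A D, forall x, j (f x) = x - rho x.
  have [|f fE] := embedding_factor (f := h) je; last by exists f => x; rewrite fE hE.
  move=> x; have : [set x | rho x = 0] (h x) by rewrite /= hE rm (rid (rho x)) ?subrr.
  by rewrite -jr => -[y _ yx]; exists y.
have [c cE] := mulmx_hom C.
pose g1 := cont_hom_comp e c.
have Hg i : exists f : cont_hom (torus R) A, forall t, f (p t) = e (t *: row i B).
  have [l lE] := line_hom (row i B).
  have [|f fE] := open_surj_factor (f := cont_hom_comp e l) po; last first.
    by exists f => t; rewrite fE /= lE.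
  move=> t /pk /intrP [z ->] /=; rewrite lE.
  have /KE : exists z' : 'rV[int]_d, z%:~R *: row i B = map_mx intr z' *m B.
    exists (z *: delta_mx 0 i).
    by rewrite rowE scalemxAl; congr (_ *m _); apply/rowP => k; rewrite !mxE rmorphM /= rmorph_nat.
  by [].
have [g2 g2E] := choice Hg.
pose g (u : 'rV[R]_m * 'rV[torus R]_d * D) : A :=
  g1 u.1.1 + \sum_(i <- index_enum 'I_d) g2 i (u.1.2 0 i) + j u.2.
pose F x : 'rV[R]_m * 'rV[torus R]_d * D := (f1 x, \row_i f2 i x, f3 x).
have torus_repr (tau : 'rV[torus R]_d) : exists t : 'rV[R]_d, forall i, p (t 0 i) = tau 0 i.
  have Ht i : exists t, p t = tau 0 i by exact: po.1.
  by have [t tE] := choice Ht; exists (\row_i t i) => i; rewrite mxE.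
have gE v (t : 'rV[R]_d) y (tau : 'rV[torus R]_d) : (forall i, p (t 0 i) = tau 0 i) ->
    g (v, tau, y) = e (v *m C + t *m B) + j y.
  move=> tE; rewrite /g /= cE homD; congr (_ + _ + _).
  rewrite mulmx_sum_row hom_sum; apply: eq_bigr => i _.
  by rewrite -tE g2E.
exists m, d, D; split.
(* Distinct points of [D] lie in distinct cosets of the open subgroup range e, and every coset
   contains a term of the dense sequence. *)
- apply/countable_injP.
  have Hn (y : D) : exists n, range e (s n - j y) by have [k kE] := sD (j y) _ A0; exists k.
  have [k kE] := choice Hn; exists k => x y _ _ xy.
  have : range e (j x - j y).
    rewrite (_ : j x - j y = (s (k x) - j y) - (s (k x) - j x)); last by zmod.
    by apply: (range_subgroup e).2; [rewrite xy|].
  move=> /rid; rewrite rm !rj subrr => /esym/eqP; rewrite subr_eq0 => /eqP.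
  exact: je.1.
- move=> x; rewrite openE => _ ->; apply/nbhs_transl.
  apply: filterS (cont_hom0 j A0) => y /= /rid; rewrite rj => jy.
  by rewrite (_ : y = 0) ?addr0 //; apply: je.1; rewrite -jy hom0.
- exists F, g; split.
  + move=> x y; rewrite /F !homB; congr (_, _, _).
    by apply/rowP => i; rewrite !mxE homB.
  + apply: (continuous_pair (f := fun x => (f1 x, \row_i f2 i x)) (g := f3)).
      apply: (continuous_pair (f := f1) (g := fun x => \row_i f2 i x)).
        exact: cont_hom_continuous.
      apply: mx_continuous => i k.
      rewrite (_ : (fun x => _) = f2 k); first exact: cont_hom_continuous.
      by apply/funext => z; rewrite mxE.
    exact: cont_hom_continuous.
  + apply: continuous_add; first apply: continuous_add.
    * move=> u; apply: (@cvg_comp _ _ _ (fun u : 'rV[R]_m * 'rV[torus R]_d * D => u.1.1) g1 _ (nbhs u.1.1)); last exact: (cont_hom_continuous (c := g1)).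
      by apply: (@cvg_comp _ _ _ fst fst _ (nbhs u.1)); exact: cvg_fst.
    * apply: continuous_sum => i u.
      apply: (@cvg_comp _ _ _ (fun u : 'rV[R]_m * 'rV[torus R]_d * D => u.1.2 0 i) (g2 i) _ (nbhs (u.1.2 0 i))); last exact: (cont_hom_continuous (c := g2 i)).
      apply: (@cvg_comp _ _ _ (fun u : 'rV[R]_m * 'rV[torus R]_d * D => u.1.2) (fun M : 'rV[torus R]_d => M 0 i) _ (nbhs u.1.2)).
        by apply: (@cvg_comp _ _ _ fst snd _ (nbhs u.1)); [exact: cvg_fst|exact: cvg_snd].
      exact: mx_coord_continuous.
    * move=> u; apply: (@cvg_comp _ _ _ snd j _ (nbhs u.2)); first exact: cvg_snd.
      exact: cont_hom_continuous.
  + move=> x; rewrite /F (gE _ (xi x *m P)); last by move=> i; rewrite [RHS]mxE f2E.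
    rewrite f1E f3E -!mulmxA -mulmxDr [Q *m C + _]addrC PQ mulmx1 xiE.
    by rewrite addrC subrK.
  + move=> [[v tau] y]; have [t tE] := torus_repr tau.
    rewrite (gE _ _ _ _ tE) /F; set w := v *m C + t *m B.
    have rw : e w = rho (e w + j y) by rewrite rD rj addr0 rid //; exists w.
    congr (_, _, _).
    * by rewrite f1E (xiQ _ _ rw) /w mulmxDl -!mulmxA CQ BQ mulmx1 mulmx0 addr0.
    * apply/rowP => i; rewrite [LHS]mxE f2E (xiP _ _ _ rw) /w mulmxDl -!mulmxA CP BP.
      by rewrite mulmx1 mulmx0 add0r tE.
    * by apply: je.1; rewrite f3E -rw addrC addKr.
Qed.

(** The chart covers R^m and the torus by R^(m+d) with third component 0; it is open because [D] is
    discrete. *)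
Lemma abelian_lie_lie (A : topologicalZmodType) : abelian_lie R A -> lie R A.
Proof.
move=> [m [d [D [_ Ddisc [F [g [Fm Fc gc FK gK]]]]]]].
have [p [po pk]] := torus_hom.
have [a aE] := @mulmx_hom R (m + d) m (col_mx 1%:M 0).
pose E (w : 'rV[R]_(m + d)) : 'rV[R]_m * 'rV[torus R]_d * D :=
  (lsubmx w, map_mx p (rsubmx w), 0).
have Em : GRing.zmod_morphism E.
  move=> x y; rewrite /E; congr (_, _, _); last by rewrite subr0.
    by apply/rowP => i; rewrite !mxE.
  by apply/rowP => i; rewrite !mxE homB.
have gm : GRing.zmod_morphism g.
  by move=> x y; apply: (can_inj FK); rewrite Fm !gK.
have Fz : F 0 = 0 by rewrite -(subrr 0) Fm subrr.
have gz : g 0 = 0 by rewrite -Fz FK.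
have lsub_le (w : 'rV[R]_(m + d)) : `|lsubmx w| <= `|w|.
  by apply: rV_norm_le => // i; rewrite mxE rV_coord_le.
have E0 : E 0 = 0.
  rewrite /E; congr (_, _, _); apply/rowP => i; rewrite !mxE //.
  exact: hom0.
have [e eE] : exists e : cont_hom 'rV[R]_(m + d) A, forall w, e w = g (E w).
  apply: hom_exists => [x y|V V0]; first by rewrite Em gm.
  have : nbhs (0 : 'rV[R]_m * 'rV[torus R]_d * D) (g @^-1` V) by apply: gc; rewrite gz.
  move=> [[X Y] /= [[[X1 X2] /= [X10 [Z Z0 ZX]] XX] Y0] XY].
  have /rV_nbhs0 [h h0 hX] := X10.
  have Zh i : exists2 r : R, 0 < r & forall t, `|t| < r -> Z 0 i (p t).
    have := Z0 0 i; rewrite mxE => /(cont_hom0 p) /nbhs_ballP [r /= r0 rZ].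
    by exists r => // t tr; apply: rZ; rewrite -ball_normE /ball_ /= sub0r normrN.
  have Hi i : nbhs (0 : 'rV[R]_(m + d)) [set w | Z 0 i (p (rsubmx w 0 i))].
    have [r r0 rZ] := Zh i; apply/rV_nbhs0; exists r => // w wr; apply: rZ.
    by apply: le_lt_trans wr; rewrite mxE rV_coord_le.
  have := @filter_forall _ _ (fun i w => Z 0 i (p (rsubmx w 0 i))) _ (nbhs_filter _) Hi.
  apply: filterS2 (nbhs0_ball (m + d) h0) => w /= wh wZ; apply: (XY (_, _)) => /=; split.
    apply: (XX (_, _)); split=> /=; first by apply: hX; exact: le_lt_trans wh.
    by apply: ZX => i j; rewrite !mxE; have := wZ j; rewrite (ord1 i) mxE.
  exact: nbhs_singleton Y0.
exists (m + d)%N, e => V /rV_nbhs0 [h h0 hV].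
pose T := [set u : 'rV[R]_m * 'rV[torus R]_d * D | exists2 w, `|w| < h & u = E w].
have T0 : nbhs (0 : 'rV[R]_m * 'rV[torus R]_d * D) T.
  exists ([set v : 'rV[R]_m | `|v| < h] `*` [set tau : 'rV[torus R]_d | forall i, (p @` ball (0 : R) h) (tau 0 i)], [set 0]) => /=.
    split; last by apply: open_nbhs_nbhs; split.
    exists ([set v : 'rV[R]_m | `|v| < h], [set tau : 'rV[torus R]_d | forall i, (p @` ball (0 : R) h) (tau 0 i)]) => //=.
    split; first exact: nbhs0_ball.
    exists (fun _ _ => p @` ball (0 : R) h) => [i k|tau /= tauP i]; last exact: tauP.
    by rewrite mxE; apply: po.2; exact: nbhsx_ballx.
  move=> [[v tau] y] /= [[vh tauh] ->].
  have Ht i : exists t : R, `|t| < h /\ p t = tau 0 i.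
    have [t th tE] := tauh i; exists t; split=> //.
    by move: th; rewrite -ball_normE /ball_ /= sub0r normrN.
  have [t tP] := choice Ht; pose t' : 'rV[R]_d := \row_i t i.
  have t'h : `|t'| < h.
    have [/eqP t0|t0] := boolP (mx_norm t' == 0); first by rewrite [`|t'|]t0.
    have [[k i] /= E1] := mx_norm_neq0 t0; rewrite [`|t'|]E1 mxE.
    by have [] := tP i.
  exists (row_mx v t').
    rewrite (@le_lt_trans _ _ (Num.max `|v| `|t'|)) //; last by rewrite gt_max vh.
    apply: rV_norm_le => [|k]; first by rewrite le_max normr_ge0.
    rewrite -(splitK k) le_max; case: (fintype.split k) => l /=.
      by rewrite row_mxEl rV_coord_le.
    by rewrite row_mxEr rV_coord_le orbT.
  rewrite /E row_mxKl row_mxKr; congr (_, _, _).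
  by apply/rowP => i; rewrite !mxE; have [] := tP i.
have : nbhs 0 (F @^-1` T) by apply: Fc; rewrite Fz.
apply: filterS => x [w wh xw]; exists w; first exact: hV.
by rewrite eE -xw FK.
Qed.

End LieStructure.

Lemma set_zmodClosedP (G : topologicalZmodType) (N : set G) (sN : subgroup N) :
  [set x | x \in set_zmodClosed sN] = N.
Proof. by apply/seteqP; split=> x; rewrite /= set_zmodClosedE => /asboolP. Qed.

(** Separability of the quotient, inherited from [G], supplies the countability that [lie] omits. *)
Lemma pro_lieP (R : realType) (G : topologicalZmodType) :
  polish_group G -> pro_lie R G <-> prolie R G.
Proof.
move=> pG; have [_ sG _ _] := pG; split=> lG U U0.
  have [N [cN NU lN]] := lG U U0; have [q [qo qk]] := quotient_hom N.
  exists (quotient_group N), q; split => //.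
  - apply/(open_surj_separated qo); rewrite (_ : mkset _ = [set x | x \in N]).
      exact/gclosedP.
    by apply/seteqP; split=> x /qk.
  - exact: abelian_lie_lie.
  - by move=> x /qk Nx; exact: NU.
have [A [p [sA lA po pU]]] := lG U U0.
pose N := set_zmodClosed (ker_subgroup p).
have [q [qo qk]] := quotient_hom N.
have NE x : x \in N <-> p x = 0.
  by rewrite set_zmodClosedE; split=> [/asboolP|px]; last exact/asboolP.
have [g gE] : exists g : cont_hom A (quotient_group N), forall x, g (p x) = q x.
  by apply: (open_surj_factor po) => x px; apply/qk/NE.
have go : open_surj g.
  split=> [y|V /(cont_hom0 p) /qo.2].
    by have [x <-] := qo.1 y; exists (p x).
  by apply: filterS => _ [x Vx <-]; exists (p x).
have cN : gclosed [set x | x \in N].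
  by rewrite set_zmodClosedP; exact: ker_closed.
have sQ : separated (quotient_group N).
  apply/(open_surj_separated qo); rewrite (_ : mkset _ = [set x | x \in N]) //.
  by apply/seteqP; split=> x /qk.
exists N; split.
- exact/gclosedP.
- by move=> x /= /NE /pU.
- apply: lie_abelian_lie => //; last exact: lie_open_surj go lA.
  by have [] := polish_quotient qo sQ pG.
Qed.

Local Open Scope cat_scope.

(** * Kernels, cokernels and quasi-abelian axioms for classes of Hausdorff groups *)

Section ConcreteCategory.
Variables (Ob : Type) (U : Ob -> topologicalZmodType).

(* The full subcategories of [TopAb] in the theorem, including the iterated
   one, are convertible to categories of this form. *)
Definition conc : category := @Category Ob (fun a b => cont_hom (U a) (U b))
  (fun a => cont_hom_id (U a)) (fun a b c g f => cont_hom_comp g f)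
  (fun a b c d h g f => cont_hom_compA h g f) (fun a b f => cont_hom_comp1m f)
  (fun a b f => cont_hom_compm1 f).

(** Each construction is requested only through its characteristic maps, so any isomorphic copy in
    the family will do. *)
Record concrete_family : Prop := ConcreteFamily {
  conc_sep : forall a, separated (U a);
  conc_sub : forall a (N : set (U a)), subgroup N -> gclosed N ->
    exists b (i : cont_hom (U b) (U a)), embedding i /\ range i = N;
  conc_quot : forall a (N : set (U a)), subgroup N -> gclosed N ->
    exists b (q : cont_hom (U a) (U b)), open_surj q /\ forall x, q x = 0 <-> N x;
  conc_prod : forall a b, exists c (i : cont_hom (U a) (U c)) (j : cont_hom (U b) (U c))
      (p : cont_hom (U c) (U a)) (q : cont_hom (U c) (U b)),
    [/\ forall x, p (i x) = x, forall y, q (j y) = y, forall y, p (j y) = 0,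
        forall x, q (i x) = 0 & forall z, i (p z) + j (q z) = z];
  conc_zero : exists z, forall x : U z, x = 0 }.

Hypothesis fam : concrete_family.

Let hom_ext a b (f g : cont_hom (U a) (U b)) : (forall x, f x = g x) -> f = g.
Proof. exact: cont_hom_ext. Qed.

Lemma conc_zero_object z : is_zero_object (C := conc) z <-> forall x : U z, x = 0.
Proof.
split=> [hz x|z0 a].
  have [[f [_ fu]] _] := hz z.
  have /= h1 := fu (cont_hom_id (U z)) Logic.I; have /= h2 := fu (cont_hom_zero (U z) (U z)) Logic.I.
  by have := congr1 (fun h : cont_hom (U z) (U z) => h x) (etrans (esym h1) h2).
split; exists (cont_hom_zero _ _); split=> // f _; apply: hom_ext => x /=.
  by rewrite (z0 (f x)).
by rewrite (z0 x) hom0.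
Qed.

Lemma conc_zero_morphism a b (f : cont_hom (U a) (U b)) :
  is_zero_morphism (C := conc) f <-> forall x, f x = 0.
Proof.
split=> [[z [u [v [/conc_zero_object z0 ->]]]] x /=|f0].
  by rewrite (z0 (u x)) hom0.
have [z z0] := conc_zero fam.
exists z, (cont_hom_zero _ _), (cont_hom_zero _ _); split; first exact/conc_zero_object.
by apply: hom_ext => x; rewrite f0.
Qed.

(** A categorical kernel is compared with the actual subgroup f = 0; uniqueness in the universal
    property makes the comparison map injective and open onto its image. *)
Lemma conc_kernelP a b c (f : cont_hom (U b) (U c)) (k : cont_hom (U a) (U b)) :
  is_kernel_of (C := conc) f k <-> embedding k /\ forall x, f x = 0 <-> exists y, k y = x.
Proof.
split=> [[/conc_zero_morphism fk ku]|[ke kf]]; last first.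
  split; first by apply/conc_zero_morphism => x; apply/kf; exists x.
  move=> y u /conc_zero_morphism fu.
  have [|h hE] := embedding_factor (f := u) ke; first by move=> x; apply/kf/fu.
  exists h; split; first by apply: hom_ext => x; exact: hE.
  move=> h' h'E; apply: hom_ext => x; apply: ke.1; rewrite hE.
  by rewrite -h'E.
have [d [i [ie ir]]] := conc_sub fam (ker_subgroup f) (@ker_closed _ _ f (@conc_sep fam c)).
have irE x : f x = 0 <-> exists y, i y = x.
  rewrite -[f x = 0]/([set x | f x = 0] x) -ir.
  by split=> [[y _ <-]|[y <-]]; exists y.
have zi : is_zero_morphism (C := conc) (cont_hom_comp f i).
  by apply/conc_zero_morphism => x; apply/irE; exists x.
have [h [hE _]] := ku d i zi.
have {}hE x : k (h x) = i x by rewrite -hE.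
have [g gE] : exists g : cont_hom (U a) (U d), forall x, i (g x) = k x.
  by apply: embedding_factor ie _ => x; apply/irE/fk.
have hg x : h (g x) = x.
  have zk : is_zero_morphism (C := conc) (cont_hom_comp f k) by apply/conc_zero_morphism.
  have [h1 [_ h1u]] := ku a k zk.
  have E1 := h1u (cont_hom_id (U a)) (compm1 _).
  have E2 : h1 = cont_hom_comp h g by apply: h1u; apply: hom_ext => y /=; rewrite hE gE.
  by have := congr1 (fun h : cont_hom (U a) (U a) => h x) (etrans (esym E2) E1).
split; last first.
  move=> x; rewrite irE; split=> [[y <-]|[y <-]]; first by exists (h y); rewrite hE.
  by exists (g y); rewrite gE.
split=> [x y|V V0].
  by rewrite -!gE => /ie.1 gxy; rewrite -(hg x) -(hg y) gxy.
have [W W0 WV] := ie.2 _ (cont_hom0 h V0).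
by exists W => // x; rewrite -gE => /WV /=; rewrite hg.
Qed.

(** The closure enters because all targets are Hausdorff: a map that kills the range of [f] kills
    its closure. *)
Lemma conc_cokernelP a b c (f : cont_hom (U a) (U b)) (q : cont_hom (U b) (U c)) :
  is_cokernel_of (C := conc) f q <->
  open_surj q /\ forall x, q x = 0 <-> gclosure (range f) x.
Proof.
have sr := range_subgroup f.
split=> [[/conc_zero_morphism qf qu]|[qo qk]]; last first.
  split; first by apply/conc_zero_morphism => x; apply/qk/sub_gclosure; exists x.
  move=> y u /conc_zero_morphism uf.
  have uk x : q x = 0 -> u x = 0.
    move=> /qk xf; have /= h := @ker_closed _ _ u (@conc_sep fam y) x; apply: h.
    by move=> V /xf [_ [z _ <-] Vz]; exists (f z) => //; exact: uf.
  have [h hE] := open_surj_factor qo uk.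
  exists h; split; first by apply: hom_ext => x; exact: hE.
  move=> h' h'E; apply: hom_ext => x; have [z <-] := qo.1 x.
  by rewrite hE -h'E.
have [d [r [ro rk]]] := conc_quot fam (subgroup_gclosure sr) (@gclosure_closed _ _).
have rf x : r (f x) = 0 by apply/rk/sub_gclosure; exists x.
have zr : is_zero_morphism (C := conc) (cont_hom_comp r f) by apply/conc_zero_morphism.
have [h [hE _]] := qu d r zr.
have {}hE x : h (q x) = r x by rewrite -hE.
have qk x : r x = 0 -> q x = 0.
  move=> /rk xf; have /= hc := @ker_closed _ _ q (@conc_sep fam c) x; apply: hc.
  by move=> V /xf [_ [z _ <-] Vz]; exists (f z) => //; exact: qf.
have [g gE] := open_surj_factor ro qk.
have gh x : g (h x) = x.
  have zq : is_zero_morphism (C := conc) (cont_hom_comp q f) by apply/conc_zero_morphism.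
  have [h1 [_ h1u]] := qu c q zq.
  have E1 := h1u (cont_hom_id (U c)) (comp1m _).
  have E2 : h1 = cont_hom_comp g h by apply: h1u; apply: hom_ext => y /=; rewrite hE gE.
  by have := congr1 (fun h : cont_hom (U c) (U c) => h x) (etrans (esym E2) E1).
split; last first.
  move=> x; rewrite -rk; split=> [qx|/qk //].
  by rewrite -hE qx hom0.
split=> [y|V /ro.2 V0].
  by have [x xE] := ro.1 (h y); exists x; rewrite -gE xE gh.
have := cont_hom0 h V0; apply: filterS => y /= [x Vx xy].
by exists x => //; rewrite -gE xy gh.
Qed.

Lemma conc_is_kernel a b (k : cont_hom (U a) (U b)) :
  is_kernel (C := conc) k <-> embedding k /\ gclosed (range k).
Proof.
split=> [[c [f /conc_kernelP [ke kf]]]|[ke kc]].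
  split=> //; rewrite (_ : range k = [set x | f x = 0]).
    by apply: ker_closed; exact: conc_sep.
  apply/seteqP; split=> [_ [y _ <-]|x /kf [y <-]]; last by exists y.
  by apply/kf; exists y.
have [c [q [qo qk]]] := conc_quot fam (range_subgroup k) kc.
exists c, q; apply/conc_kernelP; split=> // x; rewrite qk.
by split=> [[y _ <-]|[y <-]]; exists y.
Qed.

Lemma conc_is_cokernel b c (q : cont_hom (U b) (U c)) : is_cokernel (C := conc) q <-> open_surj q.
Proof.
split=> [[a [f /conc_cokernelP []]] //|qo].
have kc := @ker_closed _ _ q (@conc_sep fam c).
have [a [i [ie ir]]] := conc_sub fam (ker_subgroup q) kc.
exists a, i; apply/conc_cokernelP; split=> // x; rewrite ir.
by split=> [qx|/kc //]; exact: sub_gclosure.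
Qed.

Lemma conc_short_exact a b c (i : cont_hom (U a) (U b)) (p : cont_hom (U b) (U c)) :
  short_exact (C := conc) i p ->
  [/\ embedding i, open_surj p & forall x, p x = 0 <-> exists y, i y = x].
Proof. by move=> [/conc_kernelP [ie ip] /conc_cokernelP [po _]]. Qed.

Lemma conc_additive : additive_category conc.
Proof.
unshelve eexists (@Preadditive conc (fun a b f g => cont_hom_add f g)
  (fun a b => cont_hom_zero (U a) (U b)) (fun a b f => cont_hom_opp f) _ _ _ _ _ _).
- by move=> a b f g h; apply: hom_ext => x /=; rewrite addrA.
- by move=> a b f g; apply: hom_ext => x /=; rewrite addrC.
- by move=> a b f; apply: hom_ext => x /=; rewrite add0r.
- by move=> a b f; apply: hom_ext => x /=; rewrite addNr.
- by move=> a b c g g' f; apply: hom_ext.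
- by move=> a b c g f f'; apply: hom_ext => x /=; rewrite homD.
split; first by have [z z0] := conc_zero fam; exists z; apply/conc_zero_object.
move=> a b; have [c [i [j [p [q [pi qj pj qi ijpq]]]]]] := conc_prod fam a b.
exists c, i, j, p, q; split; apply: hom_ext => x /=; first exact: pi.
- exact: qj.
- exact: pj.
- exact: qi.
- exact: ijpq.
Qed.

(** The pushout is compared with x0, the quotient of the sum of a and b by the elements (k z, - g
    z); they form a closed subgroup because [k] is a closed embedding. The properties of [j] are
    read off x0 through [phi], which has the left inverse [psi]. *)
Lemma conc_pushout_kernel a b c x (k : cont_hom (U c) (U a)) (g : cont_hom (U c) (U b))
    (i : cont_hom (U a) (U x)) (j : cont_hom (U b) (U x)) :
  is_kernel (C := conc) k -> is_pushout (C := conc) k g i j -> is_kernel (C := conc) j.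
Proof.
move=> /conc_is_kernel [ke kc] [ij0 univ].
have ij z : i (k z) = j (g z) := congr1 (fun h : cont_hom _ _ => h z) ij0.
have [d [ia [ib [pa [pb [pia pib paib pbia ipd]]]]]] := conc_prod fam a b.
pose n : cont_hom (U c) (U d) :=
  cont_hom_add (cont_hom_comp ia k) (cont_hom_opp (cont_hom_comp ib g)).
have pan z : pa (n z) = k z by rewrite /= homB pia paib subr0.
have pbn z : pb (n z) = - g z by rewrite /= homB pib pbia sub0r.
have eqd z z' : pa z = pa z' -> pb z = pb z' -> z = z'.
  by move=> ea eb; rewrite -(ipd z) -(ipd z') ea eb.
have nc : gclosed (range n).
  move=> z zn; have [y _ yz] : range k (pa z).
    apply: kc => V /(cont_hom0 pa) /zn [_ [y _ <-] Vy]; exists (k y); first by exists y.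
    by rewrite -pan -homB.
  exists y => //; apply: eqd; rewrite ?pan ?pbn //.
  apply/eqP; rewrite eq_sym -subr_eq0 opprK; apply/eqP; apply: (@conc_sep fam) => V.
  move=> /nbhs0_sym [W [W0 Wn WV _]].
  have [Z Z0 ZW] := ke.2 _ (cont_hom0 g W0).
  have [_ [y' _ <-] [Wy' Zy']] := zn _ (filterI (cont_hom0 pb W0) (cont_hom0 pa Z0)).
  have Wg : W (g (y' - y)) by apply: ZW; rewrite homB yz -pan -homB.
  move: Wy'; rewrite /= homB pbn => Wy'.
  rewrite (_ : pb z + g y = - (- g y' - pb z) + - g (y' - y)); last by zmod.
  by apply: WV; exact: Wn.
have [x0 [q [qo qk]]] := conc_quot fam (range_subgroup n) nc.
have [phi [[phii phij] _]] : exists! h : cont_hom (U x) (U x0),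
    cont_hom_comp h i = cont_hom_comp q ia /\ cont_hom_comp h j = cont_hom_comp q ib.
  apply: univ; apply: hom_ext => z /=; apply/eqP; rewrite -subr_eq0 -homB.
  by apply/eqP/qk; exists z.
have {}phii z : phi (i z) = q (ia z) := congr1 (fun h : cont_hom _ _ => h z) phii.
have {}phij z : phi (j z) = q (ib z) := congr1 (fun h : cont_hom _ _ => h z) phij.
have [psi psiE] : exists psi : cont_hom (U x0) (U x),
    forall z, psi (q z) = i (pa z) + j (pb z).
  apply: (open_surj_factor (f := cont_hom_add (cont_hom_comp i pa) (cont_hom_comp j pb)) qo).
  by move=> z /qk [y _ <-] /=; rewrite -/(n y) pan pbn ij homN subrr.
have psiphi w : psi (phi w) = w.
  have [h [_ hu]] := univ x i j ij0.
  have E1 := hu (cont_hom_id (U x)) (conj (comp1m _) (comp1m _)).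
  have E2 : h = cont_hom_comp psi phi.
    apply: hu; split; apply: hom_ext => z /=.
      by rewrite phii psiE pia pbia hom0 addr0.
    by rewrite phij psiE pib paib hom0 add0r.
  by have := congr1 (fun h : cont_hom (U x) (U x) => h w) (etrans (esym E2) E1).
apply/conc_is_kernel; split; first split.
- move=> y y' /(congr1 phi); rewrite !phij => /eqP; rewrite -subr_eq0 -homB.
  move=> /eqP/qk [z _]; rewrite -homB => zE.
  have := congr1 pa zE; have := congr1 pb zE; rewrite pan pbn pib paib => gz kz.
  have z0 : z = 0 by apply: ke.1; rewrite kz hom0.
  by apply/eqP; rewrite -subr_eq0 -gz z0 hom0 oppr0.
- move=> V /nbhs0_sym [W [W0 Wn WV _]].
  have [Z Z0 ZW] := ke.2 _ (cont_hom0 g W0).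
  have Y0 : nbhs 0 (pb @^-1` W `&` pa @^-1` (fun z => Z (- z))).
    by apply: filterI; [exact: cont_hom0|apply: cont_hom0; exact: nbhs0_opp].
  exists (phi @^-1` (q @` (pb @^-1` W `&` pa @^-1` (fun z => Z (- z))))).
    by apply: cont_hom0; exact: qo.2.
  move=> y /= [z [Wz Zz]]; rewrite phij => /eqP; rewrite eq_sym -subr_eq0 -homB.
  move=> /eqP/qk [t _ tE].
  have := congr1 pa tE; have := congr1 pb tE.
  rewrite pan pbn !homB pib paib sub0r => gt kt.
  have -> : y = pb z + - g t by rewrite gt addrC subrK.
  by apply: WV => //; apply/Wn/ZW; rewrite kt.
(* The range of [j] is closed as the kernel of the map from x to the cokernel of [k]. *)
have [C [r [ro rk]]] := conc_quot fam (range_subgroup k) kc.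
have [s sE] : exists s : cont_hom (U x0) (U C), forall z, s (q z) = r (pa z).
  apply: (open_surj_factor (f := cont_hom_comp r pa) qo) => z /qk [y _ <-] /=.
  by rewrite -/(n y) pan; apply/rk; exists y.
rewrite (_ : range j = [set w | cont_hom_comp s phi w = 0]).
  by apply: ker_closed; exact: conc_sep.
apply/seteqP; split=> [_ [y _ <-]|w] /=; first by rewrite phij sE paib hom0.
have [z zw] := qo.1 (phi w); rewrite -zw sE => /rk [y _ yz].
exists (g y + pb z) => //.
by rewrite -[RHS]psiphi -zw psiE -yz ij homD.
Qed.

(** The explicit pullback x0 of the pairs with e u = g y maps to x by [phi], and q after phi is the
    second coordinate; its surjectivity and openness pass to [q]. *)
Lemma conc_pullback_cokernel a b c x (e : cont_hom (U a) (U c)) (g : cont_hom (U b) (U c))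
    (p : cont_hom (U x) (U a)) (q : cont_hom (U x) (U b)) :
  is_cokernel (C := conc) e -> is_pullback (C := conc) e g p q -> is_cokernel (C := conc) q.
Proof.
move=> /conc_is_cokernel eo [_ univ].
have [d [ia [ib [pa [pb [pia pib paib pbia ipd]]]]]] := conc_prod fam a b.
pose n : cont_hom (U d) (U c) :=
  cont_hom_add (cont_hom_comp e pa) (cont_hom_opp (cont_hom_comp g pb)).
have [x0 [i [ie ir]]] := conc_sub fam (ker_subgroup n) (@ker_closed _ _ n (@conc_sep fam c)).
have iP z : e (pa z) = g (pb z) -> exists y, i y = z.
  move=> eg; have : [set x | n x = 0] z by rewrite /= eg subrr.
  by rewrite -ir => -[y _ <-]; exists y.
have iE y : e (pa (i y)) = g (pb (i y)).
  have : range i (i y) by exists y.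
  by rewrite ir /= => /eqP; rewrite subr_eq0 => /eqP.
have [phi [[_ phiq] _]] : exists! h : cont_hom (U x0) (U x),
    cont_hom_comp p h = cont_hom_comp pa i /\ cont_hom_comp q h = cont_hom_comp pb i.
  by apply: univ; apply: hom_ext => y /=; exact: iE.
have {}phiq y : q (phi y) = pb (i y) := congr1 (fun h : cont_hom _ _ => h y) phiq.
have lift u y : e u = g y -> exists w, i w = ia u + ib y.
  move=> uy; apply: iP.
  have -> : pa (ia u + ib y) = u by rewrite homD pia paib addr0.
  by have -> : pb (ia u + ib y) = y by rewrite homD pbia pib add0r.
apply/conc_is_cokernel; split=> [y|V V0].
  have [u uy] := eo.1 (g y); have [w wE] := lift u y uy; exists (phi w).
  by rewrite phiq wE homD pib pbia add0r.
have [Z Z0 ZV] := ie.2 _ (cont_hom0 phi V0).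
have [Y [Y0 _ YZ _]] := nbhs0_sym Z0.
have N0 : nbhs 0 (ib @^-1` Y `&` g @^-1` (e @` (ia @^-1` Y))).
  by apply: filterI; [exact: cont_hom0|apply: cont_hom0; apply: eo.2; exact: cont_hom0].
apply: filterS N0 => y [/= Yy [u /= Yu uy]]; have [w wE] := lift u y uy.
exists (phi w); first by apply: ZV; rewrite wE; exact: YZ.
by rewrite phiq wE homD pib pbia add0r.
Qed.

End ConcreteCategory.

(** * Finite limits and colimits *)

Section FiniteLimits.
Variables (Ob : Type) (U : Ob -> topologicalZmodType).
Hypothesis fam : concrete_family U.

Let hom_ext (G H : topologicalZmodType) (f g : cont_hom G H) : (forall x, f x = g x) -> f = g.
Proof. exact: cont_hom_ext. Qed.

(** The maps are indexed by all of [T], with value zero outside [s]; [dfwith] inserts the new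
    component into these dependent families. *)
Lemma conc_seq_product (T : eqType) (x : T -> Ob) (s : seq T) : uniq s ->
  exists b (inj : forall t, cont_hom (U (x t)) (U b)) (prj : forall t, cont_hom (U b) (U (x t))),
  [/\ forall t, t \in s -> forall y, prj t (inj t y) = y,
      forall t t', t \in s -> t' \in s -> t != t' -> forall y, prj t' (inj t y) = 0
    & forall z, \sum_(t <- s) inj t (prj t z) = z].
Proof.
elim: s => [_|a s IH /= /andP[as_ us]].
  have [z z0] := conc_zero fam.
  exists z, (fun t => cont_hom_zero (U (x t)) (U z)), (fun t => cont_hom_zero (U z) (U (x t))).
  by split=> // y; rewrite (z0 y) (z0 (\sum_(_ <- _) _)).
have [b [inj [prj [pi pi0 ip]]]] := IH us.
have [c [i [j [p [q [ppi qj pj qi ijpq]]]]]] := conc_prod fam (x a) b.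
pose inj' := dfwith (fun t => cont_hom_comp j (inj t)) a i.
pose prj' := dfwith (fun t => cont_hom_comp (prj t) q) a p.
have inja : inj' a = i by rewrite /inj' dfwithin.
have prja : prj' a = p by rewrite /prj' dfwithin.
have injs t : t \in s -> inj' t = cont_hom_comp j (inj t).
  by move=> ts; rewrite /inj' dfwithout //; apply: contraNneq as_ => ->.
have prjs t : t \in s -> prj' t = cont_hom_comp (prj t) q.
  by move=> ts; rewrite /prj' dfwithout //; apply: contraNneq as_ => ->.
exists c, inj', prj'; split.
- move=> t; rewrite inE => /orP[/eqP-> y|ts y]; first by rewrite inja prja ppi.
  by rewrite injs // prjs //= qj pi.
- move=> t t'; rewrite !inE => /orP[/eqP->|ts] /orP[/eqP->|ts'] tt' y.
  + by rewrite eqxx in tt'.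
  + by rewrite inja prjs //= qi hom0.
  + by rewrite prja injs //= pj.
  + by rewrite injs // prjs //= qj pi0.
- move=> z; rewrite big_cons inja prja -[RHS]ijpq; congr (_ + _).
  rewrite -[in RHS](ip (q z)) hom_sum; apply: eq_big_seq => t ts.
  by rewrite injs // prjs.
Qed.

Lemma conc_finite_product (T : finType) (x : T -> Ob) :
  exists b (inj : forall t, cont_hom (U (x t)) (U b)) (prj : forall t, cont_hom (U b) (U (x t))),
  [/\ forall t y, prj t (inj t y) = y,
      forall t t', t != t' -> forall y, prj t' (inj t y) = 0
    & forall z, \sum_t inj t (prj t z) = z].
Proof.
have [b [inj [prj [pi pi0 ip]]]] := conc_seq_product x (index_enum_uniq T).
exists b, inj, prj; split=> // [t|t t'].
  by apply: pi; rewrite mem_index_enum.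
by apply: pi0; rewrite mem_index_enum.
Qed.

Section Diagram.
Variables (J : finite_category) (F : functor J (conc U)).

Let X (j : obj J) : topologicalZmodType := U (F j).
Let D (j k : obj J) (u : Defs.hom j k) : cont_hom (X j) (X k) := Defs.fmap F u.

(* Testing against all topological groups makes the notion independent of the
   ambient full subcategory, hence preserved by inclusions. *)
Definition top_limit (L : topologicalZmodType) (p : forall j, cont_hom L (X j)) : Prop :=
  forall (T : topologicalZmodType) (q : forall j, cont_hom T (X j)),
  (forall j k (u : Defs.hom j k) x, D u (q j x) = q k x) ->
  exists h : cont_hom T L, (forall j x, p j (h x) = q j x) /\
    forall h' : cont_hom T L, (forall j x, p j (h' x) = q j x) -> h' = h.

(** Only Hausdorff targets are tested, because the colimit divides by a closed subgroup. *)
Definition top_colimit (L : topologicalZmodType) (i : forall j, cont_hom (X j) L) : Prop :=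
  forall (T : topologicalZmodType) (g : forall j, cont_hom (X j) T), separated T ->
  (forall j k (u : Defs.hom j k) x, g k (D u x) = g j x) ->
  exists h : cont_hom L T, (forall j x, h (i j x) = g j x) /\
    forall h' : cont_hom L T, (forall j x, h' (i j x) = g j x) -> h' = h.

Lemma top_limit_is_limit (l : cone F) : top_limit (cone_leg l) -> is_limit l.
Proof.
move=> ll c; have [|h [hE hu]] := @ll _ (cone_leg c).
  by move=> j k u x; rewrite -(cone_comm c u).
exists h; split=> [j|h' h'E]; first by apply: hom_ext => x; exact: hE.
by apply/esym/hu => j x; rewrite -h'E.
Qed.

Lemma top_colimit_is_colimit (l : cocone F) : top_colimit (cocone_leg l) -> is_colimit l.
Proof.
move=> ll c; have [|j k u x|h [hE hu]] := @ll _ (cocone_leg c); first exact: conc_sep fam _.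
  by rewrite -(cocone_comm c u).
exists h; split=> [j|h' h'E]; first by apply: hom_ext => x; exact: hE.
by apply/esym/hu => j x; rewrite -h'E.
Qed.

Lemma exists_top_limit : exists l : cone F, top_limit (cone_leg l).
Proof.
have [b [inj [prj [pi pi0 ip]]]] := @conc_finite_product (fin_obj J) F.
pose N : set (U b) := [set z | forall j k (u : Defs.hom j k), D u (prj j z) = prj k z].
have sN : subgroup N.
  by split=> [j k u|y z Ny Nz j k u]; rewrite ?hom0 // !homB Ny Nz.
have cN : gclosed N.
  move=> z Nz j k u; apply/eqP; rewrite -subr_eq0; apply/eqP.
  have /= cl := @ker_closed _ _ (cont_hom_add (cont_hom_comp (D u) (prj j))
    (cont_hom_opp (prj k))) (@conc_sep _ _ fam _) z.
  apply: cl => V /Nz [y Ny Vy]; exists y => //=.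
  by rewrite Ny subrr.
have [c [i [ie ir]]] := conc_sub fam sN cN.
have iN y : N (i y) by rewrite -ir; exists y.
have comm (j k : obj J) (u : Defs.hom j k) :
    cont_hom_comp (D u) (cont_hom_comp (prj j) i) = cont_hom_comp (prj k) i.
  by apply: hom_ext => y; apply: iN.
exists (@Cone J (conc U) F c (fun j => cont_hom_comp (prj j) i) comm) => T q qN /=.
have [h0 h0E] := hom_sum_exists (index_enum (fin_obj J)) (fun j => cont_hom_comp (inj j) (q j)).
have ph0 j x : prj j (h0 x) = q j x.
  rewrite h0E hom_sum (bigD1 j) //= pi big1 ?addr0 // => k kj.
  by rewrite pi0.
have [h hE] : exists h : cont_hom T (U c), forall x, i (h x) = h0 x.
  apply: embedding_factor ie _ => x.
  have : N (h0 x) by move=> j k u; rewrite !ph0.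
  by rewrite -ir => -[y _ <-]; exists y.
exists h; split=> [j x|h' h'E]; first by rewrite hE ph0.
apply: hom_ext => x; apply: ie.1; rewrite hE -(ip (i (h' x))) h0E.
by apply: eq_bigr => j _; rewrite /= -h'E.
Qed.

Lemma exists_top_colimit : exists l : cocone F, top_colimit (cocone_leg l).
Proof.
have [b [inj [prj [pi pi0 ip]]]] := @conc_finite_product (fin_obj J) F.
pose good (N : set (U b)) := [/\ subgroup N, gclosed N
  & forall (j k : obj J) (u : Defs.hom j k) y, N (inj j y - inj k (D u y))].
(* The least closed subgroup containing the relations of the diagram; the kernel of a compatible map
   to a Hausdorff group is one of the [K]. *)
pose N : set (U b) := [set z | forall K, good K -> K z].
have sN : subgroup N.
  split=> [K [sK _ _]|y z Ny Nz K gK]; first exact: sK.1.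
  by have [sK _ _] := gK; apply: sK.2; [exact: Ny|exact: Nz].
have cN : gclosed N.
  move=> z Nz K gK; have [_ cK _] := gK; apply: cK => V /Nz [y Ny Vy].
  by exists y => //; exact: Ny.
have [c [q [qo qk]]] := conc_quot fam sN cN.
have comm (j k : obj J) (u : Defs.hom j k) :
    cont_hom_comp (cont_hom_comp q (inj k)) (D u) = cont_hom_comp q (inj j).
  apply: hom_ext => y /=; apply/eqP; rewrite eq_sym -subr_eq0 -homB; apply/eqP/qk => K [_ _ gK].
  exact: gK.
exists (@Cocone J (conc U) F c (fun j => cont_hom_comp q (inj j)) comm) => T g sT gN /=.
have [h0 h0E] := hom_sum_exists (index_enum (fin_obj J)) (fun j => cont_hom_comp (g j) (prj j)).
have h0i j y : h0 (inj j y) = g j y.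
  rewrite h0E (bigD1 j) //= pi big1 ?addr0 // => k kj.
  by rewrite pi0 ?hom0 // eq_sym.
have [h hE] : exists h : cont_hom (U c) T, forall z, h (q z) = h0 z.
  apply: open_surj_factor qo _ => z /qk Nz.
  apply: (Nz [set z | h0 z = 0]); split=> [||j k u y /=].
  - exact: ker_subgroup.
  - exact: ker_closed.
  - by rewrite homB !h0i gN subrr.
exists h; split=> [j x|h' h'E]; first by rewrite hE.
apply: hom_ext => y; have [z <-] := qo.1 y; rewrite hE h0E -[in LHS](ip z) !hom_sum.
by apply: eq_bigr => j _; rewrite h'E.
Qed.

(** A limit tested only inside the category is a retract, by [psi] and [phi], of the explicit limit,
    and so inherits the stronger property. *)
Lemma conc_is_limitP (l : cone F) : is_limit l <-> top_limit (cone_leg l).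
Proof.
split=> [ll|]; last exact: top_limit_is_limit.
have [l0 ll0] := exists_top_limit.
have [psi [psiE _]] := ll l0.
have [phi [phiE _]] := (top_limit_is_limit ll0) l.
have psiphi x : psi (phi x) = x.
  have [h [_ hu]] := ll l.
  have E1 := hu (idm _) (fun j => compm1 _).
  have E2 : h = (psi \oc phi)%cat by apply: hu => j; rewrite Defs.compA psiE phiE.
  by have := congr1 (fun h : cont_hom _ _ => h x) (etrans (esym E2) E1).
move=> T q qN; have [h0 [h0E h0u]] := ll0 T q qN.
exists (cont_hom_comp psi h0); split=> [j x|h h_E].
  by rewrite -h0E -psiE.
apply: hom_ext => x; rewrite /= -(h0u (cont_hom_comp phi h)) ?psiphi //= => j y.
by rewrite -h_E -phiE.
Qed.

Lemma conc_is_colimitP (l : cocone F) : is_colimit l <-> top_colimit (cocone_leg l).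
Proof.
split=> [ll|]; last exact: top_colimit_is_colimit.
have [l0 ll0] := exists_top_colimit.
have [psi [psiE _]] := ll l0.
have [phi [phiE _]] := (top_colimit_is_colimit ll0) l.
have phipsi x : phi (psi x) = x.
  have [h [_ hu]] := ll l.
  have E1 := hu (idm _) (fun j => comp1m _).
  have E2 : h = (phi \oc psi)%cat by apply: hu => j; rewrite -Defs.compA psiE phiE.
  by have := congr1 (fun h : cont_hom _ _ => h x) (etrans (esym E2) E1).
move=> T g sT gN; have [h0 [h0E h0u]] := ll0 T g sT gN.
exists (cont_hom_comp h0 psi); split=> [j x|h h_E].
  by rewrite -h0E -psiE.
apply: hom_ext => x; rewrite /= -(h0u (cont_hom_comp h phi)) /= ?phipsi // => j y.
by rewrite -h_E -phiE.
Qed.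

End Diagram.

Lemma conc_quasi_abelian : quasi_abelian (conc U).
Proof.
split.
- exact: conc_additive.
- by move=> J F; have [l ll] := exists_top_limit F; exists l; exact: top_limit_is_limit.
- by move=> J F; have [l ll] := exists_top_colimit F; exists l; exact: top_colimit_is_colimit.
- by move=> a b c x k g i j; exact: (@conc_pushout_kernel _ _ fam).
- by move=> a b c x e g p q; exact: (@conc_pullback_cokernel _ _ fam).
Qed.

End FiniteLimits.

(** The class [K] is realised by [U] up to equality, so that a constructed group can be substituted
    by an object together with its maps. *)
Lemma concrete_family_class (Ob : Type) (U : Ob -> topologicalZmodType)
    (K : topologicalZmodType -> Prop) :
  (forall a, K (U a)) -> (forall G, K G -> exists a, U a = G) ->
  (forall G, K G -> polish_group G) ->
  (forall G H (i : cont_hom H G), K G -> embedding i -> gclosed (range i) -> K H) ->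
  (forall G H (q : cont_hom G H), K G -> open_surj q -> separated H -> K H) ->
  (forall G H, K G -> K H -> K (prod_top G H)) ->
  (exists2 G : topologicalZmodType, K G & forall x : G, x = 0) ->
  concrete_family U.
Proof.
move=> KU UK pK Ksub Kquot Kprod [Z KZ Z0]; split.
- by move=> a; have [] := pK _ (KU a).
- move=> a N sN cN; have [H [i [ie ir]]] := subgroup_exists sN.
  have KH : K H by apply: (Ksub _ _ i) => //; rewrite ir.
  by have [b bE] := UK _ KH; subst H; exists b, i.
- move=> a N sN cN; have [Q [q [qo qk]]] := quotient_exists sN.
  have KQ : K Q.
    apply: (Kquot _ _ q) => //; apply/(open_surj_separated qo).
    by rewrite (_ : mkset _ = N) //; apply/seteqP; split=> x /qk.
  by have [b bE] := UK _ KQ; subst Q; exists b, q.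
- move=> a b; have [i [j [p [q [iE jE pE qE]]]]] := biproduct_exists (U a) (U b).
  have [c cE] := UK _ (Kprod _ _ (KU a) (KU b)).
  (* The five equations no longer mention pairs, which allows the product to be rewritten as U c. *)
  have : exists (i : cont_hom (U a) (prod_top (U a) (U b)))
      (j : cont_hom (U b) (prod_top (U a) (U b))) (p : cont_hom (prod_top (U a) (U b)) (U a))
      (q : cont_hom (prod_top (U a) (U b)) (U b)),
      [/\ forall x, p (i x) = x, forall y, q (j y) = y, forall y, p (j y) = 0,
          forall x, q (i x) = 0 & forall z, i (p z) + j (q z) = z].
    exists i, j, p, q; split=> [x|y|y|x|[x y]]; rewrite ?(iE, jE, pE, qE) //=.
    by congr pair; rewrite ?addr0 ?add0r.
  by rewrite -cE => ?; exists c.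
- by have [z zE] := UK _ KZ; subst Z; exists z.
Qed.

(** * Polish and pro-Lie Polish groups *)

Section ProLiePolish.
Variable R : realType.

Definition polish_gp (a : obj (PAb R)) : topologicalZmodType := sval a.

Definition prolie_gp (a : obj (full_subcat (@proLie R))) : topologicalZmodType :=
  polish_gp (sval a).

Lemma polish_gpP (a : obj (PAb R)) : polish_group (polish_gp a).
Proof. by case: a => G pG; apply/(polishP R). Qed.

Lemma proLieP (a : obj (PAb R)) : proLie a <-> prolie R (polish_gp a).
Proof. exact: pro_lieP (polish_gpP a). Qed.

Lemma polish_gp_exists (G : topologicalZmodType) : polish_group G ->
  exists a : obj (PAb R), polish_gp a = G.
Proof. by move=> /(polishP R) pG; exists (exist _ G pG). Qed.

Lemma polish_concrete_family : concrete_family polish_gp.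
Proof.
apply: (concrete_family_class (K := @polish_group)) => //.
- exact: polish_gpP.
- exact: polish_gp_exists.
- by move=> G H i pG ie ic; exact: (polish_closed_subgroup ie).
- by move=> G Q q pG qo sQ; exact: (polish_quotient qo).
- exact: polish_prod.
have Z0 (x : 'rV[R]_0) : x = 0 := thinmx0 x.
by exists 'rV[R]_0 => //; exact: polish_trivial.
Qed.

Lemma prolie_concrete_family : concrete_family prolie_gp.
Proof.
apply: (concrete_family_class (K := fun G => polish_group G /\ prolie R G)).
- by move=> [a la]; split; [exact: polish_gpP|apply/proLieP].
- move=> G [pG lG]; have [a aE] := polish_gp_exists pG.
  have la : proLie a by apply/proLieP; rewrite aE.
  by exists (exist _ a la).
- by move=> G [].
- move=> G H i [pG lG] ie ic; split; first exact: (polish_closed_subgroup ie).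
  by have [_ sG bG cG] := pG; exact: (prolie_closed_subgroup ie).
- move=> G Q q [pG lG] qo sQ; split; first exact: (polish_quotient qo).
  exact: (prolie_quotient qo).
- move=> G H [pG lG] [pH lH]; split; first exact: polish_prod.
  by have [_ sG _ _] := pG; have [_ sH _ _] := pH; exact: prolie_prod.
have Z0 (x : 'rV[R]_0) : x = 0 := thinmx0 x.
by exists 'rV[R]_0 => //; split; [exact: polish_trivial|exact: prolie_trivial].
Qed.

Lemma proLie_extension_closed : extension_closed (@proLie R).
Proof.
move=> b' a b'' i p ip /proLieP lb' /proLieP lb''.
have [ie po pk] := conc_short_exact polish_concrete_family ip.
exists a; split; last by exists (idm a), (idm a); split; exact: Defs.comp1m.
have [_ sa _ _] := polish_gpP a; have [_ sb _ _] := polish_gpP b''.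
by apply/proLieP; exact: (prolie_extension sa sb ie po pk).
Qed.

End ProLiePolish.

Theorem theorem3p14 (R : realType) : @thick_subcategory (PAb R) (@proLie R).
Proof.
have fL := prolie_concrete_family R; have fP := polish_concrete_family R.
split; last exact: proLie_extension_closed.
- exact: (conc_quasi_abelian fL).
(* [top_limit] mentions only the underlying groups, so [ll] is also the statement for the included
   cone. *)
- move=> J F l /(conc_is_limitP fL) ll.
  exact: (top_limit_is_limit (U := @polish_gp R) (l := map_cone (inclusion (@proLie R)) l) ll).
- move=> J F l /(conc_is_colimitP fL) ll.
  exact: (top_colimit_is_colimit fP (l := map_cocone (inclusion (@proLie R)) l) ll).
Qed.
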